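(* Let $\vec p=(p_1,\dots,p_n)$ with $1<p_i<\infty$ for all $i$, let $0<q\le\infty$, $1<v<\infty$ and $0\le\lambda<\sum_{i=1}^n\frac1{p_i}$. Then there is a constant $C>0$ such that for every sequence $\{f_j\}_{j=1}^\infty$ of measurable functions on $\mathbb R^n$, $$\left\|\left(\sum_{j=1}^\infty (Mf_j)^v\right)^{1/v}\right\|_{LM^\lambda_{\vec p,q}}\le C\left\|\left(\sum_{j=1}^\infty |f_j|^v\right)^{1/v}\right\|_{LM^\lambda_{\vec p,q}}.$$
   Context: Mixed Lebesgue norm: for $\vec p=(p_1,\dots,p_n)$ and $f$ measurable on $\mathbb R^n$, $$\|f\|_{L_{\vec p}}=\left(\int_{\mathbb R}\cdots\left(\int_{\mathbb R}\left(\int_{\mathbb R}|f(x_1,\dots,x_n)|^{p_1}dx_1\right)^{p_2/p_1}dx_2\right)^{p_3/p_2}\cdots dx_n\right)^{1/p_n},$$ and $\|f\|_{L_{\vec p}(E)}=\|f\chi_E\|_{L_{\vec p}}$. Local mixed Morrey (quasi-)norm: $$\|f\|_{LM^\lambda_{\vec p,q}}=\left(\int_0^\infty\left(r^{-\lambda}\|f\|_{L_{\vec p}(Q(0,r))}\right)^q\frac{dr}{r}\right)^{1/q},$$ with $\sup_{r>0}r^{-\lambda}\|f\|_{L_{\vec p}(Q(0,r))}$ when $q=\infty$; here $Q(0,r)=B(0,r)=\{x\in\mathbb R^n:|x|<r\}$. $M$ is the Hardy–Littlewood maximal operator, $Mf(x)=\sup_{B\ni x}\frac1{|B|}\int_B|f(y)|dy$,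 the supremum being over open balls $B$ containing $x$. *)

(* Defs.v *)
From HB Require Import structures.
From mathcomp Require Import all_boot all_order all_algebra.
From mathcomp Require Import all_classical all_reals all_analysis.
From mathcomp Require Import measurable_realfun.

Set Implicit Arguments.
Unset Strict Implicit.
Unset Printing Implicit Defensive.

Import Order.TTheory GRing.Theory Num.Theory.
Import numFieldNormedType.Exports.

Local Open Scope classical_set_scope.
Local Open Scope ring_scope.
Local Open Scope ereal_scope.

(* Tuples carry the product of the Borel sigma-algebras of the factors, so that
   Rn R n is R^n with its Borel sigma-algebra. *)
Notation Rn R n := (n.-tuple (measurableTypeR R)).

Section LebesgueRn.
Context {R : realType}.

Definition consRn n (z : measurableTypeR R * Rn R n) : Rn R n.+1 :=
  [tuple of z.1 :: z.2].

(* The measure on R^n.+1 is the product of the measure on R (coordinate 0) and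
   the measure on R^n (remaining coordinates), transported along consRn. *)
Fixpoint lebesgueRn (n : nat) : set (Rn R n) -> \bar R :=
  match n with
  | 0 => \d_([tuple] : Rn R 0)
  | m.+1 => pushforward (lebesgue_measure \x @lebesgueRn m) (@consRn m)
  end.

Lemma measurable_consRn n : measurable_fun [set: _] (@consRn n).
Proof. exact: (@measurable_cons _ _ _ _ fst n snd). Qed.

Let unconsRn n (x : Rn R n.+1) : measurableTypeR R * Rn R n :=
  (thead x, [tuple of behead x]).

Let measurable_unconsRn n : measurable_fun [set: _] (@unconsRn n).
Proof.
apply/measurable_fun_pairP; split => /=; first exact: measurable_tnth.
exact: measurable_behead.
Qed.

Let consRnK n : cancel (@consRn n) (@unconsRn n).
Proof.
by move=> [x y]; congr pair; rewrite /= ?theadE//; apply/val_inj.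
Qed.

Section product_step.
Variables (n : nat) (mu : {sigma_finite_measure set (Rn R n) -> \bar R}).

Let m : set (Rn R n.+1) -> \bar R :=
  pushforward (lebesgue_measure \x mu) (@consRn n).

Let m_preimage A : measurable A -> measurable (@consRn n @^-1` A).
Proof.
by move=> mA; rewrite -[X in measurable X]setTI; exact: measurable_consRn.
Qed.

Let m0 : m set0 = 0.
Proof. by rewrite /m /pushforward preimage_set0 measure0. Qed.

Let m_ge0 A : 0 <= m A.
Proof. by rewrite /m /pushforward; exact: measure_ge0. Qed.

Let m_sigma_additive : semi_sigma_additive m.
Proof.
move=> F mF tF mUF; rewrite /m /pushforward preimage_bigcup.
apply: measure_semi_sigma_additive.
- by move=> k; exact: m_preimage.
- apply/trivIsetP => /= i j _ _ ij; rewrite -preimage_setI.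
  by move/trivIsetP : tF => /(_ _ _ _ _ ij) ->//; rewrite preimage_set0.
- by rewrite -preimage_bigcup; exact: m_preimage.
Qed.

HB.instance Definition _ := isMeasure.Build _ _ _ m m0 m_ge0 m_sigma_additive.

Let m_sigma_finite : sigma_finite setT m.
Proof.
have /sigma_finiteP[F [FT ndF Foo]] := sigma_finiteT (@lebesgue_measure R).
have /sigma_finiteP[G [GT ndG Goo]] := sigma_finiteT mu.
exists (fun k => @unconsRn n @^-1` (F k `*` G k)).
  rewrite -preimage_bigcup (_ : \bigcup_k _ = setT) ?preimage_setT//.
  apply/seteqP; split=> // -[x y] _.
  have [i _ Fx] : (\bigcup_k F k) x by rewrite -FT.
  have [j _ Gy] : (\bigcup_k G k) y by rewrite -GT.
  exists (maxn i j) => //; split => /=.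
  - by move: x Fx; exact/subsetPset/ndF/leq_maxl.
  - by move: y Gy; exact/subsetPset/ndG/leq_maxr.
move=> k; have [mF Fk] := Foo k; have [mG Gk] := Goo k; split.
  rewrite -[X in measurable X]setTI; apply: measurable_unconsRn => //.
  exact: measurableX.
rewrite /m /pushforward -comp_preimage.
rewrite (_ : _ \o _ = id); last by apply/funext => z; exact: consRnK.
by rewrite preimage_id product_measure1E// lte_mul_pinfty// ge0_fin_numE.
Qed.

HB.instance Definition _ := Measure_isSigmaFinite.Build _ _ _ m m_sigma_finite.

Lemma lebesgueRn_step :
  exists nu : {sigma_finite_measure set (Rn R n.+1) -> \bar R}, nu = m :> (_ -> _).
Proof. by exists m. Qed.

End product_step.

Let lebesgueRn_sigma_finite_measure n :
  exists mu : {sigma_finite_measure set (Rn R n) -> \bar R},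
    mu = @lebesgueRn n :> (_ -> _).
Proof.
elim: n => [|n [mu muE]] /=; first by exists \d_([tuple] : Rn R 0).
by rewrite -muE; exact: lebesgueRn_step.
Qed.

Let lebesgueRn0 n : @lebesgueRn n set0 = 0.
Proof. by have [mu <-] := lebesgueRn_sigma_finite_measure n; exact: measure0. Qed.

Let lebesgueRn_ge0 n A : 0 <= @lebesgueRn n A.
Proof.
by have [mu <-] := lebesgueRn_sigma_finite_measure n; exact: measure_ge0.
Qed.

Let lebesgueRn_sigma_additive n : semi_sigma_additive (@lebesgueRn n).
Proof.
have [mu <-] := lebesgueRn_sigma_finite_measure n.
exact: measure_semi_sigma_additive.
Qed.

HB.instance Definition _ n := isMeasure.Build _ _ _ (@lebesgueRn n)
  (@lebesgueRn0 n) (@lebesgueRn_ge0 n) (@lebesgueRn_sigma_additive n).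

Let lebesgueRn_sigma_finite n : sigma_finite setT (@lebesgueRn n).
Proof.
by have [mu <-] := lebesgueRn_sigma_finite_measure n; exact: sigma_finiteT.
Qed.

HB.instance Definition _ n := Measure_isSigmaFinite.Build _ _ _ (@lebesgueRn n)
  (@lebesgueRn_sigma_finite n).

End LebesgueRn.
Arguments lebesgueRn {R} n.

(* f is measurable for the completion of the Borel sigma-algebra, that is, for
   the sigma-algebra of Lebesgue measurable sets. *)
Definition lebesgue_measurable_fun (R : realType) (n : nat)
    (f : Rn R n -> \bar R) :=
  measurable_fun
    [set: g_sigma_algebraType (completed_algebra_gen (@lebesgueRn R n))] f.

(* Euclidean distance; the library's norm on vectors is the sup norm. *)
Definition eucl_dist (R : realType) (n : nat) (x y : Rn R n) : R :=
  Num.sqrt (\sum_(i < n) (tnth x i - tnth y i) ^+ 2)%R.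

Definition eball (R : realType) (n : nat) (y : Rn R n) (r : R) : set (Rn R n) :=
  [set x | (eucl_dist x y < r)%R].

Definition Q0 (R : realType) (n : nat) (r : R) : set (Rn R n) :=
  eball ([tuple of nseq n 0%R] : Rn R n) r.

(* The library defines the integral of every nonnegative function as the supremum
   of the integrals of the Borel simple functions below it. For a Lebesgue
   measurable function this is the usual Lebesgue integral, so the definitions
   below are meaningful for functions that are not Borel measurable. *)

(* The integration in the first coordinate is the innermost one: taking the
   L_{p_1} norm in x_1 leaves a function of (x_2, ..., x_n), whose mixed norm
   with exponents (p_2, ..., p_n) is then taken. *)
Fixpoint mixed_norm (R : realType) (n : nat) :
    n.-tuple R -> (Rn R n -> \bar R) -> \bar R :=
  match n with
  | 0 => fun _ f => `| f [tuple] |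
  | m.+1 => fun p f =>
      @mixed_norm R m [tuple of behead p]
        (fun x => Lnorm lebesgue_measure (thead p)%:E
                    (fun x1 => f [tuple of x1 :: x]))
  end.

Definition local_morrey_norm (R : realType) (n : nat) (p : n.-tuple R)
    (lam : R) (q : \bar R) (f : Rn R n -> \bar R) : \bar R :=
  let N r := (r `^ (- lam)%R)%:E * mixed_norm p (f \_ (@Q0 R n r)) in
  match q with
  | q'%:E => (\int[lebesgue_measure]_(r in `]0%R, +oo[) (N r `^ q' * (r^-1)%:E))
               `^ q'^-1
  | +oo => ereal_sup [set N r | r in `]0%R, +oo[]
  | -oo => 0
  end.

(* The balls are parametrized by center and radius. *)
Definition maximal_op (R : realType) (n : nat) (f : Rn R n -> \bar R)
    (x : Rn R n) : \bar R :=
  ereal_sup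
    [set (\int[lebesgueRn n]_(y in eball b.1 b.2) `|f y|)
           / lebesgueRn n (eball b.1 b.2)
    | b in [set b : Rn R n * R | (0 < b.2)%R /\ eball b.1 b.2 x]].

Definition lv_norm (R : realType) (T : Type) (v : R) (g : nat -> T -> \bar R)
    (x : T) : \bar R :=
  (\sum_(0 <= j <oo) `|g j x| `^ v) `^ v^-1.

(* Main.v *)
Require Import Defs.
From HB Require Import structures.
From mathcomp Require Import all_boot all_order all_algebra.
From mathcomp Require Import all_classical all_reals all_analysis.
From mathcomp Require Import zify ring lra measurable_realfun.

(** The idea is to dominate the Hardy-Littlewood operator M by maximal operators in
    one variable at a time, for which weighted inequalities are available, and to
    reduce the Morrey norm to mixed Lebesgue norms over balls centered at the
    origin.

    One dimension. Among finitely many intervals with a common point two cover the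
    others, so a finite family of intervals can be thinned out to overlap at most
    twice without changing its union. Hence the maximal function over intervals is
    bounded on L^p(nu), p > 1, for every measure nu on the line that is finite on
    bounded intervals, with a constant that depends on p only (maxfun_strong). For
    a weight w in the Muckenhoupt class A_p this gives the weighted inequality for
    Lebesgue averages by Lerner's argument (Ap_maximal), which uses the uniform
    bound for the two measures w dt and w^(-1/(p-1)) dt.

    Extrapolation. Summing damped iterates of the maximal operator yields A_1
    majorants (A1_majorant), and quotients of powers of such majorants are A_p
    weights (Ap_of_A1). So an inequality between two functions that holds in
    L^p0(W) for all W in A_p0 holds in L^p(w) for all p > 1 and all w in A_p
    (extrapolation_pair). Consequently, if the maximal operator in a variable t is
    bounded on L^s(w dt; X), for all s > 1 and all w in A_s, with values in a
    normed space of functions X, then so it is with values in L^p(X): for s = p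
    this is Fubini's theorem, and the other s follow by extrapolation
    (maximal_regular_Lp). Starting from scalars, one reaches l^v and then the
    spaces L^p1(l^v), L^p2(L^p1(l^v)), and so on. Applying the maximal operators in
    x_1, ..., x_n successively, one obtains the vector-valued inequality for the
    iterated operator in mixed norm (strong_max_vector_valued). A ball being
    contained in a box of comparable volume, the iterated operator dominates M.

    Morrey norms. On Q0 (s / (2 n)) the function M f is at most a multiple of the
    sum of the iterated maximal function of the restriction of f to Q0 s and of the
    l^v norm in k of the averages of |f| over the balls Q0 (2^k s)
    (maximal_op_le_local_far). The first term is bounded in mixed norm by the
    previous paragraph. The averages do not depend on the point; since each of them
    is in turn bounded by an iterated maximal function on the whole ball, their l^v
    norm B_k satisfies B_k ||1_(Q0 (2^k s))|| <= C ||F||_(Q0 (2^k s)), where F is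
    the l^v norm of the sequence. As the norm of the indicator of Q0 r is
    comparable with r^sigma, sigma = sum 1/p_i, the quantities N(r) = r^(-lam)
    ||F||_(Q0 r) satisfy: the analogue of N for M is at most, at r = s / (2 n), a
    multiple of sup_k theta^k N(2^k s), where theta < 1 because lam < sigma
    (local_estimate). Taking L^q norms with respect to the dilation invariant
    measure dr / r concludes (morrey_maximal_borel).

    Measurability. The functions f_j are Lebesgue measurable, whereas the above is
    carried out for Borel functions. Each |f_j| has a Borel minorant with the same
    integrals (exists_borel_minorant), hence with the same maximal function, and
    replacing |f_j| by it can only decrease the right-hand side. *)

Set Implicit Arguments.
Unset Strict Implicit.
Unset Printing Implicit Defensive.

Import Order.TTheory GRing.Theory Num.Theory.
Import numFieldNormedType.Exports.

Local Open Scope classical_set_scope.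
Local Open Scope ring_scope.
Local Open Scope ereal_scope.

(** * Extended real powers and lower integrals *)

Section ereal_prelim.
Context {R : realType}.
Implicit Types x y z : \bar R.

Lemma lee_poweR x y (r : R) : (0 <= r)%R -> 0 <= x -> x <= y ->
  x `^ r <= y `^ r.
Proof.
move=> r0 x0 xy; apply: gt0_ler_poweR => //; rewrite in_itv/= leey ?x0//.
by rewrite (le_trans x0).
Qed.

Lemma poweRVK x (r : R) : (r != 0)%R -> 0 <= x -> (x `^ r) `^ r^-1 = x.
Proof. by move=> r0 x0; rewrite -poweRrM divff// poweRe1. Qed.

Lemma poweRKV x (r : R) : (r != 0)%R -> 0 <= x -> (x `^ r^-1) `^ r = x.
Proof. by move=> r0 x0; rewrite -poweRrM mulVf// poweRe1. Qed.

Lemma poweRD_le x y (r : R) : (0 < r)%R -> 0 <= x -> 0 <= y ->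
  (x + y) `^ r <= (2 `^ r)%:E * (x `^ r + y `^ r).
Proof.
move=> r0 x0 y0.
have key a b : 0 <= a -> 0 <= b -> a <= b ->
    (a + b) `^ r <= (2 `^ r)%:E * (a `^ r + b `^ r).
  move=> a0 b0 ab; rewrite -poweR_EFin.
  apply: (@le_trans _ _ ((2%:E * b) `^ r)).
    apply: lee_poweR; rewrite ?(ltW r0) ?adde_ge0//.
    by rewrite (_ : 2%:E = 1%:E + 1%:E) ?ge0_muleDl ?mul1e ?leeD2r// -EFinD.
  by rewrite poweRM// lee_wpmul2l ?poweR_ge0// leeDr// poweR_ge0.
by case: (leP x y) => [|/ltW] xy; [|rewrite addeC [x `^ r + _]addeC]; apply: key.
Qed.

End ereal_prelim.

Section measurable_power.
Context d (T : measurableType d) (R : realType).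

Lemma measurableT_comp_powR (f : T -> R) (r : R) :
  measurable_fun setT f -> measurable_fun setT (fun x => f x `^ r)%R.
Proof. exact: (@measurableT_comp _ _ _ _ _ _ (@powR R ^~ r)). Qed.

Lemma measurableT_comp_poweR (f : T -> \bar R) (r : R) :
  measurable_fun setT f -> measurable_fun setT (fun x => f x `^ r).
Proof. exact: (measurableT_comp (measurable_poweR r)). Qed.

End measurable_power.

Section integral_prelim.
Context d (T : measurableType d) (R : realType).
Variable mu : {measure set T -> \bar R}.
Implicit Types f g : T -> \bar R.

(** The integral of a nonnegative function is a supremum over the simple functions
    below it, so monotonicity holds without measurability. This form lets M f be
    compared with other functions without discussing whether M f is measurable. *)
Lemma ge0_le_integralW (D : set T) f g :
  (forall x, D x -> 0 <= f x) -> (forall x, D x -> f x <= g x) ->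
  \int[mu]_(x in D) f x <= \int[mu]_(x in D) g x.
Proof.
move=> f0 fg; have g0 x : D x -> 0 <= g x.
  by move=> Dx; rewrite (le_trans (f0 x Dx))// fg.
rewrite (integral_mkcond _ f) (integral_mkcond _ g).
have f'0 x : 0 <= (f \_ D) x by rewrite patchE; case: ifPn => // /set_mem/f0.
have g'0 x : 0 <= (g \_ D) x by rewrite patchE; case: ifPn => // /set_mem/g0.
rewrite !ge0_integralTE//; apply: ereal_sup_le => _ [h hf <-]; exists h => // x.
by rewrite (le_trans (hf x))// !patchE; case: ifPn => // /set_mem/fg.
Qed.

End integral_prelim.

(** * A covering lemma for intervals *)

Section interval_covering.
Context {R : realType}.
Local Notation RR := (measurableTypeR R).
Implicit Types (I : R * R) (l : seq (R * R)) (x : RR).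

Definition oitv I : set RR := `]I.1, I.2[%classic.
Definition inoitv x I : bool := ((I.1 < x) && (x < I.2))%R.
Definition Uoitv l : set RR := [set x | has (inoitv x) l].

Lemma measurable_oitv I : measurable (oitv I).
Proof. exact: measurable_itv. Qed.

Lemma oitvE I x : oitv I x = inoitv x I.
Proof. by rewrite /oitv /inoitv/= in_itv. Qed.

Lemma Uoitv_cons I l : Uoitv (I :: l) = oitv I `|` Uoitv l.
Proof.
apply/seteqP; split => x; rewrite /Uoitv /setU /mkset oitvE/=.
  by move=> /orP.
by move=> /orP.
Qed.

Lemma Uoitv_nil : Uoitv [::] = set0.
Proof. by apply/seteqP; split. Qed.

Lemma measurable_Uoitv l : measurable (Uoitv l).
Proof.
elim: l => [|I l IHl]; first by rewrite Uoitv_nil.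
by rewrite Uoitv_cons; apply: measurableU => //; exact: measurable_oitv.
Qed.

Lemma perm_Uoitv l1 l2 : perm_eq l1 l2 -> Uoitv l1 = Uoitv l2.
Proof.
move=> l12; apply/funext => x; rewrite /Uoitv /mkset.
by rewrite (eq_has_r (perm_mem l12)).
Qed.

Lemma oitv_sub_setU x (I J K : R * R) : inoitv x I -> inoitv x J -> inoitv x K ->
  ((J.1 <= I.1) || (K.1 <= I.1))%R -> ((I.2 <= J.2) || (I.2 <= K.2))%R ->
  oitv I `<=` oitv J `|` oitv K.
Proof.
move=> /andP[xI1 xI2] /andP[xJ1 xJ2] /andP[xK1 xK2] H1 H2 y.
rewrite /setU /mkset !oitvE /inoitv => /andP[y1 y2].
have [yx|/ltW xy] := leP y x.
  by case/orP: H1 => h; [left|right]; rewrite (le_lt_trans h)//= (le_lt_trans yx).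
by case/orP: H2 => h; [left|right]; rewrite (lt_le_trans y2 h) andbT (lt_le_trans _ xy).
Qed.

(** When three intervals share a point, one reaching furthest to the left and one
    reaching furthest to the right cover the remaining one. *)
Lemma three_oitv x (I J K : R * R) : inoitv x I -> inoitv x J -> inoitv x K ->
  [\/ oitv I `<=` oitv J `|` oitv K, oitv J `<=` oitv I `|` oitv K |
      oitv K `<=` oitv I `|` oitv J].
Proof.
move=> xI xJ xK.
have : [|| ((J.1 <= I.1) || (K.1 <= I.1)) && ((I.2 <= J.2) || (I.2 <= K.2)),
  ((I.1 <= J.1) || (K.1 <= J.1)) && ((J.2 <= I.2) || (J.2 <= K.2)) |
  ((I.1 <= K.1) || (J.1 <= K.1)) && ((K.2 <= I.2) || (K.2 <= J.2))]%R.
  case: (lerP I.1 J.1) => h1; case: (lerP I.1 K.1) => h2;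
  case: (lerP J.1 K.1) => h3; case: (lerP I.2 J.2) => h4;
  case: (lerP I.2 K.2) => h5; case: (lerP J.2 K.2) => h6;
  rewrite ?(ltW h1) ?(ltW h2) ?(ltW h3) ?(ltW h4) ?(ltW h5) ?(ltW h6) ?orbT//=; lra.
case/or3P => /andP[h1 h2].
- by apply: Or31; apply: (oitv_sub_setU xI xJ xK).
- by apply: Or32; apply: (oitv_sub_setU xJ xI xK).
- by apply: Or33; apply: (oitv_sub_setU xK xI xJ).
Qed.

(** By three_oitv, one of three intervals through x is covered by the two others,
    hence can be discarded without changing the union. *)
Lemma redundant_oitv x l : (2 < count (inoitv x) l)%N ->
  exists2 J, J \in l & oitv J `<=` Uoitv (rem J l).
Proof.
have ex P : (0 < count P l -> exists2 I, I \in l & P I)%N by rewrite -has_count => /hasP.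
have cntE J l' : J \in l' -> count (inoitv x) l' = (inoitv x J + count (inoitv x) (rem J l'))%N.
  by move=> Jl; rewrite (permP (perm_to_rem Jl)).
move=> c2; have /ex[I Il xI] : (0 < count (inoitv x) l)%N by exact: ltn_trans c2.
move: (cntE _ _ Il) c2; rewrite xI => -> c2.
have /hasP[J Jl xJ] : has (inoitv x) (rem I l) by rewrite has_count; lia.
move: (cntE _ _ Jl) c2; rewrite xJ => -> c2.
have /hasP[K Kl xK] : has (inoitv x) (rem J (rem I l)) by rewrite has_count; lia.
pose l' := rem K (rem J (rem I l)).
have pl : perm_eq l [:: I, J, K & l'].
  rewrite (perm_trans (perm_to_rem Il))// perm_cons.
  rewrite (perm_trans (perm_to_rem Jl))// perm_cons.
  exact: perm_to_rem.
have main A B C : perm_eq l [:: A, B, C & l'] -> oitv A `<=` oitv B `|` oitv C ->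
    exists2 J, J \in l & oitv J `<=` Uoitv (rem J l).
  move=> pA sA; have Al : A \in l by rewrite (perm_mem pA) mem_head.
  exists A => //; apply: (subset_trans sA).
  rewrite (@perm_Uoitv _ [:: B, C & l']) ?Uoitv_cons; first by rewrite setUA; exact: subsetUl.
  by rewrite -(perm_cons A) -(permPl (perm_to_rem Al)).
case: (three_oitv xI xJ xK) => sub; [apply: main sub|apply: main sub|apply: main sub] => //.
  by rewrite (permPl pl); exact: (permEl (perm_catCA [:: I] [:: J] (K :: l'))).
by rewrite (permPl pl); exact: (permEl (perm_catCA [:: I; J] [:: K] l')).
Qed.

End interval_covering.

Section weak_type.
Context {R : realType}.
Local Notation RR := (measurableTypeR R).
Variables (nu : {measure set RR -> \bar R}) (f : RR -> \bar R).
Hypotheses (f0 : forall x, 0 <= f x) (mf : measurable_fun setT f).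
Implicit Types l : seq (R * R).

Lemma measure_Uoitv_le l : nu (Uoitv l) <= \sum_(I <- l) nu (oitv I).
Proof.
elim: l => [|I l IHl]; first by rewrite Uoitv_nil measure0 big_nil.
rewrite Uoitv_cons big_cons (le_trans _ (leeD2l _ IHl))//.
by apply: measureU2; [exact: measurable_oitv|exact: measurable_Uoitv].
Qed.

Lemma sum_integral_oitv_le l : (forall x, count (inoitv x) l <= 2)%N ->
  \sum_(I <- l) \int[nu]_(x in oitv I) f x <= 2%:E * \int[nu]_(x in Uoitv l) f x.
Proof.
move=> l2; under eq_bigr do rewrite integral_mkcond.
rewrite -ge0_integral_sum//; last 2 first.
- move=> I; apply/(measurable_restrictT _ _).1 => //; first exact: measurable_oitv.
  exact: measurable_funS mf.
- by move=> I x _; rewrite patchE; case: ifPn.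
rewrite -ge0_integralZl//; last 2 first.
- exact: measurable_Uoitv.
- exact: measurable_funS mf.
rewrite [leRHS]integral_mkcond.
apply: ge0_le_integralW => x _.
  by apply: sume_ge0 => I _; rewrite patchE; case: ifPn.
have -> : \sum_(I <- l) (f \_ (oitv I)) x = f x *+ count (inoitv x) l.
  rewrite (eq_bigr (fun I => if inoitv x I then f x else 0)); last first.
    move=> I _; rewrite patchE; case: ifPn; first by rewrite inE oitvE => ->.
    by rewrite notin_setE oitvE => /negP/negbTE->.
  by rewrite -big_mkcond/= big_const_seq iter_addr_0.
rewrite patchE; case: ifPn => [_|].
  have := l2 x; case: count => [|[|[|//]]] _; first by rewrite mule_ge0.
    by change (f x *+ 1) with (f x); rewrite lee_pemull// lee_fin ler1n.
  change (f x *+ 2) with (f x + f x).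
  by rewrite -[in leLHS](mul1e (f x)) -ge0_muleDl.
rewrite notin_setE /Uoitv/= => /negP; rewrite has_count -leqNgt leqn0 => /eqP->.
by [].
Qed.

(** The family can be thinned out, keeping its union, until no point belongs to
    three intervals; then the integrals over the intervals add up to at most twice
    the integral over the union. The measure is arbitrary: an interval covered by
    the others is discarded, and no interval is ever enlarged. *)
Lemma weak_type_intervals l (v : R) : (0 <= v)%R ->
  (forall I, I \in l -> v%:E * nu (oitv I) <= \int[nu]_(x in oitv I) f x) ->
  v%:E * nu (Uoitv l) <= 2%:E * \int[nu]_(x in Uoitv l) f x.
Proof.
move=> v0; have [n] := ubnP (size l); elim: n l => // n IHn l /ltnSE ln vl.
have [[x xl]|l2] := pselect (exists x, 2 < count (inoitv x) l)%N.
  have [J Jl sub] := redundant_oitv xl.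
  have <- : Uoitv (rem J l) = Uoitv l.
    by rewrite (perm_Uoitv (perm_to_rem Jl)) Uoitv_cons setUidr.
  apply: IHn => [|I /mem_rem]; last exact: vl.
  by rewrite size_rem// (leq_trans _ ln)// prednK// -has_predT; apply/hasP; exists J.
have {}l2 x : (count (inoitv x) l <= 2)%N.
  by rewrite leqNgt; apply/negP => xl; apply: l2; exists x.
apply: (le_trans _ (sum_integral_oitv_le l2)).
apply: (@le_trans _ _ (\sum_(I <- l) v%:E * nu (oitv I))).
  rewrite -ge0_sume_distrr//.
  by rewrite lee_wpmul2l//; exact: measure_Uoitv_le.
by rewrite big_seq [leRHS]big_seq; apply: lee_sum => I /vl.
Qed.

End weak_type.

(** * From weak type to strong type *)

(** Young's inequality for v and u^(p-1). It compares the increments of t^p with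
    those of t^(p-1), as required by summation by parts over the levels of a
    function. *)
Lemma powR_slope_le (R : realType) (p u v : R) : (1 < p)%R -> (0 <= u)%R -> (u <= v)%R ->
  (v `^ p - u `^ p <= p / (p - 1) * (v * (v `^ (p - 1) - u `^ (p - 1))))%R.
Proof.
move=> p1 u0 uv; have v0 := le_trans u0 uv; have p0 : (0 < p)%R by lra.
have q0 : (0 < p / (p - 1))%R by rewrite divr_gt0//; lra.
have pne : p != 0%R by rewrite gt_eqF.
have p1ne : (p - 1)%R != 0%R by rewrite gt_eqF//; lra.
have := @conjugate_powR _ v (u `^ (p - 1))%R p (p / (p - 1))%R v0 (powR_ge0 _ _) p0 q0.
rewrite -powRrM (_ : ((p - 1) * (p / (p - 1)) = p)%R); last by field; rewrite ?pne ?p1ne.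
rewrite invf_div mulrBr mulr_powRB1//.
set V := (v `^ p)%R; set U := (u `^ p)%R; set W := (v * u `^ (p - 1))%R => /(_ _)/wrap[].
  by field; rewrite ?pne ?p1ne.
move=> WVU.
have : (p / (p - 1) * W <= p / (p - 1) * (V / p + U * ((p - 1) / p)))%R.
  by rewrite ler_pM2l.
have -> : (p / (p - 1) * (V / p + U * ((p - 1) / p)) = V / (p - 1) + U)%R.
  by field; rewrite ?pne ?p1ne.
have -> : (p / (p - 1) * (V - W) = V + V / (p - 1) - p / (p - 1) * W)%R.
  by field; rewrite ?pne ?p1ne.
lra.
Qed.

Section monotone_sup.
Context d (T : measurableType d) (R : realType).
Variable mu : {measure set T -> \bar R}.

Lemma integral_ereal_sup_le (g : (T -> \bar R)^nat) (K : \bar R) :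
  (forall n, measurable_fun setT (g n)) -> (forall n x, 0 <= g n x) ->
  (forall x, nondecreasing_seq (g ^~ x)) ->
  (forall n, \int[mu]_x g n x <= K) ->
  \int[mu]_x ereal_sup (range (g ^~ x)) <= K.
Proof.
move=> mg g0 ndg gK.
have gE x : ereal_sup (range (g ^~ x)) = limn (g ^~ x).
  by apply/esym/cvg_lim => //; exact: ereal_nondecreasing_cvgn.
under eq_integral do rewrite gE.
rewrite monotone_convergence//.
apply: lime_le; last by apply: nearW => n; exact: gK.
apply: ereal_nondecreasing_is_cvgn => m n mn.
by apply: ge0_le_integralW => x _ //; exact: ndg.
Qed.

Lemma poweR_ereal_sup_le (g : (\bar R)^nat) (p : R) : (0 < p)%R ->
  (forall n, 0 <= g n) ->
  ereal_sup (range g) `^ p <= ereal_sup (range (fun n => g n `^ p)).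
Proof.
move=> p0 g0; have pne : p != 0%R by rewrite gt_eqF.
have h0 : 0 <= ereal_sup (range (fun n => g n `^ p)).
  by apply: (@le_trans _ _ (g 0%N `^ p)); [exact: poweR_ge0|apply: ereal_sup_ubound; exists 0%N].
rewrite -[leRHS](poweRKV pne)//; apply: lee_poweR; rewrite ?(ltW p0)//.
  by rewrite (le_trans (g0 0%N))//; apply: ereal_sup_ubound; exists 0%N.
apply: ge_ereal_sup => _ [n _ <-].
rewrite -[leLHS](poweRVK pne)//; apply: lee_poweR; rewrite ?invr_ge0 ?(ltW p0) ?poweR_ge0//.
by apply: ereal_sup_ubound; exists n.
Qed.

End monotone_sup.

Section weak_to_strong.
Context d (T : measurableType d) (R : realType).
Variables (nu : {measure set T -> \bar R}) (f : T -> \bar R) (m : T -> R).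
Variables (p A : R).
Hypotheses (p1 : (1 < p)%R) (A0 : (0 <= A)%R).
Hypotheses (f0 : forall x, 0 <= f x) (mf : measurable_fun setT f).
Hypotheses (m0 : forall x, (0 <= m x)%R) (mm : measurable_fun setT m).
Hypothesis weak : forall v, (0 < v)%R ->
  v%:E * nu [set x | (v <= m x)%R] <= A%:E * \int[nu]_(x in [set x | (v <= m x)%R]) f x.

Let p0 : (0 < p)%R. Proof. exact: lt_trans ltr01 p1. Qed.

Let excess (r u : R) (x : T) : R := if (u < m x)%R then (m x `^ r - u `^ r)%R else 0%R.

Let excess_ge0 r u x : (0 <= r)%R -> (0 <= u)%R -> (0 <= excess r u x)%R.
Proof.
move=> r0 u0; rewrite /excess; case: ifPn => // umx; rewrite subr_ge0.
by apply: ge0_ler_powR; rewrite // ?nnegrE ?m0// ltW.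
Qed.

Let measurable_excess r u : measurable_fun setT (excess r u).
Proof.
apply: measurable_fun_ifT => //; first exact: measurable_fun_ltr.
by apply: measurable_funB => //; exact: measurableT_comp_powR.
Qed.

Let measurable_superlevel v : measurable [set x | (v <= m x)%R].
Proof.
by rewrite -[X in measurable X]setTI; exact: measurable_fun_le.
Qed.

(** Peeling off the smallest value v of m above the level u. *)
Let excess_step r u v vs x : (u < v)%R -> path <%R v vs ->
  (forall x, (u < m x)%R -> m x \in v :: vs) ->
  excess r u x = (excess r v x + (v `^ r - u `^ r) * \1_[set x | (v <= m x)%R] x)%R.
Proof.
move=> uv vvs umx; rewrite /excess indicE.
have vle y : y \in v :: vs -> (v <= y)%R.
  rewrite inE => /predU1P[->//|]; move: vvs; rewrite (path_sortedE lt_trans).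
  by move=> /andP[/allP h _] /h /ltW.
have [umx'|mxu] := ltP u (m x).
  have vm := vle _ (umx _ umx'); rewrite mem_set// mulr1.
  move: vm; rewrite le_eqVlt => /predU1P[<-|->]; first by rewrite ltxx add0r.
  by rewrite addrA subrK.
have mv := le_lt_trans mxu uv; rewrite memNset/=; last by apply/negP; rewrite -ltNge.
by rewrite ltNge (ltW mv) mulr0 addr0.
Qed.

Let excess_le vs u : (0 <= u)%R -> path <%R u vs ->
  (forall x, (u < m x)%R -> m x \in vs) ->
  \int[nu]_x (excess p u x)%:E <=
    (A * (p / (p - 1)))%:E * \int[nu]_x (f x * (excess (p - 1) u x)%:E).
Proof.
have pB0 : (0 <= p - 1)%R by rewrite subr_ge0 ltW.
have q0 : (0 < p / (p - 1))%R by rewrite divr_gt0// subr_gt0.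
elim: vs u => [|v vs IHvs] u u0 /=.
  move=> _ umx; rewrite integral0_eq; last first.
    by move=> x _; rewrite /excess; case: ifPn => // /umx; rewrite in_nil.
  apply: mule_ge0; first by rewrite lee_fin mulr_ge0// ltW.
  by apply: integral_ge0 => x _; apply: mule_ge0 => //; rewrite lee_fin excess_ge0.
move=> /andP[uv vvs] umx; have v0 := le_lt_trans u0 uv.
pose E := [set x | (v <= m x)%R].
have step r x := @excess_step r u v vs x uv vvs umx.
have vur r : (0 <= r)%R -> (0 <= v `^ r - u `^ r)%R.
  by move=> r0; rewrite subr_ge0; apply: ge0_ler_powR; rewrite // ?nnegrE ltW.
have mE : measurable E by exact: measurable_superlevel.
have m1E : measurable_fun setT (\1_E : T -> R) by exact: measurable_indic.
under eq_integral => x _ do rewrite step EFinD.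
rewrite ge0_integralD//; last 4 first.
- by move=> x _; rewrite lee_fin excess_ge0 ?(ltW v0) ?(ltW p0).
- exact/measurable_EFinP.
- by move=> x _; rewrite lee_fin mulr_ge0 ?vur ?(ltW p0).
- by apply/measurable_EFinP; exact: measurable_funM.
have -> : \int[nu]_x ((v `^ p - u `^ p) * \1_E x)%:E = (v `^ p - u `^ p)%:E * nu E.
  under eq_integral do rewrite EFinM.
  rewrite ge0_integralZl_EFin ?integral_indic ?setIT//; last exact: vur (ltW p0).
  exact/measurable_EFinP.
have -> : \int[nu]_x (f x * (excess (p - 1) u x)%:E) =
    \int[nu]_x (f x * (excess (p - 1) v x)%:E) +
    (v `^ (p - 1) - u `^ (p - 1))%:E * \int[nu]_(x in E) f x.
  under eq_integral => x _ do rewrite step EFinD ge0_muleDr ?lee_fin ?excess_ge0 ?mulr_ge0 ?vur ?(ltW v0)//.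
  rewrite ge0_integralD//; last 4 first.
  - by move=> x _; rewrite mule_ge0// lee_fin excess_ge0 ?(ltW v0) ?(ltW p0).
  - by apply: emeasurable_funM => //; exact/measurable_EFinP.
  - by move=> x _; rewrite mule_ge0// lee_fin mulr_ge0 ?vur.
  - by apply: emeasurable_funM => //; apply/measurable_EFinP; exact: measurable_funM.
  congr (_ + _); rewrite [in RHS]integral_mkcond -ge0_integralZl_EFin ?vur//; last 2 first.
  - by move=> x _; rewrite patchE; case: ifPn.
  - apply/(measurable_restrictT _ _).1 => //; exact: measurable_funS mf.
  apply: eq_integral => x _; rewrite patchE indicE; case: ifPn => xE; rewrite ?mulr1 ?mulr0 ?mule0//.
  by rewrite muleC.
rewrite ge0_muleDr; last 2 first.
- by apply: integral_ge0 => x _; rewrite mule_ge0// lee_fin excess_ge0 ?(ltW v0) ?(ltW p0).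
- by rewrite mule_ge0 ?lee_fin ?vur// integral_ge0.
apply: leeD; first by apply: IHvs => //; [exact: ltW|move=> x vx; have := umx x (lt_trans uv vx);
  rewrite inE gt_eqF].
set D := (v `^ (p - 1) - u `^ (p - 1))%R.
apply: (@le_trans _ _ ((p / (p - 1) * (v * D))%:E * nu E)).
  by rewrite lee_wpmul2r// lee_fin; exact: (powR_slope_le p1 u0 (ltW uv)).
have -> : (p / (p - 1) * (v * D))%:E * nu E = (p / (p - 1) * D)%:E * (v%:E * nu E).
  by rewrite muleA -EFinM; congr (_%:E * _); ring.
have -> I : (A * (p / (p - 1)))%:E * (D%:E * I) = (p / (p - 1) * D)%:E * (A%:E * I).
  by rewrite !muleA -!EFinM; congr (_%:E * _); ring.
by apply: lee_wpmul2l; [rewrite lee_fin mulr_ge0 ?vur// ltW|exact: weak].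
Qed.

(** The layer cake formula, summed by parts over the finitely many values of m: the
    weak type bound applies at each level. *)
Lemma weak_to_strong_finite_range (s : seq R) : (forall x, m x \in s) ->
  \int[nu]_x (m x `^ p)%:E <=
    (A * (p / (p - 1)))%:E * \int[nu]_x (f x * (m x `^ (p - 1))%:E).
Proof.
move=> ms; pose vs := sort <=%R (undup [seq y <- s | (0 < y)%R]).
have e0 r x : (r != 0)%R -> (m x `^ r)%R = excess r 0 x.
  move=> r0; rewrite /excess powR0// subr0; have := m0 x.
  by rewrite le_eqVlt => /predU1P[<-|->//]; rewrite ltxx powR0.
have p1ne : (p - 1)%R != 0%R by rewrite gt_eqF// subr_gt0.
under eq_integral do rewrite e0 ?(gt_eqF p0)//.
under [in leRHS]eq_integral do rewrite e0//.
apply: (@excess_le vs) => //.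
  rewrite path_min_sorted; last first.
    by apply/allP => y; rewrite mem_sort mem_undup mem_filter => /andP[].
  by rewrite lt_sorted_uniq_le sort_uniq undup_uniq sort_sorted//; exact: le_total.
by move=> x mx0; rewrite mem_sort mem_undup mem_filter mx0 ms.
Qed.

(** In weak_to_strong_finite_range the integrand f m^(p-1) is at most a multiple of
    f^p where m <= 2 C f, and elsewhere a small multiple of m^p, which is absorbed
    in the left-hand side since the latter is finite. *)
Lemma strong_type_finite_range (s : seq R) : (forall x, m x \in s) ->
  \int[nu]_x (m x `^ p)%:E < +oo ->
  \int[nu]_x (m x `^ p)%:E <=
    (2 * (2 * (A * (p / (p - 1)))) `^ p)%:E * \int[nu]_x (f x `^ p).
Proof.
move=> ms mfin; set C := (A * (p / (p - 1)))%R.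
have C0 : (0 <= C)%R by rewrite mulr_ge0// divr_ge0 ?subr_ge0 ?(ltW p0) ?(ltW p1).
have mmp r : measurable_fun setT (fun x => (m x `^ r)%:E).
  by apply/measurable_EFinP; exact: measurableT_comp_powR.
have mfp : measurable_fun setT (fun x => f x `^ p).
  exact: measurableT_comp_poweR.
have key x : C%:E * (f x * (m x `^ (p - 1))%:E) <=
    ((2 * C) `^ p)%:E * f x `^ p + 2^-1%:E * (m x `^ p)%:E.
  have [->|Cn0] := eqVneq C 0%R.
    by rewrite mul0e adde_ge0 ?mule_ge0 ?lee_fin ?powR_ge0 ?poweR_ge0.
  have Cp : (0 < C)%R by rewrite lt_neqAle eq_sym Cn0.
  have mp : (m x `^ p = m x * m x `^ (p - 1))%R by rewrite mulr_powRB1.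
  have [h|h] := leP (m x)%:E (2%:E * C%:E * f x).
    apply: (@le_trans _ _ (((2 * C) `^ p)%:E * f x `^ p)); last first.
      by rewrite leeDl// mule_ge0// lee_fin powR_ge0.
    have C2 : (0 <= 2 * C)%R by rewrite mulr_ge0.
    apply: (@le_trans _ _ ((2 * C)%:E * f x * (m x `^ (p - 1))%:E)).
      rewrite muleA; apply: lee_wpmul2r; first by rewrite lee_fin powR_ge0.
      by apply: lee_wpmul2r => //; rewrite lee_fin; lra.
    rewrite -(poweR_EFin (2 * C)) -poweRM ?lee_fin//; set y := _%:E * f x.
    have y0 : 0 <= y by rewrite mule_ge0 ?lee_fin.
    apply: (@le_trans _ _ (y * y `^ (p - 1))).
      apply: lee_wpmul2l => //; rewrite -poweR_EFin; apply: lee_poweR => //; first by rewrite subr_ge0 ltW.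
      by rewrite lee_fin.
    move: y0; case: (y) => [r| |]// r0.
    - by rewrite !poweR_EFin -EFinM mulr_powRB1.
    - by rewrite [leRHS]poweRyr ?gt_eqF// leey.
  have fx : f x \is a fin_num.
    rewrite ge0_fin_numE// ltey; apply/eqP => fx; move: h.
    rewrite fx -EFinM gt0_muley; last by rewrite lte_fin mulr_gt0.
    by rewrite ltNge leey.
  move: h; rewrite -(fineK fx) -!EFinM lte_fin => h.
  apply: (@le_trans _ _ (2^-1 * (m x `^ p))%:E); last first.
    by rewrite leeDr// lee_fin mulr_ge0// powR_ge0.
  rewrite lee_fin mp !mulrA ler_wpM2r ?powR_ge0//; lra.
have I0 : 0 <= \int[nu]_x (m x `^ p)%:E.
  by apply: integral_ge0 => x _; rewrite lee_fin powR_ge0.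
have I1 := weak_to_strong_finite_range ms.
have : \int[nu]_x (m x `^ p)%:E <= ((2 * C) `^ p)%:E * \int[nu]_x (f x `^ p) +
    2^-1%:E * \int[nu]_x (m x `^ p)%:E.
  apply: (le_trans I1); rewrite -!ge0_integralZl_EFin//; last 5 first.
  - by move=> x _; rewrite lee_fin powR_ge0.
  - by move=> x _; exact: poweR_ge0.
  - by rewrite powR_ge0.
  - by move=> x _; rewrite mule_ge0// lee_fin powR_ge0.
  - by apply: emeasurable_funM.
  rewrite -ge0_integralD//; last 4 first.
  - by move=> x _; rewrite mule_ge0 ?lee_fin ?powR_ge0 ?poweR_ge0.
  - exact: measurable_funeM.
  - by move=> x _; rewrite mule_ge0 ?lee_fin ?powR_ge0.
  - exact: measurable_funeM.
  by apply: ge0_le_integralW => x _; rewrite ?key// !mule_ge0 ?lee_fin ?powR_ge0.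
move: mfin I0 I1; case: (\int[nu]_x (m x `^ p)%:E) => [r| |]// _ r0 I1.
have : 0 <= \int[nu]_x (f x `^ p) by apply: integral_ge0 => x _; exact: poweR_ge0.
case: (\int[nu]_x (f x `^ p)) => [F| |]// F0.
  rewrite -!EFinM -EFinD !lee_fin => h; rewrite -mulrA; lra.
move=> _; have [C1|C1] := eqVneq C 0%R.
  have r0' : r%:E <= 0 by move: I1; rewrite -/C C1 mul0e.
  by rewrite (le_trans r0')// mule_ge0// lee_fin mulr_ge0// powR_ge0.
have Cp : (0 < C)%R by rewrite lt_neqAle eq_sym C1.
rewrite [leRHS]gt0_muley ?leey//; last by rewrite lte_fin mulr_gt0// powR_gt0// mulr_gt0.
Qed.

End weak_to_strong.

(** * The one-dimensional maximal function *)

Section maximal_function.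
Context {R : realType}.
Local Notation RR := (measurableTypeR R).
Implicit Types (nu : {measure set RR -> \bar R}) (f : RR -> \bar R).

Definition rat_itv (k : nat) : R * R :=
  if (unpickle k : option (rat * rat)) is Some ab then (ratr ab.1, ratr ab.2)
  else (0%R, 0%R).

Definition avg nu f (I : R * R) : \bar R :=
  (\int[nu]_(x in oitv I) f x) / nu (oitv I).

(** Rational endpoints make the supremum countable, hence measurable. *)
Definition maxfun nu f (x : RR) : \bar R :=
  ereal_sup (range (fun k => (\1_(oitv (rat_itv k)) x)%:E * avg nu f (rat_itv k))).

Lemma avg_ge0 nu f I : (forall x, 0 <= f x) -> 0 <= avg nu f I.
Proof. by move=> f0; rewrite mule_ge0 ?inve_ge0 ?integral_ge0. Qed.

Lemma avg_le_maxfun nu f k x : inoitv x (rat_itv k) ->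
  avg nu f (rat_itv k) <= maxfun nu f x.
Proof.
move=> xk; apply: ereal_sup_ubound; exists k => //.
by rewrite indicE mem_set ?oitvE// mul1e.
Qed.

Lemma maxfun_ge0 nu f x : (forall x, 0 <= f x) -> 0 <= maxfun nu f x.
Proof.
move=> f0; apply: le_ereal_sup_tmp.
exists ((\1_(oitv (rat_itv 0)) x)%:E * avg nu f (rat_itv 0)); first by exists 0%N.
by rewrite mule_ge0 ?avg_ge0// lee_fin.
Qed.

Lemma maxfun_le nu f x (K : \bar R) : 0 <= K ->
  (forall k, inoitv x (rat_itv k) -> avg nu f (rat_itv k) <= K) ->
  maxfun nu f x <= K.
Proof.
move=> K0 fK; apply: ge_ereal_sup => _ [k _ <-]; rewrite indicE.
case: (boolP (x \in _)) => [|_]; last by rewrite mul0e.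
by rewrite inE oitvE mul1e; exact: fK.
Qed.

Lemma measurable_ereal_supT d (T : measurableType d) (h : nat -> T -> \bar R) :
  (forall k, measurable_fun setT (h k)) ->
  measurable_fun setT (fun x => ereal_sup (range (h ^~ x))).
Proof.
move=> mh; rewrite (_ : (fun x => _) = (fun x => esups (h ^~ x) 0%N)).
  exact: measurable_fun_esups.
apply/funext => x; rewrite /esups/=; congr ereal_sup; apply/seteqP; split => y /=.
  by move=> [k _ <-]; exists k.
by move=> [k _ <-]; exists k.
Qed.

Lemma measurable_maxfun nu f : measurable_fun setT (maxfun nu f).
Proof.
apply: measurable_ereal_supT => k; apply: emeasurable_funM => //.
by apply/measurable_EFinP; apply: measurable_indic; exact: measurable_oitv.
Qed.

Definition strong_cst (p : R) : R := (2 * (2 * (2 * (p / (p - 1)))) `^ p)%R.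

Lemma strong_cst_gt0 p : (1 < p)%R -> (0 < strong_cst p)%R.
Proof.
move=> p1; rewrite mulr_gt0// powR_gt0// mulr_gt0// mulr_gt0// divr_gt0 ?subr_gt0//.
exact: lt_trans ltr01 p1.
Qed.

Section strong_type.
Variables (nu : {measure set RR -> \bar R}) (f : RR -> \bar R) (p : R).
Hypotheses (p1 : (1 < p)%R) (nufin : forall k, nu (oitv (rat_itv k)) < +oo).
Hypotheses (f0 : forall x, 0 <= f x) (mf : measurable_fun setT f).
Hypothesis fpfin : \int[nu]_x (f x `^ p) < +oo.

Let p0 : (0 < p)%R. Proof. exact: lt_trans ltr01 p1. Qed.
Let moitv I : measurable (oitv I : set RR). Proof. exact: measurable_oitv. Qed.

Let integral_fin k : \int[nu]_(x in oitv (rat_itv k)) f x < +oo.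
Proof.
have mfp : measurable_fun setT (fun x => f x `^ p) by exact: measurableT_comp_poweR.
apply: (@le_lt_trans _ _ (\int[nu]_(x in oitv (rat_itv k)) (cst 1 x + f x `^ p))).
  apply: ge0_le_integralW => // x _.
  have [fx1|/ltW fx1] := leP (f x) 1; first by rewrite (le_trans fx1)// leeDl// poweR_ge0.
  apply: (@le_trans _ _ (f x `^ p)); last by rewrite leeDr.
  move: fx1; case: (f x) => [r| |]//; last by rewrite poweRyr ?gt_eqF.
  by rewrite poweR_EFin !lee_fin => r1; rewrite le1r_powR// ltW.
rewrite ge0_integralD//; last 2 first.
- by move=> x _; exact: poweR_ge0.
- exact: measurable_funS mfp.
rewrite lte_add_pinfty ?integral_cst ?mul1e// (le_lt_trans _ fpfin)//.
by apply: ge0_subset_integral => // x _; exact: poweR_ge0.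
Qed.

Let c k : R := fine (avg nu f (rat_itv k)).

Let avg_fin k : avg nu f (rat_itv k) \is a fin_num.
Proof.
rewrite /avg; have [n0|n0] := eqVneq (nu (oitv (rat_itv k))) 0.
  rewrite null_set_integral ?mul0e//; last first.
  exact: measurable_funS mf.
rewrite fin_numM ?ge0_fin_numE ?integral_ge0 ?integral_fin ?inve_ge0//.
move: (nufin k) n0 (measure_ge0 nu (oitv (rat_itv k))).
by case: (nu _) => [r| |]//; rewrite eqe inver => _ /negbTE -> _; rewrite ltry.
Qed.

Let c_ge0 k : (0 <= c k)%R.
Proof. by rewrite /c fine_ge0// avg_ge0. Qed.

Let c_weak k : (c k)%:E * nu (oitv (rat_itv k)) <= \int[nu]_(x in oitv (rat_itv k)) f x.
Proof.
rewrite /c fineK// /avg; have [->|n0] := eqVneq (nu (oitv (rat_itv k))) 0.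
  by rewrite mule0 integral_ge0.
rewrite -muleA muleC -[leLHS]muleC [_ * nu _]muleC divee ?mule1//.
by rewrite ge0_fin_numE.
Qed.

(** The maximal function over the first N intervals: it has finitely many values,
    and its superlevel sets are finite unions of intervals. *)
Let m : nat -> RR -> R := fix m N x :=
  if N is N'.+1 then Num.max (m N' x) (c N' * \1_(oitv (rat_itv N')) x)%R else 0%R.

Let m_ge0 N x : (0 <= m N x)%R.
Proof. by elim: N => //= N IH; rewrite le_max IH. Qed.

Let measurable_m N : measurable_fun setT (m N).
Proof.
elim: N => [|N IH] /=; first exact: measurable_cst.
by apply: measurable_maxr => //; apply: measurable_funM.
Qed.

(** The intervals that make up the superlevel set of level v. *)
Let L v : nat -> seq (R * R) := fix L N :=
  if N is N'.+1 then (if (v <= c N')%R then rat_itv N' :: L N' else L N') else [::].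

Let superlevel_m v N : (0 < v)%R -> [set x | (v <= m N x)%R] = Uoitv (L v N).
Proof.
move=> v0; elim: N => [|N IH] /=.
  by rewrite Uoitv_nil; apply/seteqP; split => // x /=; rewrite leNgt v0.
have -> : [set x | (v <= Num.max (m N x) (c N * \1_(oitv (rat_itv N)) x))%R] =
    [set x | (v <= m N x)%R] `|` [set x | (v <= c N * \1_(oitv (rat_itv N)) x)%R].
  by apply/seteqP; split => x /=; rewrite le_max => /orP.
rewrite IH; case: ifPn => vc; [rewrite Uoitv_cons setUC; congr (_ `|` _)|rewrite setUidl//].
  apply/seteqP; split => x /=; rewrite indicE.
    by case: (boolP (x \in _)) => [/set_mem//|_]; rewrite mulr0 leNgt v0.
  by move=> xN; rewrite mem_set// mulr1.
move=> x /=; rewrite indicE; case: (boolP (x \in _)) => _; first by rewrite mulr1 (negbTE vc).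
by rewrite mulr0 leNgt v0.
Qed.

Let L_weak v N I : I \in L v N -> (0 < v)%R ->
  v%:E * nu (oitv I) <= \int[nu]_(x in oitv I) f x.
Proof.
move=> + v0; elim: N => //= N IH; case: ifPn => // vc; rewrite inE => /predU1P[->|//].
by apply: (le_trans _ (c_weak N)); rewrite lee_wpmul2r// lee_fin.
Qed.

Let m_range N : exists s : seq R, forall x, m N x \in s.
Proof.
elim: N => [|N [s IH]] /=; first by exists [:: 0%R] => x; rewrite inE.
exists [:: c N, 0%R & s] => x; rewrite maxEle indicE.
case: ifPn => _; last by rewrite !inE IH !orbT.
by case: (x \in _); rewrite ?mulr1 ?mulr0 !inE eqxx ?orbT.
Qed.

Let m_fin N : \int[nu]_x (m N x `^ p)%:E < +oo.
Proof.
elim: N => [|N IH] /=.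
  by under eq_integral do rewrite powR0 ?gt_eqF//; rewrite integral0.
pose g x := (c N * \1_(oitv (rat_itv N)) x)%R.
have g0 x : (0 <= g x)%R by rewrite mulr_ge0.
have mg : measurable_fun setT g by apply: measurable_funM => //; exact: measurable_indic.
apply: (@le_lt_trans _ _ (\int[nu]_x ((m N x `^ p)%:E + (g x `^ p)%:E))).
  apply: ge0_le_integralW => x _; rewrite ?lee_fin ?powR_ge0//.
  by rewrite -/(g x) maxEle; case: ifPn => _; rewrite ?lerDl ?lerDr powR_ge0.
rewrite ge0_integralD//; last 4 first.
- by move=> x _; rewrite lee_fin powR_ge0.
- by apply/measurable_EFinP; exact: measurableT_comp_powR.
- by move=> x _; rewrite lee_fin powR_ge0.
- by apply/measurable_EFinP; exact: measurableT_comp_powR.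
rewrite lte_add_pinfty//.
have -> : \int[nu]_x (g x `^ p)%:E = \int[nu]_x ((c N `^ p)%:E * (\1_(oitv (rat_itv N)) x)%:E).
  apply: eq_integral => x _; rewrite /g indicE; case: (x \in _); rewrite ?mulr1 ?mule1//.
  by rewrite mulr0 powR0 ?mule0 ?gt_eqF.
rewrite ge0_integralZl_EFin ?powR_ge0//; last first.
  by apply/measurable_EFinP; exact: measurable_indic.
by rewrite integral_indic// setIT lte_mul_pinfty// lee_fin powR_ge0.
Qed.

Let m_strong N : \int[nu]_x (m N x `^ p)%:E <= (strong_cst p)%:E * \int[nu]_x (f x `^ p).
Proof.
have [s ms] := m_range N; have mNfin := m_fin N.
apply: (@strong_type_finite_range _ _ _ nu f (m N) p 2 p1 _ f0 mf (@m_ge0 N) (@measurable_m N) _ s) => //.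
move=> v v0; rewrite superlevel_m//; apply: weak_type_intervals => //; first exact: ltW.
by move=> I /L_weak; exact.
Qed.

Let m_mono x : nondecreasing_seq (m ^~ x).
Proof. by apply/nondecreasing_seqP => n /=; rewrite le_max lexx. Qed.

Let maxfun_m x : maxfun nu f x <= ereal_sup (range (fun N => (m N x)%:E)).
Proof.
apply: ge_ereal_sup => _ [k _ <-]; apply: le_ereal_sup_tmp.
exists (m k.+1 x)%:E; first by exists k.+1.
rewrite (_ : _ * _ = (c k * \1_(oitv (rat_itv k)) x)%:E).
  by rewrite lee_fin /= le_max lexx orbT.
by rewrite EFinM muleC /c fineK.
Qed.

Lemma maxfun_strong_fin : \int[nu]_x (maxfun nu f x `^ p) <=
  (strong_cst p)%:E * \int[nu]_x (f x `^ p).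
Proof.
apply: (@le_trans _ _ (\int[nu]_x ereal_sup (range (fun N => (m N x `^ p)%:E)))).
  apply: ge0_le_integralW => x _; first exact: poweR_ge0.
  apply: (@le_trans _ _ (ereal_sup (range (fun N => (m N x)%:E)) `^ p)); last first.
    by apply: (poweR_ereal_sup_le p0) => N; rewrite lee_fin.
  by apply: lee_poweR; rewrite ?(ltW p0) ?maxfun_ge0.
apply: integral_ereal_sup_le => //.
- by move=> N; apply/measurable_EFinP; exact: measurableT_comp_powR.
- by move=> N x; rewrite lee_fin powR_ge0.
- move=> x a b ab; rewrite lee_fin; apply: ge0_ler_powR; rewrite ?nnegrE ?(ltW p0)//.
  exact: m_mono.
Qed.

End strong_type.

(** The weak type constant of weak_type_intervals does not depend on nu; the bound
    passes to the limit over finite families of intervals by monotone convergence. *)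
Lemma maxfun_strong nu f p : (1 < p)%R ->
  (forall k, nu (oitv (rat_itv k)) < +oo) ->
  (forall x, 0 <= f x) -> measurable_fun setT f ->
  \int[nu]_x (maxfun nu f x `^ p) <= (strong_cst p)%:E * \int[nu]_x (f x `^ p).
Proof.
move=> p1 nufin f0 mf.
have [fp|] := ltP (\int[nu]_x (f x `^ p)) +oo; first exact: maxfun_strong_fin.
by rewrite leye_eq => /eqP ->; rewrite gt0_muley ?leey// lte_fin strong_cst_gt0.
Qed.

End maximal_function.

(** * Muckenhoupt weights *)

Lemma integral_pos (d : measure_display) (T : measurableType d) (R : realType)
    (mu : {measure set T -> \bar R}) (D : set T) (f : T -> \bar R) :
  measurable D -> 0 < mu D -> measurable_fun D f -> (forall x, D x -> 0 < f x) ->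
  0 < \int[mu]_(x in D) f x.
Proof.
move=> mD D0 mf f0; rewrite lt_neqAle eq_sym integral_ge0 ?andbT; last first.
  by move=> x /f0/ltW.
apply/eqP => I0; have : \int[mu]_(x in D) `|f x| = 0.
  by rewrite -I0; apply: eq_integral => x /set_mem/f0/ltW f0x; rewrite gee0_abs.
move/(ae_eq_integral_abs mu mD mf) => [N [mN N0 DN]].
move: D0; rewrite (_ : mu D = 0) ?ltxx//; apply/eqP; rewrite -measure_le0 -N0.
apply: le_measure; rewrite ?inE// => x Dx; apply: DN => /=.
by move=> /(_ Dx) fx; move: (f0 _ Dx); rewrite fx ltxx.
Qed.

Lemma powR_invM (R : realType) (a r : R) : (0 < a)%R ->
  (a^-1 `^ r * a = a `^ (1 - r))%R.
Proof.
move=> a0; rewrite -powR_inv1 ?(ltW a0)// -powRrM -[X in (_ * X)%R]powRr1 ?(ltW a0)//.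
by rewrite -powRD ?(gt_eqF a0) ?implybT//; congr powR; ring.
Qed.

Lemma measurable_fun_invr d (T : measurableType d) (R : realType) (u : T -> R) :
  (forall t, 0 < u t)%R -> measurable_fun setT u ->
  measurable_fun setT (fun t => (u t)^-1)%R.
Proof.
move=> u0 mu; rewrite (_ : (fun t => _) = (fun t => u t `^ (-1))%R).
  exact: measurableT_comp_powR.
by apply/funext => t; rewrite powR_inv1// ltW.
Qed.

Section density.
Context d (T : measurableType d) (R : realType).
Variables (mu : {measure set T -> \bar R}) (w : T -> R).
Hypotheses (w0 : forall x, (0 <= w x)%R) (mw : measurable_fun setT w).

Let dens (A : set T) : \bar R := \int[mu]_(x in A) (w x)%:E.

Let dens0 : dens set0 = 0. Proof. exact: integral_set0. Qed.

Let dens_ge0 A : 0 <= dens A.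
Proof. by apply: integral_ge0 => x _; rewrite lee_fin. Qed.

Let mwE : measurable_fun setT (EFin \o w). Proof. exact/measurable_EFinP. Qed.

Let dens_sigma_additive : semi_sigma_additive dens.
Proof.
move=> F mF tF mUF; rewrite /dens ge0_integral_bigcup//; last 2 first.
- exact: measurable_funS mwE.
- by move=> x _; rewrite lee_fin.
by apply: is_cvg_nneseries => n _ _; exact: dens_ge0.
Qed.

HB.instance Definition _ := isMeasure.Build _ _ _ dens dens0 dens_ge0 dens_sigma_additive.

Import HBNNSimple.

Let dens_nnsfun (g : {nnsfun T >-> R}) :
  \int[dens]_x (g x)%:E = \int[mu]_x ((g x)%:E * (w x)%:E).
Proof.
rewrite integralT_nnsfun sintegralE.
transitivity (\int[mu]_x (\sum_(y \in range g) (y * \1_(g @^-1` [set y]) x)%:E * (w x)%:E)).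
  rewrite ge0_integral_fsum//; last 2 first.
  - move=> y; apply: emeasurable_funM => //; apply/measurable_EFinP.
    exact: measurable_funM.
  - by move=> y x _; rewrite mule_ge0 ?lee_fin ?nnfun_muleindic_ge0//; exact: nnfun_muleindic_ge0.
  apply: eq_fsbigr => y /set_mem[x _ <-]; rewrite /dens.
  rewrite [X in _ * X](_ : _ = \int[mu]_(z in g @^-1` [set g x]) (w z)%:E)//.
  rewrite [in LHS]integral_mkcond -ge0_integralZl_EFin//; last 2 first.
  - by move=> z _; rewrite patchE; case: ifPn => // _; rewrite lee_fin.
  - apply/(measurable_restrictT _ _).1 => //; exact: measurable_funS mwE.
  apply: eq_integral => z _; rewrite patchE indicE.
  by case: (boolP (z \in _)) => _; rewrite ?mulr1 ?mulr0 ?mule0 ?mul0e.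
apply: eq_integral => x _; rewrite [in RHS]fimfunE -fsumEFin//.
rewrite fsbig_finite//= [in RHS]fsbig_finite//= ge0_sume_distrl//.
by move=> y _; exact: nnfun_muleindic_ge0.
Qed.

Let dens_integral (f : T -> \bar R) : (forall x, 0 <= f x) -> measurable_fun setT f ->
  \int[dens]_x f x = \int[mu]_x (f x * (w x)%:E).
Proof.
move=> f0 mf; pose g := nnsfun_approx measurableT mf.
have gf x : EFin \o g^~ x @ \oo --> f x by apply: cvg_nnsfun_approx.
have ndg x : nondecreasing_seq (EFin \o g^~ x).
  by move=> a b ab; rewrite lee_fin; exact/lefP/nd_nnsfun_approx.
have -> : \int[dens]_x f x = \int[dens]_x limn (EFin \o g^~ x).
  by apply: eq_integral => x _; apply/esym/cvg_lim.
have -> : \int[mu]_x (f x * (w x)%:E) = \int[mu]_x limn (fun n => (g n x)%:E * (w x)%:E).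
  apply: eq_integral => x _; apply/esym/cvg_lim => //.
  exact: (cvgeZr (isT : (w x)%:E \is a fin_num) (gf x)).
rewrite !monotone_convergence//.
- by congr (limn _); apply/funext => n; exact: dens_nnsfun.
- by move=> n; apply: emeasurable_funM => //; exact/measurable_EFinP.
- by move=> n x _; rewrite mule_ge0// lee_fin.
- by move=> x _ a b ab; rewrite lee_wpmul2r ?lee_fin//; exact: ndg.
- by move=> n; exact/measurable_EFinP.
- by move=> n x _; rewrite lee_fin.
- by move=> x _; exact: ndg.
Qed.

(** For simple functions the formula follows from linearity, in general from
    monotone convergence. *)
Lemma density_measure : exists nu : {measure set T -> \bar R},
  (forall A, nu A = \int[mu]_(x in A) (w x)%:E) /\
  (forall D f, measurable D -> (forall x, 0 <= f x) -> measurable_fun setT f ->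
     \int[nu]_(x in D) f x = \int[mu]_(x in D) (f x * (w x)%:E)).
Proof.
exists dens; split => // D f mD f0 mf; rewrite integral_mkcond dens_integral.
- rewrite [in RHS]integral_mkcond; apply: eq_integral => x _; rewrite !patchE.
  by case: ifPn; rewrite ?mul0e.
- by move=> x; rewrite patchE; case: ifPn.
- apply/(measurable_restrictT _ _).1 => //; exact: measurable_funS mf.
Qed.

End density.

Section Muckenhoupt.
Context {R : realType}.
Local Notation RR := (measurableTypeR R).
Local Notation mu := (@lebesgue_measure R).
Implicit Types (w : RR -> R) (f : RR -> \bar R).

(** The Muckenhoupt condition A_p with constant K on rational intervals. The
    average over the interval is multiplied out, so that null intervals are no
    exception. *)
Definition Ap (p K : R) w := [/\ measurable_fun setT w, (forall t, 0 < w t)%R &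
  forall k, (\int[mu]_(t in oitv (rat_itv k)) (w t)%:E) *
    (\int[mu]_(t in oitv (rat_itv k)) (w t `^ (- (p - 1)^-1))%:E) `^ (p - 1)
    <= K%:E * mu (oitv (rat_itv k)) `^ p].

Definition Ap_cst (p K : R) : R :=
  (K `^ (p / (p - 1)) * (strong_cst (p / (p - 1)) * strong_cst p))%R.

Lemma lebesgue_oitv (I : R * R) :
  mu (oitv I) = (if (I.1 < I.2)%R then (I.2 - I.1)%:E else 0).
Proof. by rewrite /oitv lebesgue_measure_itv/= lte_fin; case: ifPn. Qed.

Lemma lebesgue_oitv_fin (I : R * R) : mu (oitv I) < +oo.
Proof. by rewrite lebesgue_oitv; case: ifPn => _; rewrite ltry. Qed.

Section Ap_maximal.
Variables (p K : R) (w : RR -> R) (f : RR -> \bar R).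
Hypotheses (p1 : (1 < p)%R) (K0 : (0 < K)%R) (wAp : Ap p K w).
Hypotheses (f0 : forall x, 0 <= f x) (mf : measurable_fun setT f).

Let p0 : (0 < p)%R. Proof. exact: lt_trans ltr01 p1. Qed.
Let pB : (0 < p - 1)%R. Proof. by rewrite subr_gt0. Qed.
Let w0 t : (0 < w t)%R. Proof. by case: wAp. Qed.
Let mw : measurable_fun setT w. Proof. by case: wAp. Qed.
Let s t : R := (w t `^ (- (p - 1)^-1))%R.
Let s0 t : (0 < s t)%R. Proof. exact: powR_gt0. Qed.
Let ms : measurable_fun setT s. Proof. exact: measurableT_comp_powR. Qed.
Let J k := oitv (rat_itv k) : set RR.
Let mJ k : measurable (J k). Proof. exact: measurable_oitv. Qed.

Let weight_pos (u : RR -> R) k : (forall t, 0 < u t)%R -> measurable_fun setT u ->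
  0 < mu (J k) -> 0 < \int[mu]_(t in J k) (u t)%:E.
Proof.
move=> u0 mu' J0; apply: integral_pos => // [|x _]; last by rewrite lte_fin.
by apply: measurable_funTS; exact/measurable_EFinP.
Qed.

Let weight_fin k : (\int[mu]_(t in J k) (w t)%:E < +oo) /\
  (\int[mu]_(t in J k) (s t)%:E < +oo).
Proof.
have [J0|] := ltP 0 (mu (J k)); last first.
  rewrite measure_le0 => /eqP J0.
  by rewrite !null_set_integral ?ltry//; apply/measurable_EFinP; [exact: measurable_funS ms|exact: measurable_funS mw].
have W0 := weight_pos w0 mw J0; have S0 := weight_pos s0 ms J0.
have [_ _ /(_ k)] := wAp; rewrite -/(J k) -/s.
have -> : K%:E * mu (J k) `^ p = (K * fine (mu (J k)) `^ p)%:E.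
  rewrite EFinM -poweR_EFin fineK// ge0_fin_numE//; exact: lebesgue_oitv_fin.
move: W0 S0; rewrite -/s.
case: (\int[mu]_(t in J k) (w t)%:E) => [W| |]//; case: (\int[mu]_(t in J k) (s t)%:E) => [S| |]// W0 S0.
- by rewrite !ltry.
- by rewrite poweRyr ?gt_eqF// gt0_muley// leye_eq.
- rewrite poweR_EFin gt0_mulye ?leye_eq// lte_fin powR_gt0//.
- by rewrite poweRyr ?gt_eqF// gt0_muley// leye_eq.
Qed.

Let real_ineq (m W S : R) : (0 < m)%R -> (0 < W)%R -> (0 < S)%R ->
  (W * S `^ (p - 1) <= K * m `^ p)%R ->
  ((m^-1) `^ (p - 1) <= K * (W^-1 * (m * S^-1 `^ (p - 1))))%R.
Proof.
move=> m0 W0 S0; rewrite -(mulr_powRB1 (ltW m0) p0) => H.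
rewrite -!powR_inv1 ?(ltW m0) ?(ltW W0) ?(ltW S0)// -!powRrM !mulN1r !powRN.
rewrite powRr1 ?(ltW W0)//.
have mp := powR_gt0 (p - 1) m0; have Sp := powR_gt0 (p - 1) S0.
set M := (m `^ (p - 1))%R in H mp *; set X := (S `^ (p - 1))%R in H Sp *.
have -> : (K * (W^-1 * (m * X^-1)) = (K * (m * M)) / (W * X) * M^-1)%R.
  by field; rewrite !gt_eqF.
by rewrite ler_peMl ?invr_ge0 ?(ltW mp)// ler_pdivlMr ?mulr_gt0// mul1r.
Qed.

(** Lerner's argument. Let sigma = w^(-1/(p-1)). The A_p condition turns Lebesgue
    averages into averages for the measures sigma dt and w dt, which gives the
    pointwise bound (M f)^(p-1) <= K M_w ((M_sigma (f / sigma))^(p-1) / w). Since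
    maxfun_strong holds for every measure, it applies to M_w on L^(p/(p-1))(w dt)
    and then to M_sigma on L^p(sigma dt), and the weights cancel. *)
Lemma Ap_maximal : \int[mu]_x ((maxfun mu f x) `^ p * (w x)%:E) <=
  (Ap_cst p K)%:E * \int[mu]_x (f x `^ p * (w x)%:E).
Proof.
have [nw [nwE nwI]] := density_measure mu (fun t => ltW (w0 t)) mw.
have [ns [nsE nsI]] := density_measure mu (fun t => ltW (s0 t)) ms.
have nwfin k : nw (oitv (rat_itv k)) < +oo by rewrite nwE; case: (weight_fin k).
have nsfin k : ns (oitv (rat_itv k)) < +oo by rewrite nsE; case: (weight_fin k).
pose h t := f t * ((s t)^-1)%:E.
have h0 t : 0 <= h t by rewrite mule_ge0// lee_fin invr_ge0 ltW.
have mh : measurable_fun setT h.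
  by apply: emeasurable_funM => //; apply/measurable_EFinP; exact: measurable_fun_invr.
pose g t := (maxfun ns h t) `^ (p - 1) * ((w t)^-1)%:E.
have g0 t : 0 <= g t by rewrite mule_ge0 ?poweR_ge0// lee_fin invr_ge0 ltW.
have mMh : measurable_fun setT (maxfun ns h) by exact: measurable_maxfun.
have mg : measurable_fun setT g.
  apply: emeasurable_funM; first exact: measurableT_comp_poweR.
  by apply/measurable_EFinP; exact: measurable_fun_invr.
have hI k : \int[ns]_(t in J k) h t = \int[mu]_(t in J k) f t.
  rewrite nsI//; apply: eq_integral => t _.
  by rewrite /h -muleA -EFinM mulVf ?mule1// gt_eqF.
have gI k : \int[nw]_(t in J k) g t = \int[mu]_(t in J k) (maxfun ns h t `^ (p - 1)).
  rewrite nwI//; apply: eq_integral => t _.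
  by rewrite /g -muleA -EFinM mulVf ?mule1// gt_eqF.
(* The densities of nw and ns are w and sigma, so that averages of g and h for
    these measures are quotients of Lebesgue integrals. *)
have key x : maxfun mu f x `^ (p - 1) <= K%:E * maxfun nw g x.
  have Mg0 : 0 <= K%:E * maxfun nw g x by rewrite mule_ge0 ?lee_fin ?(ltW K0) ?maxfun_ge0.
  rewrite -[leRHS](@poweRKV _ _ (p - 1)) ?gt_eqF//.
  apply: lee_poweR; rewrite ?(ltW pB) ?maxfun_ge0//.
  apply: maxfun_le => [|k xk]; first exact: poweR_ge0.
  rewrite -[leLHS](@poweRVK _ _ (p - 1)) ?gt_eqF ?avg_ge0//.
  apply: lee_poweR; rewrite ?invr_ge0 ?(ltW pB) ?poweR_ge0//.
  apply: (le_trans _ (lee_wpmul2l _ (avg_le_maxfun nw g xk))); last by rewrite lee_fin ltW.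
  have J0 : 0 < mu (J k).
    rewrite /J lebesgue_oitv; move: xk; rewrite /inoitv => /andP[a b].
    by rewrite (lt_trans a b) lte_fin subr_gt0 (lt_trans a b).
  have W0 := weight_pos w0 mw J0; have S0 := weight_pos s0 ms J0.
  have [Wf Sf] := weight_fin k.
  have [_ _ /(_ k)] := wAp; rewrite -/(J k) -/s.
  have -> : avg mu f (rat_itv k) = (\int[mu]_(t in J k) f t) / mu (J k) by [].
  rewrite /avg nwE gI -/(J k) => wA.
  apply: (@le_trans _ _ (K%:E * ((mu (J k) * ((\int[mu]_(t in J k) f t) * (\int[mu]_(t in J k) (s t)%:E)^-1) `^ (p - 1))
      / \int[mu]_(t in J k) (w t)%:E))); last first.
    rewrite lee_wpmul2l ?lee_fin ?(ltW K0)// lee_wpmul2r ?inve_ge0 ?(ltW W0)//.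
    rewrite muleC -integral_cst//; apply: ge0_le_integralW => t Jt; first exact: poweR_ge0.
    apply: lee_poweR; rewrite ?(ltW pB)//.
      by rewrite mule_ge0 ?integral_ge0 ?inve_ge0// ltW.
    by rewrite -hI -nsE; apply: avg_le_maxfun; rewrite -oitvE.
  have [m mE m0] : exists2 m : R, mu (J k) = m%:E & (0 < m)%R.
    move: (lebesgue_oitv_fin (rat_itv k)) J0; rewrite -/(J k).
    by case: (mu _) => // m _; rewrite lte_fin; exists m.
  rewrite -/s in wA; move: Wf Sf W0 S0 wA; rewrite mE.
  case: (\int[mu]_(t in J k) (w t)%:E) => [W| |]//; case: (\int[mu]_(t in J k) (s t)%:E) => [S| |]// _ _.
  rewrite !lte_fin => W0 S0.
  rewrite !poweR_EFin -!EFinM lee_fin => /(real_ineq m0 W0 S0) H.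
  rewrite !inver !gt_eqF// !poweRM ?integral_ge0 ?lee_fin ?invr_ge0 ?(ltW m0) ?(ltW S0)//.
  rewrite !poweR_EFin.
  set I := (\int[mu]_(_ in _) _) `^ _.
  have -> : K%:E * (m%:E * (I * (S^-1 `^ (p - 1))%:E) * W^-1%:E) =
     (K * (W^-1 * (m * S^-1 `^ (p - 1))))%:E * I.
    rewrite !muleA (muleAC _ I) (muleAC _ I) -!EFinM; congr (_%:E * _); ring.
  by rewrite muleC lee_wpmul2r ?poweR_ge0// lee_fin.
have pq : (1 < p / (p - 1))%R by rewrite ltr_pdivlMr// mul1r ltrBlDr ltrDl.
have q0 : (0 <= p / (p - 1))%R by rewrite (le_trans ler01)// ltW.
apply: (@le_trans _ _ (\int[mu]_x ((K `^ (p / (p - 1)))%:E * (maxfun nw g x `^ (p / (p - 1)) * (w x)%:E)))).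
  apply: ge0_le_integralW => x _; first by rewrite mule_ge0 ?poweR_ge0// lee_fin ltW.
  rewrite muleA lee_wpmul2r ?lee_fin ?(ltW (w0 x))//.
  rewrite -(poweR_EFin K) -poweRM ?lee_fin ?(ltW K0) ?maxfun_ge0//.
  have -> : maxfun mu f x `^ p = (maxfun mu f x `^ (p - 1)) `^ (p / (p - 1)).
    by rewrite -poweRrM mulrCA divff ?mulr1// gt_eqF.
  by apply: lee_poweR => //; exact: poweR_ge0.
rewrite ge0_integralZl_EFin ?powR_ge0//; last 2 first.
- by move=> x _; rewrite mule_ge0 ?poweR_ge0// lee_fin ltW.
- apply: emeasurable_funM; last exact/measurable_EFinP.
  by apply: measurableT_comp_poweR; exact: measurable_maxfun.
rewrite /Ap_cst EFinM -muleA lee_wpmul2l ?lee_fin ?powR_ge0//.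
rewrite -nwI//; last 2 first.
- by move=> x; exact: poweR_ge0.
- by apply: measurableT_comp_poweR; exact: measurable_maxfun.
apply: (le_trans (maxfun_strong pq nwfin g0 mg)).
rewrite [X in _ <= X * _]EFinM -muleA lee_wpmul2l ?lee_fin ?(ltW (strong_cst_gt0 _))//.
have -> : \int[nw]_x (g x `^ (p / (p - 1))) = \int[ns]_x (maxfun ns h x `^ p).
  rewrite nwI//; last 2 first.
  - by move=> x; exact: poweR_ge0.
  - exact: measurableT_comp_poweR.
  rewrite nsI//; last 2 first.
  - by move=> x; exact: poweR_ge0.
  - exact: measurableT_comp_poweR.
  apply: eq_integral => x _; rewrite /g poweRM ?poweR_ge0 ?lee_fin ?invr_ge0 ?(ltW (w0 x))//.
  rewrite -poweRrM mulrCA divff ?mulr1 ?gt_eqF// -muleA; congr (_ * _).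
  rewrite poweR_EFin -EFinM; congr (_%:E).
  rewrite powR_invM//; congr (_ `^ _)%R.
  by field; rewrite !gt_eqF.
apply: (le_trans (maxfun_strong p1 nsfin h0 mh)).
rewrite lee_wpmul2l ?lee_fin ?(ltW (strong_cst_gt0 _))//.
rewrite nsI//; last 2 first.
- by move=> x; exact: poweR_ge0.
- exact: measurableT_comp_poweR.
apply: ge0_le_integralW => x _; first by rewrite mule_ge0 ?poweR_ge0// lee_fin ltW.
rewrite /h poweRM ?lee_fin ?invr_ge0 ?(ltW (s0 x))// -muleA lee_wpmul2l ?poweR_ge0//.
rewrite poweR_EFin -EFinM lee_fin powR_invM// /s -powRrM.
by rewrite (_ : (- (p - 1)^-1 * (1 - p) = 1)%R) ?powRr1 ?(ltW (w0 x))//; field; rewrite gt_eqF.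
Qed.

End Ap_maximal.
End Muckenhoupt.

(** * A_1 majorants *)

Section series_prelim.
Context {R : realType}.
Implicit Types f g : nat -> \bar R.

Lemma nneseries_le_bound f (K : \bar R) : (forall n, 0 <= f n) ->
  (forall n, \sum_(0 <= i < n) f i <= K) -> \sum_(0 <= i <oo) f i <= K.
Proof.
move=> f0 fK; apply: lime_le; first by apply: is_cvg_nneseries.
by apply: nearW => n; exact: fK.
Qed.

Lemma nneseries_ge_term f k : (forall n, 0 <= f n) -> f k <= \sum_(0 <= i <oo) f i.
Proof.
move=> f0; apply: (le_trans _ (@nneseries_lim_ge _ _ xpredT 0 k.+1 (fun n _ _ => f0 n))).
by rewrite big_nat_recr//= leeDr// sume_ge0.
Qed.

Lemma nneseries_shift_le f : (forall n, 0 <= f n) ->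
  \sum_(0 <= i <oo) f i.+1 <= \sum_(0 <= i <oo) f i.
Proof.
move=> f0; apply: nneseries_le_bound => // n.
apply: (le_trans _ (@nneseries_lim_ge _ _ xpredT 0 n.+1 (fun n _ _ => f0 n))).
by rewrite big_nat_recl//= leeDr.
Qed.

Lemma nneseries_geometric_le (z : R) (S : \bar R) : (0 <= z)%R -> (z < 1)%R -> 0 <= S ->
  \sum_(0 <= i <oo) ((z ^+ i)%:E * S) <= ((1 - z)^-1)%:E * S.
Proof.
move=> z0 z1 S0; apply: nneseries_le_bound => [m|m].
  by rewrite mule_ge0// lee_fin exprn_ge0.
rewrite -ge0_sume_distrl; last by move=> i _; rewrite lee_fin exprn_ge0.
rewrite sumEFin lee_wpmul2r// lee_fin.
have z1' : (0 < 1 - z)%R by rewrite subr_gt0.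
have -> : (\sum_(0 <= i < m) z ^+ i = (1 - z ^+ m) / (1 - z))%R.
  elim: m => [|m IH]; first by rewrite big_nil expr0 subrr mul0r.
  by rewrite big_nat_recr//= IH exprS; field; rewrite gt_eqF.
by rewrite ler_pdivrMr// mulVf ?gt_eqF// lerBlDr lerDl exprn_ge0.
Qed.

Lemma nneseries_half_le (S : \bar R) : 0 <= S ->
  \sum_(0 <= i <oo) ((2^-1 ^+ i)%:E * S) <= 2%:E * S.
Proof.
move=> S0; have z1 : (2^-1 < 1 :> R)%R by rewrite invf_lt1// ltr1n.
have := nneseries_geometric_le (_ : (0 <= 2^-1 :> R)%R) z1 S0; rewrite invr_ge0 ler0n.
by rewrite (_ : (1 - 2^-1)^-1 = 2 :> R)%R; [exact|field].
Qed.

End series_prelim.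

Lemma inve_fin_ge0 (R : realType) (x : \bar R) : 0 <= x -> x < +oo -> x != 0 ->
  exists2 r : R, x^-1 = r%:E & (0 <= r)%R.
Proof.
case: x => [x| |]//; rewrite lee_fin eqe => x0 _ xn0.
by exists x^-1%R; rewrite ?inver ?(negbTE xn0)// invr_ge0.
Qed.

Lemma powR_invl (R : realType) (x p : R) : (0 < x)%R ->
  (x^-1 `^ p = (x `^ p)^-1)%R.
Proof. by move=> x0; rewrite -powR_inv1 ?(ltW x0)// -powRrM mulN1r powRN. Qed.

Section maxfun_series.
Context {R : realType}.
Local Notation RR := (measurableTypeR R).
Variable nu : {measure set RR -> \bar R}.

Lemma maxfun_nneseries (g : nat -> RR -> \bar R) x :
  (forall k y, 0 <= g k y) -> (forall k, measurable_fun setT (g k)) ->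
  (forall k, nu (oitv (rat_itv k)) < +oo) ->
  maxfun nu (fun y => \sum_(0 <= k <oo) g k y) x <= \sum_(0 <= k <oo) maxfun nu (g k) x.
Proof.
move=> g0 mg nufin; apply: maxfun_le => [|k xk].
  by apply: nneseries_ge0 => i _ _; exact: maxfun_ge0.
rewrite /avg integral_nneseries//; last 2 first.
- exact: measurable_oitv.
- by move=> i; exact: measurable_funS (mg i).
have [n0|n0] := eqVneq (nu (oitv (rat_itv k))) 0.
  rewrite eseries0 ?mul0e ?nneseries_ge0// => [i _ _|i _ _]; first exact: maxfun_ge0.
  rewrite null_set_integral//; first exact: measurable_oitv.
  exact: measurable_funS (mg i).
have [r rE r0] : exists2 r : R, (nu (oitv (rat_itv k)))^-1 = r%:E & (0 <= r)%R.
  exact: (inve_fin_ge0 (measure_ge0 nu _) (nufin k) n0).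
rewrite rE muleC -nneseriesZl; last by move=> i _; exact: integral_ge0.
apply: lee_nneseries => i _; first by rewrite mule_ge0 ?lee_fin ?integral_ge0.
by rewrite muleC -rE; exact: avg_le_maxfun.
Qed.

Lemma maxfunZl_le (c : R) (g : RR -> \bar R) x : (0 <= c)%R ->
  (forall y, 0 <= g y) -> measurable_fun setT g ->
  maxfun nu (fun y => c%:E * g y) x <= c%:E * maxfun nu g x.
Proof.
move=> c0 g0 mg; apply: maxfun_le => [|k xk].
  by rewrite mule_ge0 ?lee_fin ?maxfun_ge0.
rewrite /avg ge0_integralZl_EFin//; last 2 first.
- exact: measurable_oitv.
- exact: measurable_funS mg.
by rewrite -muleA lee_wpmul2l ?lee_fin//; exact: avg_le_maxfun.
Qed.

End maxfun_series.

Section A1_majorant.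
Context {R : realType}.
Local Notation RR := (measurableTypeR R).
Local Notation mu := (@lebesgue_measure R).

Definition A1_cst (p K : R) : R := (2 * (2 * Ap_cst p K) `^ p^-1)%R.
Definition majorant_cst (p : R) : R := (2 `^ p * 2)%R.

Lemma Ap_cst_gt0 (p K : R) : (1 < p)%R -> (0 < K)%R -> (0 < Ap_cst p K)%R.
Proof.
move=> p1 K0; rewrite /Ap_cst mulr_gt0 ?powR_gt0// mulr_gt0 ?strong_cst_gt0//.
by rewrite ltr_pdivlMr ?subr_gt0// mul1r ltrBlDr ltrDl.
Qed.

Lemma A1_cst_gt0 (p K : R) : (1 < p)%R -> (0 < K)%R -> (0 < A1_cst p K)%R.
Proof. by move=> p1 K0; rewrite mulr_gt0// powR_gt0// mulr_gt0// Ap_cst_gt0. Qed.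

Section rubio_de_francia.
Variables (p K : R) (w : RR -> R) (g : RR -> \bar R).
Hypotheses (p1 : (1 < p)%R) (K0 : (0 < K)%R) (wAp : Ap p K w).
Hypotheses (g0 : forall x, 0 <= g x) (mg : measurable_fun setT g).

Let p0 : (0 < p)%R. Proof. exact: lt_trans ltr01 p1. Qed.
Let pne : p != 0%R. Proof. by rewrite gt_eqF. Qed.
Let w0 t : (0 < w t)%R. Proof. by case: wAp. Qed.
Let mw : measurable_fun setT w. Proof. by case: wAp. Qed.
Let mwE : measurable_fun setT (EFin \o w). Proof. exact/measurable_EFinP. Qed.
Let B := Ap_cst p K.
Let B0 : (0 < B)%R. Proof. exact: Ap_cst_gt0. Qed.
Let beta := ((2 * B) `^ p^-1)%R.
Let beta0 : (0 < beta)%R. Proof. by rewrite powR_gt0// mulr_gt0. Qed.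

Let b : nat -> RR -> \bar R := fix b k :=
  if k is k'.+1 then fun x => (beta^-1)%:E * maxfun mu (b k') x else g.

Let b_ge0 k x : 0 <= b k x.
Proof. by elim: k x => [|k IH] x//=; rewrite mule_ge0 ?lee_fin ?invr_ge0 ?(ltW beta0) ?maxfun_ge0. Qed.

Let measurable_b k : measurable_fun setT (b k).
Proof. by case: k => [//|k] /=; apply: measurable_funeM; exact: measurable_maxfun. Qed.

Let Lp (h : RR -> \bar R) := \int[mu]_x (h x `^ p * (w x)%:E).

Let measurable_Lp h : measurable_fun setT h ->
  measurable_fun setT (fun x => h x `^ p * (w x)%:E).
Proof. by move=> mh; apply: emeasurable_funM => //; exact: measurableT_comp_poweR. Qed.

Let Lp_integrand_ge0 h x : 0 <= h x `^ p * (w x)%:E.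
Proof. by rewrite mule_ge0 ?poweR_ge0// lee_fin ltW. Qed.

Let Lp_b k : Lp (b k) <= (2^-1 ^+ k)%:E * Lp g.
Proof.
elim: k => [|k IH]; first by rewrite expr0 mul1e.
rewrite exprS EFinM -muleA; apply: (le_trans _ (lee_wpmul2l _ IH)); last by rewrite lee_fin invr_ge0.
have -> : Lp (b k.+1) = \int[mu]_x ((beta^-1 `^ p)%:E * (maxfun mu (b k) x `^ p * (w x)%:E)).
  apply: eq_integral => x _; rewrite /= poweRM ?lee_fin ?invr_ge0 ?(ltW beta0)//.
    by rewrite -muleA.
  exact: (maxfun_ge0 _ _ (b_ge0 k)).
rewrite ge0_integralZl_EFin ?powR_ge0//; last first.
  by apply: measurable_Lp; exact: measurable_maxfun.
have -> : ((beta^-1) `^ p = (2 * B)^-1)%R.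
  rewrite powR_invl// /beta -powRrM mulVf ?gt_eqF//.
  by rewrite powRr1// mulr_ge0// ltW.
apply: (@le_trans _ _ (((2 * B)^-1)%:E * (B%:E * Lp (b k)))).
  apply: lee_wpmul2l; first by rewrite lee_fin invr_ge0 mulr_ge0// ltW.
  exact: (Ap_maximal p1 K0 wAp (b_ge0 k) (measurable_b k)).
by rewrite muleA -EFinM invfM -mulrA mulVf ?mulr1 ?gt_eqF.
Qed.

Let G x := \sum_(0 <= k <oo) ((2^-1 ^+ k)%:E * b k x).

Let half_ge0 k : (0 <= 2^-1 ^+ k :> R)%R.
Proof. by rewrite exprn_ge0// invr_ge0. Qed.

Let Gterm_ge0 k x : 0 <= (2^-1 ^+ k)%:E * b k x.
Proof. by rewrite mule_ge0 ?lee_fin. Qed.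

Let measurable_Gterm k : measurable_fun setT (fun x => (2^-1 ^+ k)%:E * b k x).
Proof. exact: measurable_funeM. Qed.

Let measurable_G : measurable_fun setT G.
Proof. exact: ge0_emeasurable_sum. Qed.

Let G_ge x : g x <= G x.
Proof.
by apply: (le_trans _ (@nneseries_ge_term _ _ 0%N (fun k => Gterm_ge0 k x))); rewrite expr0 mul1e.
Qed.

Let Lp_G : Lp G <= (majorant_cst p)%:E * Lp g.
Proof.
apply: (@le_trans _ _ (\int[mu]_x ((2 `^ p)%:E * \sum_(0 <= k <oo) (b k x `^ p * (w x)%:E)))).
  apply: ge0_le_integralW => x _; first exact: Lp_integrand_ge0.
  pose S := \sum_(0 <= k <oo) (b k x `^ p).
  have S0 : 0 <= S by apply: nneseries_ge0 => k _ _; exact: poweR_ge0.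
  have GS : G x <= 2%:E * S `^ p^-1.
    apply: (le_trans _ (nneseries_half_le (poweR_ge0 S p^-1))).
    apply: lee_nneseries => k _ *; first exact: Gterm_ge0.
    rewrite lee_wpmul2l ?lee_fin// -[leLHS](poweRVK pne)//.
    apply: lee_poweR; rewrite ?invr_ge0 ?(ltW p0) ?poweR_ge0//.
    by apply: (@nneseries_ge_term _ (fun k => b k x `^ p)) => n; exact: poweR_ge0.
  have -> : \sum_(0 <= k <oo) (b k x `^ p * (w x)%:E) = S * (w x)%:E.
    rewrite muleC -nneseriesZl; last by move=> k _; exact: poweR_ge0.
    by apply: eq_eseriesr => k _; rewrite muleC.
  rewrite muleA lee_wpmul2r ?lee_fin ?(ltW (w0 x))//.
  apply: (@le_trans _ _ ((2%:E * S `^ p^-1) `^ p)).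
    apply: lee_poweR; rewrite ?(ltW p0)//.
    by apply: nneseries_ge0 => k _ _; exact: Gterm_ge0.
  by rewrite poweRM ?poweR_ge0// poweRKV.
rewrite ge0_integralZl_EFin ?powR_ge0//; last 2 first.
- by move=> x _; apply: nneseries_ge0 => k _ _; exact: Lp_integrand_ge0.
- apply: ge0_emeasurable_sum => [k x _ _|k _]; first exact: Lp_integrand_ge0.
  exact: measurable_Lp.
rewrite integral_nneseries//; last by move=> k; exact: measurable_Lp.
rewrite /majorant_cst EFinM -muleA lee_wpmul2l ?lee_fin ?powR_ge0//.
apply: (@le_trans _ _ (\sum_(0 <= k <oo) ((2^-1 ^+ k)%:E * Lp g))).
  by apply: lee_nneseries => [k _ _|k _]; [exact: integral_ge0|exact: Lp_b].
by apply: nneseries_half_le; exact: integral_ge0.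
Qed.

Let maxfun_G x : maxfun mu G x <= (A1_cst p K)%:E * G x.
Proof.
have nufin k : mu (oitv (rat_itv k)) < +oo by exact: lebesgue_oitv_fin.
apply: (le_trans (maxfun_nneseries x Gterm_ge0 measurable_Gterm nufin)).
apply: (@le_trans _ _ (\sum_(0 <= k <oo) ((A1_cst p K)%:E * ((2^-1 ^+ k.+1)%:E * b k.+1 x)))).
  apply: lee_nneseries => k _ *; first by apply: maxfun_ge0 => y; exact: Gterm_ge0.
  apply: (le_trans (maxfunZl_le _ _ (half_ge0 k) (b_ge0 k) (measurable_b k))).
  rewrite /= !muleA -!EFinM /A1_cst -/B -/beta exprS.
  rewrite (_ : (2 * beta * (2^-1 * 2^-1 ^+ k) * beta^-1 = 2^-1 ^+ k)%R)//.
  by field; rewrite gt_eqF.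
rewrite nneseriesZl; last by move=> k _; exact: Gterm_ge0.
rewrite lee_wpmul2l ?lee_fin ?(ltW (A1_cst_gt0 _ _))//.
exact: (@nneseries_shift_le _ (fun k => (2^-1 ^+ k)%:E * b k x)).
Qed.

Hypotheses (gpos : forall x, 0 < g x) (gfin : Lp g < +oo).

(** The Rubio de Francia algorithm: the series of iterates of the maximal operator,
    suitably damped, is a majorant of g of comparable norm, and applying the
    operator to it shifts the series, so it is almost an A_1 weight. It is finite
    off a null set E, on which it is redefined to be 1. *)
Lemma A1_majorant : exists (r : RR -> R) (E : set RR),
  [/\ measurable E, mu E = 0, measurable_fun setT r, (forall x, 0 < r x)%R &
   [/\ (forall x, ~ E x -> g x <= (r x)%:E),
      \int[mu]_x (((r x)%:E) `^ p * (w x)%:E) <= (majorant_cst p)%:E * Lp g &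
   forall k x, ~ E x -> inoitv x (rat_itv k) ->
     avg mu (EFin \o r) (rat_itv k) <= (A1_cst p K * r x)%:E]].
Proof.
pose E := [set x | G x = +oo].
have mE : measurable E.
  rewrite (_ : E = G @^-1` [set +oo]); last by [].
  by rewrite -[X in measurable X]setTI; exact: measurable_G.
have LpGfin : Lp G < +oo.
  by rewrite (le_lt_trans Lp_G)// lte_mul_pinfty// lee_fin mulr_ge0 ?powR_ge0.
have E0 : mu E = 0.
  apply/eqP; rewrite -measure_le0 leNgt; apply/negP => E0.
  suff : Lp G = +oo by move=> h; move: LpGfin; rewrite h ltxx.
  apply/eqP; rewrite -leye_eq.
  apply: (@le_trans _ _ (\int[mu]_(x in E) (G x `^ p * (w x)%:E))); last first.
    by apply: ge0_subset_integral => //; exact: measurable_Lp.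
  rewrite (eq_integral (cst +oo)); last first.
    move=> x /set_mem Ex; rewrite Ex/= (negbTE pne) gt0_mulye// lte_fin//.
  by rewrite integral_cst// gt0_mulye.
pose r x := if G x == +oo then 1%R else fine (G x).
have Gpos x : 0 < G x by apply: lt_le_trans (G_ge x).
have rE x : ~ E x -> (r x)%:E = G x.
  move=> Ex; rewrite /r; case: ifPn => [/eqP//|Gx].
  by rewrite fineK// ge0_fin_numE ?(ltW (Gpos x))// ltey.
have mr : measurable_fun setT r.
  apply: measurable_fun_ifT => //; last exact: measurableT_comp.
  apply: (measurable_fun_bool true); rewrite setTI.
  rewrite [X in measurable X](_ : _ = E)//.
  by apply/seteqP; split => x /= /eqP.
have r0 x : (0 < r x)%R.
  rewrite /r; case: ifPn => // Gx; apply: fine_gt0; rewrite Gpos/= ltey//.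
exists r, E; split => //; split => [x Ex||k x Ex xk].
- by rewrite rE.
- apply: le_trans Lp_G; apply: ae_ge0_le_integral => //.
  + by move=> x _; rewrite mule_ge0 ?poweR_ge0// lee_fin ltW.
  + apply: emeasurable_funM => //; apply: measurableT_comp_poweR; exact/measurable_EFinP.
  + exact: measurable_Lp.
  + exists E; split => // x /= h; apply: contrapT => Ex; apply: h => _.
    by rewrite -poweR_EFin (rE x Ex).
- rewrite EFinM (rE x Ex); apply: (le_trans _ (maxfun_G x)).
  apply: (le_trans _ (avg_le_maxfun mu G xk)).
  rewrite lee_wpmul2r ?inve_ge0//; apply: ae_ge0_le_integral => //.
  + exact: measurable_oitv.
  + by move=> y _; rewrite lee_fin ltW.
  + by apply: measurable_funTS; exact/measurable_EFinP.
  + by move=> y _; exact: ltW.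
  + exact: measurable_funS measurable_G.
  + exists E; split => // y /= h; apply: contrapT => Ey; apply: h => _.
    by rewrite (rE y Ey).
Qed.

End rubio_de_francia.

End A1_majorant.

(** * A_p weights from A_1 weights *)

Lemma powR_anti (R : realType) (x y s : R) : (0 <= s)%R -> (0 < x)%R -> (x <= y)%R ->
  (y `^ (- s) <= x `^ (- s))%R.
Proof.
move=> s0 x0 xy; have y0 := lt_le_trans x0 xy.
rewrite !powRN lef_pV2 ?posrE ?powR_gt0//.
by apply: ge0_ler_powR; rewrite // nnegrE ltW.
Qed.

Section Ap_factor.
Context {R : realType}.
Local Notation RR := (measurableTypeR R).
Local Notation mu := (@lebesgue_measure R).
Implicit Types (w : RR -> R).

Definition dual_weight (p : R) w : RR -> R := fun t => (w t `^ (- (p - 1)^-1))%R.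

(** Raising the A_p condition to the power 1/(p-1) exchanges the two weights. *)
Lemma Ap_dual (p K : R) w : (1 < p)%R -> (0 < K)%R -> Ap p K w ->
  Ap (p / (p - 1)) (K `^ (p - 1)^-1) (dual_weight p w).
Proof.
move=> p1 K0 [mw w0 wA]; have pB : (0 < p - 1)%R by rewrite subr_gt0.
have pBne : (p - 1)%R != 0%R by rewrite gt_eqF.
have qB : (p / (p - 1) - 1 = (p - 1)^-1)%R by field.
split => [|t|k]; [exact: measurableT_comp_powR|exact: powR_gt0|].
rewrite qB invrK.
have -> : \int[mu]_(t in oitv (rat_itv k)) (dual_weight p w t `^ (- (p - 1)))%:E =
    \int[mu]_(t in oitv (rat_itv k)) (w t)%:E.
  apply: eq_integral => t _.
  by rewrite /dual_weight -powRrM mulrN mulNr opprK mulVf// powRr1 ?(ltW (w0 t)).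
have a0 : 0 <= \int[mu]_(t in oitv (rat_itv k)) (w t)%:E.
  by apply: integral_ge0 => t _; rewrite lee_fin ltW.
have b0 : 0 <= \int[mu]_(t in oitv (rat_itv k)) (dual_weight p w t)%:E.
  by apply: integral_ge0 => t _; rewrite lee_fin powR_ge0.
have := wA k; rewrite -/(dual_weight p w) => h.
have {}h : (\int[mu]_(t in oitv (rat_itv k)) (w t)%:E *
    (\int[mu]_(t in oitv (rat_itv k)) (dual_weight p w t)%:E) `^ (p - 1)) `^ (p - 1)^-1 <=
    (K%:E * mu (oitv (rat_itv k)) `^ p) `^ (p - 1)^-1.
  apply: lee_poweR => //; first by rewrite invr_ge0 ltW.
  by rewrite mule_ge0// poweR_ge0.
move: h; rewrite !poweRM ?poweR_ge0 ?lee_fin ?(ltW K0)// poweRVK// -poweRrM poweR_EFin.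
by rewrite muleC.
Qed.

Section product.
Variables (p c1 c2 : R) (r1 r2 : RR -> R) (E : set RR).
Hypotheses (p1 : (1 < p)%R) (c1_gt0 : (0 < c1)%R) (c2_gt0 : (0 < c2)%R).
Hypotheses (mE : measurable E) (E0 : mu E = 0).
Hypotheses (mr1 : measurable_fun setT r1) (mr2 : measurable_fun setT r2).
Hypotheses (r1_gt0 : forall t, (0 < r1 t)%R) (r2_gt0 : forall t, (0 < r2 t)%R).
Hypothesis r1_A1 : forall k t, ~ E t -> inoitv t (rat_itv k) ->
  avg mu (EFin \o r1) (rat_itv k) <= (c1 * r1 t)%:E.
Hypothesis r2_A1 : forall k t, ~ E t -> inoitv t (rat_itv k) ->
  avg mu (EFin \o r2) (rat_itv k) <= (c2 * r2 t)%:E.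

Let J k := oitv (rat_itv k) : set RR.
Let mJ k : measurable (J k). Proof. exact: measurable_oitv. Qed.
Let pB : (0 < p - 1)%R. Proof. by rewrite subr_gt0. Qed.

(** On an interval of positive measure the A_1 condition bounds r from below, off
    the null set E, by a multiple of its average; this controls the negative powers
    of r. *)
Let average (r : RR -> R) c k : measurable_fun setT r -> (forall t, 0 < r t)%R -> (0 < c)%R ->
  (forall t, ~ E t -> inoitv t (rat_itv k) -> avg mu (EFin \o r) (rat_itv k) <= (c * r t)%:E) ->
  0 < mu (J k) -> exists a : R, [/\ (0 < a)%R, \int[mu]_(t in J k) (r t)%:E = a%:E &
    forall t, ~ E t -> J k t -> (a / (c * fine (mu (J k))) <= r t)%R].
Proof.
move=> mr r0 c0 rA J0.
have mfin : mu (J k) \is a fin_num by rewrite ge0_fin_numE//; exact: lebesgue_oitv_fin.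
have m0 : (0 < fine (mu (J k)))%R by rewrite fine_gt0// J0/= ltey_eq mfin.
have I0 : 0 < \int[mu]_(t in J k) (r t)%:E.
  apply: integral_pos => // [|t _]; last by rewrite lte_fin.
  by apply: measurable_funTS; exact/measurable_EFinP.
have [y Jy Ey] : exists2 y, J k y & ~ E y.
  apply: contrapT => h; move: J0; rewrite (_ : mu (J k) = 0) ?ltxx//.
  apply/eqP; rewrite -measure_le0 -E0; apply: le_measure; rewrite ?inE// => t Jt.
  by apply: contrapT => Et; apply: h; exists t.
have avgE : avg mu (EFin \o r) (rat_itv k) =
    \int[mu]_(t in J k) (r t)%:E * ((fine (mu (J k)))^-1)%:E.
  have -> : avg mu (EFin \o r) (rat_itv k) = (\int[mu]_(t in J k) (r t)%:E) / mu (J k) by [].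
  by congr (_ * _); rewrite -[in LHS](fineK mfin) inver gt_eqF.
have [a aE] : exists a : R, \int[mu]_(t in J k) (r t)%:E = a%:E.
  have := rA y Ey; rewrite -oitvE => /(_ Jy); rewrite avgE; move: I0.
  case: (\int[mu]_(t in J k) (r t)%:E) => [a| |]//; first by exists a.
  by rewrite gt0_mulye ?leye_eq// lte_fin invr_gt0.
move: I0; rewrite aE lte_fin => a0; exists a; split => // t Et Jt.
have := rA t Et; rewrite -oitvE => /(_ Jt); rewrite avgE aE -EFinM lee_fin.
by rewrite ler_pdivrMr// ler_pdivrMr ?mulr_gt0// mulrCA mulrA (mulrC c).
Qed.

Let ae_integral_le (f g : RR -> R) k : measurable_fun setT f -> measurable_fun setT g ->
  (forall t, 0 <= f t)%R -> (forall t, 0 <= g t)%R ->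
  (forall t, ~ E t -> J k t -> (f t <= g t)%R) ->
  \int[mu]_(t in J k) (f t)%:E <= \int[mu]_(t in J k) (g t)%:E.
Proof.
move=> mf mg f0 g0 fg; apply: ae_ge0_le_integral => //.
- by move=> t _; rewrite lee_fin.
- by apply: measurable_funTS; exact/measurable_EFinP.
- by move=> t _; rewrite lee_fin.
- by apply: measurable_funTS; exact/measurable_EFinP.
- exists E; split => // t /= h; apply: contrapT => Et; apply: h => Jt.
  by rewrite lee_fin fg.
Qed.

Let final_ineq (a1 a2 m : R) : (0 < a1)%R -> (0 < a2)%R -> (0 < m)%R ->
  ((a2 / (c2 * m)) `^ (1 - p) * a1 *
    ((a1 / (c1 * m)) `^ (- (p - 1)^-1) * a2) `^ (p - 1) =
  (c1 * c2 `^ (p - 1)) * m `^ p)%R.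
Proof.
move=> a1p a2p m0; have h1 : (0 < a1 / (c1 * m))%R by rewrite divr_gt0// mulr_gt0.
have h2 : (0 < c2 * m)%R by rewrite mulr_gt0.
rewrite [X in (_ * X)%R]powRM ?powR_ge0 ?(ltW a2p)// -powRrM mulNr mulVf ?gt_eqF//.
rewrite powR_inv1 ?(ltW h1)// -opprB powRN powRM ?invr_ge0 ?(ltW a2p) ?(ltW h2)//.
rewrite powR_invl// powRM ?(ltW c2_gt0) ?(ltW m0)//.
rewrite -(mulr_powRB1 (ltW m0) (lt_trans ltr01 p1)).
have := powR_gt0 (p - 1) a2p; have := powR_gt0 (p - 1) m0; have := powR_gt0 (p - 1) c2_gt0.
set A := (a2 `^ _)%R; set M := (m `^ _)%R; set C := (c2 `^ _)%R => C0 M0 A0.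
by field; rewrite !gt_eqF.
Qed.

(** The easy half of the Jones factorization theorem. The negative powers of r1 and
    r2 are bounded by powers of their averages, after which only the integrals of
    r1 and r2 remain. *)
Lemma Ap_of_A1 : Ap p (c1 * c2 `^ (p - 1)) (fun t => r1 t * r2 t `^ (1 - p))%R.
Proof.
have mW : measurable_fun setT (fun t => r1 t * r2 t `^ (1 - p))%R.
  by apply: measurable_funM => //; exact: measurableT_comp_powR.
have W0 t : (0 < r1 t * r2 t `^ (1 - p))%R by rewrite mulr_gt0 ?powR_gt0.
split => // k; rewrite -/(J k).
have [J0|] := ltP 0 (mu (J k)); last first.
  rewrite measure_le0 => /eqP J0; rewrite null_set_integral//; last first.
    by apply: measurable_funTS; exact/measurable_EFinP.
  by rewrite mul0e mule_ge0 ?poweR_ge0// lee_fin mulr_ge0 ?powR_ge0// ltW.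
have [a1 [a1p a1E a1A]] := average mr1 r1_gt0 c1_gt0 (r1_A1 (k := k)) J0.
have [a2 [a2p a2E a2A]] := average mr2 r2_gt0 c2_gt0 (r2_A1 (k := k)) J0.
have mfin : mu (J k) \is a fin_num by rewrite ge0_fin_numE//; exact: lebesgue_oitv_fin.
have m0 : (0 < fine (mu (J k)))%R by rewrite fine_gt0// J0/= ltey_eq mfin.
set m := fine (mu (J k)) in m0 a1A a2A.
have h1 : (0 < a1 / (c1 * m))%R by rewrite divr_gt0// mulr_gt0.
have h2 : (0 < a2 / (c2 * m))%R by rewrite divr_gt0// mulr_gt0.
have I1 : \int[mu]_(t in J k) (r1 t * r2 t `^ (1 - p))%:E <=
    ((a2 / (c2 * m)) `^ (1 - p) * a1)%:E.
  rewrite EFinM -a1E -ge0_integralZl_EFin ?powR_ge0//; last 2 first.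
  - by move=> t _; rewrite lee_fin ltW.
  - by apply: measurable_funTS; exact/measurable_EFinP.
  apply: ae_integral_le => //.
  - exact: measurable_funM.
  - by move=> t; rewrite ltW.
  - by move=> t; rewrite mulr_ge0 ?powR_ge0// ltW.
  - move=> t Et Jt; rewrite mulrC ler_wpM2r ?(ltW (r1_gt0 t))//.
    by rewrite -opprB; apply: powR_anti; rewrite ?(ltW pB)//; exact: a2A.
have I2 : \int[mu]_(t in J k) ((r1 t * r2 t `^ (1 - p)) `^ (- (p - 1)^-1))%:E <=
    ((a1 / (c1 * m)) `^ (- (p - 1)^-1) * a2)%:E.
  rewrite EFinM -a2E -ge0_integralZl_EFin ?powR_ge0//; last 2 first.
  - by move=> t _; rewrite lee_fin ltW.
  - by apply: measurable_funTS; exact/measurable_EFinP.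
  apply: ae_integral_le => //.
  - exact: measurableT_comp_powR.
  - exact: measurable_funM.
  - by move=> t; exact: powR_ge0.
  - by move=> t; rewrite mulr_ge0 ?powR_ge0// ltW.
  - move=> t Et Jt; rewrite powRM ?powR_ge0 ?(ltW (r1_gt0 t))// -powRrM.
    rewrite (_ : ((1 - p) * - (p - 1)^-1 = 1)%R); last by field; rewrite gt_eqF.
    rewrite powRr1 ?(ltW (r2_gt0 t))// ler_wpM2r ?(ltW (r2_gt0 t))//.
    by apply: powR_anti; rewrite ?invr_ge0 ?(ltW pB)//; exact: a1A.
apply: (@le_trans _ _ (((a2 / (c2 * m)) `^ (1 - p) * a1)%:E *
    ((a1 / (c1 * m)) `^ (- (p - 1)^-1) * a2)%:E `^ (p - 1))).
  apply: lee_pmul => //.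
  - by apply: integral_ge0 => t _; rewrite lee_fin ltW.
  - exact: poweR_ge0.
  - apply: lee_poweR; rewrite ?(ltW pB)//.
    by apply: integral_ge0 => t _; rewrite lee_fin powR_ge0.
by rewrite -(fineK mfin) -/m !poweR_EFin -!EFinM lee_fin final_ineq.
Qed.

End product.
End Ap_factor.

(** * Extrapolation *)

Lemma normal_pdf01_gt0 (R : realType) (x : R) : (0 < normal_pdf 0 1 x)%R.
Proof.
rewrite normal_pdfE ?oner_neq0// mulr_gt0// ?normal_peak_gt0 ?oner_neq0//.
exact: expR_gt0.
Qed.

Section extrapolation.
Context {R : realType}.
Local Notation RR := (measurableTypeR R).
Local Notation mu := (@lebesgue_measure R).
Implicit Types (w : RR -> R).

(** A Gaussian density divided by w, raised to the power 1/p. Adding such a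
    function makes a nonnegative function positive at an arbitrarily small cost. *)
Lemma positive_Lp_small (p e : R) w : (0 < p)%R -> (0 < e)%R ->
  (forall t, 0 < w t)%R -> measurable_fun setT w ->
  exists u : RR -> R, [/\ measurable_fun setT u, (forall t, 0 < u t)%R &
    \int[mu]_t ((u t)%:E `^ p * (w t)%:E) = e%:E].
Proof.
move=> p0 e0 w0 mw; pose u (t : RR) := ((e * normal_pdf 0 1 t / w t) `^ p^-1)%R.
have u1 t : (0 < e * normal_pdf 0 1 t / w t)%R.
  by rewrite divr_gt0// mulr_gt0// normal_pdf01_gt0.
exists u; split.
- apply: measurableT_comp_powR; apply: measurable_funM; last exact: measurable_fun_invr.
  by apply: measurable_funM => //; exact: measurable_normal_pdf.
- by move=> t; exact: powR_gt0.
- transitivity (\int[mu]_t (e%:E * (normal_pdf 0 1 t)%:E)).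
    apply: eq_integral => t _; rewrite poweR_EFin -!EFinM; congr (_%:E).
    by rewrite /u -powRrM mulVf ?gt_eqF// powRr1 ?(ltW (u1 t))// divfK// gt_eqF.
  rewrite ge0_integralZl_EFin ?(ltW e0)//.
  + by rewrite integral_normal_pdf mule1.
  + by move=> t _; rewrite lee_fin normal_pdf_ge0.
  + by apply/measurable_EFinP; exact: measurable_normal_pdf.
Qed.

(** Young's inequality for the duality between L^p(v) and L^(p/(p-1)) of the dual
    weight; d is a parameter that makes the first term small. *)
Lemma dual_young (p d x r v : R) : (1 < p)%R -> (0 < d)%R -> (0 < x)%R -> (0 < r)%R ->
  (0 < v)%R ->
  (x * r <= d * (r `^ (p / (p - 1)) * v `^ (- (p - 1)^-1)) +
            (d `^ (p - 1))^-1 * (x `^ p * v))%R.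
Proof.
move=> p1 d0 x0 r0 v0; have pB : (0 < p - 1)%R by rewrite subr_gt0.
have pBn : (p - 1)%R != 0%R by rewrite gt_eqF.
have [H H0 rE] : exists2 H, (0 < H)%R & r = (H * v)%R.
  by exists (r / v)%R; [rewrite divr_gt0|rewrite divfK// gt_eqF].
have -> : (r `^ (p / (p - 1)) * v `^ (- (p - 1)^-1) = H `^ (p / (p - 1)) * v)%R.
  rewrite {1}rE powRM ?(ltW H0) ?(ltW v0)// -mulrA -powRD; last by rewrite (gt_eqF v0) implybT.
  by rewrite (_ : (p / (p - 1) + - (p - 1)^-1 = 1)%R) ?powRr1 ?(ltW v0)//; field.
rewrite [in leLHS]rE !mulrA -mulrDl ler_wpM2r ?(ltW v0)//.
have qE : (H `^ (p / (p - 1)) = H * H `^ (p - 1)^-1)%R.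
  transitivity (H `^ 1 * H `^ (p - 1)^-1)%R; last by rewrite powRr1// ltW.
  rewrite -powRD; last by rewrite (gt_eqF H0) implybT.
  by congr powR; field.
have [h|h] := leP x (d * H `^ (p - 1)^-1)%R.
  apply: (@le_trans _ _ (d * H `^ (p / (p - 1)))%R); last first.
    by rewrite lerDl mulr_ge0 ?invr_ge0 ?powR_ge0.
  by rewrite qE (mulrC H) mulrA ler_wpM2r// ltW.
apply: (@le_trans _ _ ((d `^ (p - 1))^-1 * x `^ p)%R); last first.
  by rewrite lerDr mulr_ge0 ?powR_ge0 ?(ltW d0).
have {}h : (H <= (x / d) `^ (p - 1))%R.
  have -> : H = ((H `^ (p - 1)^-1) `^ (p - 1))%R.
    by rewrite -powRrM mulVf// powRr1// ltW.
  apply: ge0_ler_powR; rewrite ?nnegrE ?powR_ge0 ?(ltW pB) ?divr_ge0 ?(ltW x0) ?(ltW d0)//.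
  by rewrite ler_pdivlMr// mulrC ltW.
apply: (le_trans (ler_wpM2l (ltW x0) h)).
rewrite powRM ?(ltW x0) ?invr_ge0 ?(ltW d0)// powR_invl// mulrA mulr_powRB1 ?(ltW x0)//.
  by rewrite mulrC.
exact: lt_trans ltr01 p1.
Qed.

Section extrapolation_constants.
Variables (p0 p K phi : R).
Hypotheses (p0_gt1 : (1 < p0)%R) (p1 : (1 < p)%R) (K0 : (0 < K)%R) (phi0 : (0 <= phi)%R).

Let p' := (p / (p - 1))%R.
Let K' := (K `^ (p - 1)^-1)%R.
Let pB : (0 < p - 1)%R. Proof. by rewrite subr_gt0. Qed.
Let pgt0 : (0 < p)%R. Proof. exact: lt_trans ltr01 p1. Qed.
Let p'1 : (1 < p')%R. Proof. by rewrite ltr_pdivlMr// mul1r ltrBlDr ltrDl. Qed.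
Let p'0 : (0 < p')%R. Proof. exact: lt_trans ltr01 p'1. Qed.
Let K'0 : (0 < K')%R. Proof. exact: powR_gt0. Qed.

Definition extrapolated_Ap_cst : R :=
  (A1_cst (p / (p - 1)) (K `^ (p - 1)^-1) * A1_cst p K `^ (p0 - 1))%R.

Let m' := (majorant_cst p' * 2 `^ p')%R.
Let m'0 : (0 < m')%R. Proof. by rewrite !mulr_gt0 ?powR_gt0. Qed.
(** Chosen so that the term to be absorbed below has the coefficient 1/2. *)
Let delta := ((phi + 1) * m' * 2)^-1%R.
Let phi1 : (0 < phi + 1)%R. Proof. by rewrite ltr_wpDl. Qed.
Let delta0 : (0 < delta)%R. Proof. by rewrite invr_gt0 !mulr_gt0. Qed.

Let C0 : R := (2 * ((phi + 1) * ((delta `^ (p - 1))^-1 * majorant_cst p)))%R.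
Let mc0 q : (0 < majorant_cst q :> R)%R. Proof. by rewrite mulr_gt0// powR_gt0. Qed.
Let C0_gt0 : (0 < C0)%R.
Proof. by rewrite mulr_gt0// mulr_gt0// mulr_gt0 ?invr_gt0 ?powR_gt0. Qed.

Section pair.
Variables (w : RR -> R) (f : RR -> R) (g G : RR -> \bar R) (e : R).
Hypotheses (wAp : Ap p K w) (e0 : (0 < e)%R).
Hypotheses (f0 : forall t, (0 <= f t)%R) (mf : measurable_fun setT f).
Hypotheses (ffin : \int[mu]_t ((f t)%:E `^ p * (w t)%:E) < +oo).
Hypotheses (gpos : forall t, 0 < g t) (mg : measurable_fun setT g).
Hypotheses (gfin : \int[mu]_t (g t `^ p * (w t)%:E) < +oo).
Hypotheses (G0 : forall t, 0 <= G t) (mG : measurable_fun setT G) (Gg : forall t, G t <= g t).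
Hypothesis fG : forall W, Ap p0 extrapolated_Ap_cst W ->
  \int[mu]_t ((f t)%:E `^ p0 * (W t)%:E) <= phi%:E * \int[mu]_t (G t `^ p0 * (W t)%:E).

Let w0 t : (0 < w t)%R. Proof. by case: wAp. Qed.
Let mw : measurable_fun setT w. Proof. by case: wAp. Qed.
Let s := dual_weight p w.
Let sAp : Ap p' K' s. Proof. exact: Ap_dual. Qed.
Let s0 t : (0 < s t)%R. Proof. exact: powR_gt0. Qed.
Let ms : measurable_fun setT s. Proof. exact: measurableT_comp_powR. Qed.

Let mE (h : RR -> R) : measurable_fun setT h -> measurable_fun setT (fun t => (h t)%:E).
Proof. by move=> mh; exact/measurable_EFinP. Qed.

(** Let r2 be an A_1 majorant of g in L^p(w), and r1 one of f^(p-1) w (plus a small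
    positive function) in the dual space, so that W = r1 r2^(1-p0) is an A_p0
    weight. Pointwise f r1 <= f^p0 W + r2 r1, because f > r2 implies 1 <= f^(p0-1)
    r2^(1-p0), and G^p0 W <= r2 r1. The hypothesis for the weight W therefore
    bounds the integral of f^p w by a multiple of that of r2 r1. By dual_young the
    latter is bounded by a multiple of the integral of g^p w plus a small multiple
    of that of f^p w, which is finite and is absorbed. *)
Lemma extrapolation_bounded_pair : \int[mu]_t ((f t)%:E `^ p * (w t)%:E) <=
  e%:E + C0%:E * \int[mu]_t (g t `^ p * (w t)%:E).
Proof.
have [u [mu_ u0 uI]] := positive_Lp_small p'0 e0 s0 ms.
pose fw t := (f t `^ (p - 1) * w t)%R.
have mfw : measurable_fun setT fw by apply: measurable_funM => //; exact: measurableT_comp_powR.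
have fw0 t : (0 <= fw t)%R by rewrite mulr_ge0 ?powR_ge0// ltW.
pose h t := (fw t)%:E + (u t)%:E.
have hpos t : 0 < h t by rewrite /h -EFinD lte_fin ltr_wpDl.
have mh : measurable_fun setT h by apply: emeasurable_funD; exact: mE.
set I := \int[mu]_t ((f t)%:E `^ p * (w t)%:E).
have I0 : 0 <= I by apply: integral_ge0 => t _; rewrite mule_ge0 ?poweR_ge0// lee_fin ltW.
have hI : \int[mu]_t (h t `^ p' * (s t)%:E) <= (2 `^ p')%:E * (I + e%:E).
  apply: (@le_trans _ _ (\int[mu]_t ((2 `^ p')%:E *
      ((f t)%:E `^ p * (w t)%:E + (u t)%:E `^ p' * (s t)%:E)))).
    apply: ge0_le_integralW => t _; first by rewrite mule_ge0 ?poweR_ge0// lee_fin ltW.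
    have -> : (f t)%:E `^ p * (w t)%:E = (fw t)%:E `^ p' * (s t)%:E.
      rewrite !poweR_EFin -!EFinM; congr (_%:E).
      rewrite /fw powRM ?powR_ge0 ?(ltW (w0 t))// -powRrM /p' mulrCA divff ?gt_eqF// mulr1.
      rewrite -mulrA /s /dual_weight -powRD; last by rewrite (gt_eqF (w0 t)) implybT.
      rewrite (_ : (p / (p - 1) + - (p - 1)^-1 = 1)%R) ?powRr1 ?(ltW (w0 t))//.
      by field; rewrite gt_eqF.
    rewrite -ge0_muleDl ?poweR_ge0// muleA lee_wpmul2r ?lee_fin ?(ltW (s0 t))//.
    by rewrite -lee_fin; apply: (@poweRD_le _ (fw t)%:E (u t)%:E); rewrite ?lee_fin// ltW.
  rewrite ge0_integralZl_EFin ?powR_ge0//; last 2 first.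
  - by move=> t _; rewrite adde_ge0 ?mule_ge0 ?poweR_ge0// lee_fin ltW.
  - apply: emeasurable_funD; apply: emeasurable_funM; try exact: mE;
      by apply: measurableT_comp_poweR; exact: mE.
  rewrite lee_wpmul2l ?lee_fin ?powR_ge0// ge0_integralD//.
  - by rewrite uI.
  - by move=> t _; rewrite mule_ge0 ?poweR_ge0// lee_fin ltW.
  - by apply: emeasurable_funM; try exact: mE; apply: measurableT_comp_poweR; exact: mE.
  - by move=> t _; rewrite mule_ge0 ?poweR_ge0// lee_fin ltW.
  - by apply: emeasurable_funM; try exact: mE; apply: measurableT_comp_poweR; exact: mE.
have hfin : \int[mu]_t (h t `^ p' * (s t)%:E) < +oo.
  apply: (le_lt_trans hI); rewrite lte_mul_pinfty ?lee_fin ?powR_ge0//.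
  by rewrite lte_add_pinfty// ltry.
have [r2 [E2 [mE2 E20 mr2 r20 [gr2 r2I r2A]]]] :=
  A1_majorant p1 K0 wAp (fun t => ltW (gpos t)) mg gpos gfin.
have [r1 [E1 [mE1 E10 mr1 r10 [hr1 r1I r1A]]]] :=
  A1_majorant p'1 K'0 sAp (fun t => ltW (hpos t)) mh hpos hfin.
pose E := E1 `|` E2.
have mEE : measurable E by exact: measurableU.
have E0 : mu E = 0.
  apply/eqP; rewrite -measure_le0 (le_trans (measureU2 _ _ _))//.
  by rewrite [X in X + _]E10 [X in _ + X]E20 adde0.
pose W t := (r1 t * r2 t `^ (1 - p0))%R.
have W0 t : (0 < W t)%R by rewrite mulr_gt0 ?powR_gt0.
have WAp : Ap p0 extrapolated_Ap_cst W.
  apply: (@Ap_of_A1 _ p0 _ _ r1 r2 E) => //; try exact: A1_cst_gt0.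
  - by move=> k t /not_orP[Et _]; exact: r1A.
  - by move=> k t /not_orP[_ Et]; exact: r2A.
have mW : measurable_fun setT W by case: WAp.
have mrr : measurable_fun setT (fun t => (r2 t * r1 t)%:E).
  by apply: mE; exact: measurable_funM.
have rr0 t : 0 <= (r2 t * r1 t)%:E by rewrite lee_fin mulr_ge0// ltW.
have mfp q (v : RR -> R) : measurable_fun setT v ->
    measurable_fun setT (fun t => (f t)%:E `^ q * (v t)%:E).
  by move=> mv; apply: emeasurable_funM; [apply: measurableT_comp_poweR; exact: mE|exact: mE].
set D := \int[mu]_t (r2 t * r1 t)%:E.
have D0 : 0 <= D by exact: integral_ge0.
have step1 : I <= (phi + 1)%:E * D.
  apply: (@le_trans _ _ (\int[mu]_t ((f t)%:E `^ p0 * (W t)%:E + (r2 t * r1 t)%:E))).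
    apply: ae_ge0_le_integral => //.
    - by move=> t _; rewrite mule_ge0 ?poweR_ge0// lee_fin ltW.
    - exact: mfp.
    - by move=> t _; rewrite adde_ge0// mule_ge0 ?poweR_ge0// lee_fin ltW.
    - by apply: emeasurable_funD => //; exact: mfp.
    exists E; split => // t /= hh; apply: contrapT => /not_orP[Et1 Et2]; apply: hh => _.
    have hr : (fw t <= r1 t)%R.
      by have := hr1 t Et1; rewrite /h -EFinD lee_fin; apply: le_trans; rewrite lerDl ltW.
    rewrite -EFinM -EFinM -EFinD lee_fin.
    apply: (@le_trans _ _ (f t * r1 t)%R).
      by rewrite -(mulr_powRB1 (f0 t) pgt0) -mulrA ler_wpM2l.
    have [fr|fr] := leP (f t) (r2 t).
      apply: (@le_trans _ _ (r2 t * r1 t)%R); first by rewrite ler_wpM2r// ltW.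
      by rewrite lerDr mulr_ge0 ?powR_ge0// ltW.
    apply: (@le_trans _ _ (f t `^ p0 * W t)%R); last by rewrite lerDl mulr_ge0 ?ltW.
    rewrite /W mulrCA mulrC ler_wpM2l ?(ltW (r10 t))//.
    rewrite -(mulr_powRB1 (f0 t) (lt_trans ltr01 p0_gt1)) -mulrA ler_peMr//.
    rewrite (_ : (1 - p0)%R = (- (p0 - 1))%R); last by rewrite opprB.
    rewrite powRN ler_pdivlMr ?powR_gt0// mul1r.
    by apply: ge0_ler_powR; rewrite ?nnegrE ?subr_ge0 ?(ltW p0_gt1) ?(ltW (r20 t))// ltW.
  rewrite ge0_integralD//; last 2 first.
  - by move=> t _; rewrite mule_ge0 ?poweR_ge0// lee_fin ltW.
  - exact: mfp.
  rewrite EFinD ge0_muleDl ?lee_fin// mul1e leeD2r//.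
  apply: (le_trans (fG WAp)); rewrite lee_wpmul2l ?lee_fin//.
  apply: ae_ge0_le_integral => //.
  - by move=> t _; rewrite mule_ge0 ?poweR_ge0// lee_fin ltW.
  - by apply: emeasurable_funM; [exact: measurableT_comp_poweR|exact: mE].
  exists E; split => // t /= hh; apply: contrapT => /not_orP[Et1 Et2]; apply: hh => _.
  apply: (@le_trans _ _ ((r2 t)%:E `^ p0 * (W t)%:E)).
    rewrite lee_wpmul2r ?lee_fin ?(ltW (W0 t))//; apply: lee_poweR => //.
      by rewrite (le_trans ler01)// ltW.
    exact: le_trans (Gg t) (gr2 t Et2).
  rewrite poweR_EFin -EFinM lee_fin /W mulrCA -powRD; last by rewrite (gt_eqF (r20 t)) implybT.
  by rewrite addrC subrK powRr1 1?mulrC// ltW.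
(* Duality between L^p(w) and its dual space, with r1 in the latter. *)
have step2 : D <= delta%:E * \int[mu]_t ((r1 t)%:E `^ p' * (s t)%:E) +
    ((delta `^ (p - 1))^-1)%:E * \int[mu]_t ((r2 t)%:E `^ p * (w t)%:E).
  have mr q (r v : RR -> R) : measurable_fun setT r -> measurable_fun setT v ->
      measurable_fun setT (fun t => (r t)%:E `^ q * (v t)%:E).
    move=> mr mv; apply: emeasurable_funM; last exact: mE.
    by apply: measurableT_comp_poweR; exact: mE.
  have di0 : (0 <= (delta `^ (p - 1))^-1)%R by rewrite invr_ge0 powR_ge0.
  rewrite -!ge0_integralZl_EFin ?(ltW delta0)//; last 4 first.
  - by move=> t _; rewrite mule_ge0 ?poweR_ge0// lee_fin ltW.
  - exact: mr.
  - by move=> t _; rewrite mule_ge0 ?poweR_ge0// lee_fin ltW.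
  - exact: mr.
  rewrite -ge0_integralD//; last 4 first.
  - by move=> t _; rewrite !mule_ge0 ?poweR_ge0// lee_fin ltW.
  - by apply: measurable_funeM; exact: mr.
  - by move=> t _; rewrite !mule_ge0 ?poweR_ge0// lee_fin ltW.
  - by apply: measurable_funeM; exact: mr.
  apply: ge0_le_integralW => t _ //.
  rewrite !poweR_EFin -!EFinM -EFinD lee_fin.
  exact: dual_young.
have step3 : I <= (phi + 1)%:E * (delta%:E * (m'%:E * (I + e%:E)) +
    ((delta `^ (p - 1))^-1)%:E * ((majorant_cst p)%:E * \int[mu]_t (g t `^ p * (w t)%:E))).
  apply: (le_trans step1); rewrite lee_wpmul2l ?lee_fin ?(ltW phi1)//.
  apply: (le_trans step2); apply: leeD.
    rewrite lee_wpmul2l ?lee_fin ?(ltW delta0)//; apply: (le_trans r1I).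
    rewrite (_ : m'%:E = (majorant_cst p')%:E * (2 `^ p')%:E); last by rewrite -EFinM.
    by rewrite -muleA lee_wpmul2l ?lee_fin ?(ltW (mc0 _)).
  by rewrite lee_wpmul2l ?lee_fin ?invr_ge0 ?powR_ge0.
move: step3 gfin ffin I0; rewrite -/I.
have : 0 <= \int[mu]_t (g t `^ p * (w t)%:E).
  by apply: integral_ge0 => t _; rewrite mule_ge0 ?poweR_ge0// lee_fin ltW.
case: (\int[mu]_t (g t `^ p * (w t)%:E)) => [gp| |]//; case: (I) => [i| |]//.
rewrite !lee_fin => gp0 + _ _ i0.
rewrite mulrDr (mulrA (phi + 1)%R delta) (mulrA _ m').
rewrite (_ : ((phi + 1) * delta * m' = 2^-1)%R); last first.
  by rewrite /delta; field; rewrite !gt_eqF.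
have -> : ((phi + 1) * ((delta `^ (p - 1))^-1 * (majorant_cst p * gp)) = C0 * gp / 2)%R.
  by rewrite /C0; field; rewrite gt_eqF// powR_gt0.
lra.
Qed.

End pair.

Definition extrapolation_cst : R := (C0 * 2 `^ p)%R.

Lemma extrapolation_cst_gt0 : (0 < extrapolation_cst)%R.
Proof. by rewrite mulr_gt0// powR_gt0. Qed.

Section general_pair.
Variables (w : RR -> R) (F G : RR -> \bar R).
Hypotheses (wAp : Ap p K w).
Hypotheses (F0 : forall t, 0 <= F t) (mF : measurable_fun setT F).
Hypotheses (G0 : forall t, 0 <= G t) (mG : measurable_fun setT G).
Hypothesis FG : forall W, Ap p0 extrapolated_Ap_cst W ->
  \int[mu]_t (F t `^ p0 * (W t)%:E) <= phi%:E * \int[mu]_t (G t `^ p0 * (W t)%:E).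

Let w0 t : (0 < w t)%R. Proof. by case: wAp. Qed.
Let mw : measurable_fun setT w. Proof. by case: wAp. Qed.

(** Bounding the values, the domain and the weight makes the L^p(w) norm finite. *)
Let trunc (N : nat) (t : RR) : R :=
  if (`|t| <= N%:R)%R && (w t <= N%:R)%R then fine (mine (F t) N%:R%:E) else 0%R.

Let trunc_fin N t : mine (F t) N%:R%:E \is a fin_num.
Proof.
rewrite ge0_fin_numE; last by rewrite le_min F0 lee_fin ler0n.
by rewrite gt_min ltry orbT.
Qed.

Let trunc_ge0 N t : (0 <= trunc N t)%R.
Proof.
rewrite /trunc; case: ifPn => // _; apply: fine_ge0.
by rewrite le_min F0 lee_fin ler0n.
Qed.

Let trunc_le N t : (trunc N t)%:E <= F t.
Proof.
by rewrite /trunc; case: ifPn => // _; rewrite fineK// ge_min lexx.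
Qed.

Let measurable_trunc N : measurable_fun setT (trunc N).
Proof.
apply: measurable_fun_ifT => //; last first.
  by apply: measurableT_comp => //; apply: measurable_mine.
apply: measurable_and; apply: measurable_fun_ler => //.
Qed.

Let trunc_mono t : nondecreasing_seq (trunc ^~ t).
Proof.
move=> N M NM; rewrite /trunc; case: ifPn => [/andP[tN wN]|_]; last exact: trunc_ge0.
have NM' : (N%:R <= M%:R :> R)%R by rewrite ler_nat.
rewrite (le_trans tN NM') (le_trans wN NM')/= -lee_fin !fineK//.
by rewrite le_min !ge_min lexx/= lee_fin NM' orbT.
Qed.

Let trunc_sup t : F t <= ereal_sup (range (fun N => (trunc N t)%:E)).
Proof.
set S := ereal_sup _.
have S0 : 0 <= S.
  by apply: (@le_trans _ _ (trunc 0 t)%:E); [rewrite lee_fin|apply: ereal_sup_ubound; exists 0%N].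
pose N0 := (Num.bound `|t| + Num.bound (w t))%N.
have minS N : (N0 <= N)%N -> mine (F t) N%:R%:E <= S.
  move=> N0N; apply: le_ereal_sup_tmp; exists (trunc N t)%:E; first by exists N.
  have Nb : (`|t| <= N%:R)%R && (w t <= N%:R)%R.
    apply/andP; split.
      rewrite (le_trans (ltW (archi_boundP (normr_ge0 t))))// ler_nat.
      by rewrite (leq_trans _ N0N)// leq_addr.
    rewrite (le_trans (ltW (archi_boundP (ltW (w0 t)))))// ler_nat.
    by rewrite (leq_trans _ N0N)// leq_addl.
  by rewrite /trunc Nb fineK.
move: S0 minS; case: (S) => [x| |]// S0 minS; last by rewrite leey.
have := minS (maxn N0 (Num.bound x)) (leq_maxl _ _).
rewrite ge_min => /orP[//|]; rewrite lee_fin => h; exfalso.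
move: h; apply/negP; rewrite -ltNge (lt_le_trans (archi_boundP S0))// ler_nat.
exact: leq_maxr.
Qed.

Let trunc_Lp_fin N : \int[mu]_t ((trunc N t)%:E `^ p * (w t)%:E) < +oo.
Proof.
pose D := `[(- N%:R)%R, N%:R%R]%classic : set RR.
apply: (@le_lt_trans _ _ (\int[mu]_t ((N%:R `^ p * N%:R)%:E * (\1_D t)%:E))).
  apply: ge0_le_integralW => t _; first by rewrite mule_ge0 ?poweR_ge0// lee_fin ltW.
  rewrite poweR_EFin -!EFinM lee_fin /trunc; case: ifPn => [/andP[tN wN]|_]; last first.
    by rewrite powR0 ?gt_eqF// mul0r mulr_ge0// mulr_ge0 ?powR_ge0.
  rewrite indicE mem_set ?mulr1; last by rewrite /D/= in_itv/= -ler_norml.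
  apply: ler_pM => //; [exact: powR_ge0|exact: ltW|].
  apply: ge0_ler_powR; rewrite ?nnegrE ?(ltW pgt0)//.
    by apply: fine_ge0; rewrite le_min F0 lee_fin ler0n.
  by rewrite -lee_fin fineK// ge_min lexx orbT.
rewrite ge0_integralZl_EFin ?mulr_ge0 ?powR_ge0//; last first.
  by apply/measurable_EFinP; apply: measurable_indic; exact: measurable_itv.
rewrite integral_indic; [|by []|exact: measurable_itv].
rewrite setIT lte_mul_pinfty ?lee_fin ?mulr_ge0 ?powR_ge0//.
have : @lebesgue_measure R `[(- N%:R)%R, N%:R%R]%classic < +oo; last by [].
by rewrite lebesgue_measure_itv/=; case: ifPn => _; rewrite -?EFinB ltry.
Qed.

Let trunc_bound N (e : R) : (0 < e)%R -> \int[mu]_t (G t `^ p * (w t)%:E) < +oo ->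
  \int[mu]_t ((trunc N t)%:E `^ p * (w t)%:E) <=
  e%:E + C0%:E * ((2 `^ p)%:E * (\int[mu]_t (G t `^ p * (w t)%:E) + e%:E)).
Proof.
move=> e0 Gfin.
have [u [mu_ u0 uI]] := positive_Lp_small pgt0 e0 w0 mw.
pose g t := G t + (u t)%:E.
have mue : measurable_fun setT (EFin \o u) by exact/measurable_EFinP.
have mwe : measurable_fun setT (EFin \o w) by exact/measurable_EFinP.
have gpos t : 0 < g t by rewrite lte_paddl// lte_fin.
have mg : measurable_fun setT g by exact: emeasurable_funD.
have gI : \int[mu]_t (g t `^ p * (w t)%:E) <=
    (2 `^ p)%:E * (\int[mu]_t (G t `^ p * (w t)%:E) + e%:E).
  rewrite -uI -ge0_integralD//; last 4 first.
  - by move=> t _; rewrite mule_ge0 ?poweR_ge0// lee_fin ltW.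
  - by apply: emeasurable_funM => //; exact: measurableT_comp_poweR.
  - by move=> t _; rewrite mule_ge0 ?poweR_ge0// lee_fin ltW.
  - by apply: emeasurable_funM => //; exact: measurableT_comp_poweR.
  rewrite -ge0_integralZl_EFin ?powR_ge0//; last 2 first.
  - by move=> t _; rewrite adde_ge0 ?mule_ge0 ?poweR_ge0// lee_fin ltW.
  - by apply: emeasurable_funD; apply: emeasurable_funM => //; exact: measurableT_comp_poweR.
  apply: ge0_le_integralW => t _; first by rewrite mule_ge0 ?poweR_ge0// lee_fin ltW.
  rewrite -ge0_muleDl ?poweR_ge0// muleA lee_wpmul2r ?lee_fin ?(ltW (w0 t))//.
  by apply: poweRD_le; rewrite // lee_fin ltW.
have gfin : \int[mu]_t (g t `^ p * (w t)%:E) < +oo.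
  rewrite (le_lt_trans gI)// lte_mul_pinfty ?lee_fin ?powR_ge0//.
  by rewrite lte_add_pinfty// ltry.
apply: (le_trans (@extrapolation_bounded_pair w (trunc N) g G e wAp e0 (trunc_ge0 N)
  (@measurable_trunc N) (trunc_Lp_fin N) gpos mg gfin G0 mG _ _)).
- by move=> t; rewrite leeDl// lee_fin ltW.
- move=> W WAp; apply: le_trans (FG WAp); have [_ W0 _] := WAp.
  apply: ge0_le_integralW => t _; first by rewrite mule_ge0 ?poweR_ge0// lee_fin ltW.
  rewrite lee_wpmul2r ?lee_fin ?(ltW (W0 t))//; apply: lee_poweR => //.
  + by rewrite ltW// (lt_trans ltr01).
  + by rewrite lee_fin.
by rewrite leeD2l// lee_wpmul2l ?lee_fin ?(ltW C0_gt0).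
Qed.

(** Truncations of F have finite norm, and adding a small function makes G
    positive; extrapolation_bounded_pair then holds with errors that vanish in the
    limit. *)
Lemma extrapolation_pair : \int[mu]_t (F t `^ p * (w t)%:E) <=
  extrapolation_cst%:E * \int[mu]_t (G t `^ p * (w t)%:E).
Proof.
have [Gfin|] := ltP (\int[mu]_t (G t `^ p * (w t)%:E)) +oo; last first.
  rewrite leye_eq => /eqP ->.
  by rewrite gt0_muley ?leey// lte_fin extrapolation_cst_gt0.
have G_ge0 : 0 <= \int[mu]_t (G t `^ p * (w t)%:E).
  by apply: integral_ge0 => t _; rewrite mule_ge0 ?poweR_ge0// lee_fin ltW.
have bound N : \int[mu]_t ((trunc N t)%:E `^ p * (w t)%:E) <=
    extrapolation_cst%:E * \int[mu]_t (G t `^ p * (w t)%:E).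
  apply/lee_addgt0Pr => e e0.
  have k0 : (0 < 1 + extrapolation_cst)%R by rewrite addr_gt0// extrapolation_cst_gt0.
  have e'0 : (0 < e / (1 + extrapolation_cst))%R by rewrite divr_gt0.
  apply: (le_trans (trunc_bound N e'0 Gfin)).
  rewrite muleA -EFinM -/extrapolation_cst ge0_muleDr ?lee_fin ?(ltW e'0)//.
  rewrite addeCA leeD2l// -EFinM -EFinD lee_fin.
  rewrite -[X in (X + _)%R]mul1r -mulrDl mulrC divfK// gt_eqF//.
have [nu [nuE nuI]] := density_measure mu (fun t => ltW (w0 t)) mw.
rewrite -nuI//; last 2 first.
- by move=> t; exact: poweR_ge0.
- exact: measurableT_comp_poweR.
apply: (@le_trans _ _ (\int[nu]_t ereal_sup (range (fun N => (trunc N t)%:E `^ p)))).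
  apply: ge0_le_integralW => t _; first exact: poweR_ge0.
  apply: (@le_trans _ _ (ereal_sup (range (fun N => (trunc N t)%:E)) `^ p)).
    by apply: lee_poweR; rewrite ?(ltW pgt0).
  by apply: (poweR_ereal_sup_le pgt0) => N; rewrite lee_fin.
have mt N : measurable_fun setT (fun t => (trunc N t)%:E `^ p).
  apply: measurableT_comp_poweR; apply/measurable_EFinP; exact: measurable_trunc.
apply: integral_ereal_sup_le => //.
- by move=> N t; exact: poweR_ge0.
- move=> t N M NM; apply: lee_poweR; rewrite ?(ltW pgt0) ?lee_fin//.
  exact: trunc_mono.
- by move=> N; rewrite nuI// => t; exact: poweR_ge0.
Qed.

End general_pair.
End extrapolation_constants.
End extrapolation.

(** * Norms for which the maximal function is bounded *)

Lemma measurable_maxfun_param (R : realType) d (T : measurableType d)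
    (f : measurableTypeR R * T -> \bar R) : (forall z, 0 <= f z) ->
  measurable_fun setT f ->
  measurable_fun setT (fun z : measurableTypeR R * T =>
    maxfun lebesgue_measure (fun u => f (u, z.2)) z.1).
Proof.
move=> f0 mf; apply: measurable_ereal_supT => k.
have mI : measurable_fun setT (fun z : measurableTypeR R * T => (\1_(oitv (rat_itv k)) z.1 : R)%:E).
  apply/measurable_EFinP; apply: measurableT_comp => //.
  by apply: measurable_indic; exact: measurable_oitv.
apply: emeasurable_funM => //.
have [r rE] : exists2 r : R, (@lebesgue_measure R (oitv (rat_itv k)))^-1 = r%:E \/
    @lebesgue_measure R (oitv (rat_itv k)) = 0 & (0 <= r)%R.
  have [n0|n0] := eqVneq (@lebesgue_measure R (oitv (rat_itv k))) 0.
    by exists 0%R => //; right.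
  have [r rE r0] := inve_fin_ge0 (measure_ge0 (@lebesgue_measure R) _) (lebesgue_oitv_fin (rat_itv k)) n0.
  by exists r => //; left.
move=> r0.
rewrite (_ : (fun z => _) = (fun z => r%:E * \int[lebesgue_measure]_u
    ((\1_(oitv (rat_itv k)) u)%:E * f (u, z.2)))).
  apply: measurable_funeM.
  apply: (measurableT_comp (f := fun y => \int[lebesgue_measure]_u ((\1_(oitv (rat_itv k)) u)%:E * f (u, y)))) => //.
  apply: (measurable_fun_fubini_tonelli_G (fun z : measurableTypeR R * T => (\1_(oitv (rat_itv k)) z.1)%:E * f z)).
    exact: emeasurable_funM.
  by move=> z; rewrite mule_ge0// lee_fin.
apply/funext => z; rewrite /avg.
have IE : \int[lebesgue_measure]_(u in oitv (rat_itv k)) f (u, z.2) =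
    \int[lebesgue_measure]_u ((\1_(oitv (rat_itv k)) u)%:E * f (u, z.2)).
  rewrite integral_mkcond; apply: eq_integral => u _; rewrite patchE indicE.
  by case: ifPn => _; rewrite ?mul1e ?mul0e.
case: rE => [->|n0]; first by rewrite IE muleC.
rewrite -IE null_set_integral ?mul0e ?mule0//; first exact: measurable_oitv.
apply: measurable_funTS.
exact: (measurableT_comp mf (pair2_measurable z.2)).
Qed.

Section maximal_regular_norms.
Context {R : realType}.
Local Notation RR := (measurableTypeR R).
Local Notation mu := (@lebesgue_measure R).

(** The maximal operator acts in an extra variable t, for each value of the
    parameter of rho, and is required to be bounded on L^s(w dt; rho) for all
    exponents s and all Muckenhoupt weights w. Asking for all weights is what makes
    the property inherited by L^p(rho). *)
Record maximal_regular d (T : measurableType d) (rho : (T -> \bar R) -> \bar R) : Prop :=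
  MaximalRegular {
  mr_ge0 : forall f, (forall x, 0 <= f x) -> 0 <= rho f;
  mr_mono : forall f g, (forall x, 0 <= f x) -> (forall x, f x <= g x) -> rho f <= rho g;
  mr_measurable : forall d' (T' : measurableType d') (f : T' * T -> \bar R),
    (forall z, 0 <= f z) -> measurable_fun setT f ->
    measurable_fun setT (fun x => rho (fun y => f (x, y)));
  mr_maximal : forall s K : R, (1 < s)%R -> (0 < K)%R -> exists2 C : R, (0 < C)%R &
    forall (w : RR -> R), Ap s K w -> forall f : RR * T -> \bar R,
    (forall z, 0 <= f z) -> measurable_fun setT f ->
    \int[mu]_t (rho (fun y => maxfun mu (fun u => f (u, y)) t) `^ s * (w t)%:E) <=
    C%:E * \int[mu]_t (rho (fun y => f (t, y)) `^ s * (w t)%:E) }.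

(** For a one-point parameter space this is the weighted inequality Ap_maximal. *)
Lemma maximal_regular_unit : maximal_regular (fun f : unit -> \bar R => f tt).
Proof.
split.
- by move=> f f0.
- by move=> f g f0 fg.
- by move=> d' T' f f0 mf; exact: (measurableT_comp mf (pair2_measurable tt)).
- move=> s K s1 K0; exists (Ap_cst s K); first exact: Ap_cst_gt0.
  move=> w wAp f f0 mf; apply: (Ap_maximal (f := fun t => f (t, tt))) => //.
  exact: (measurableT_comp mf (pair2_measurable tt)).
Qed.

Definition Lp_norm d1 d2 (T : measurableType d1) (S : measurableType d2)
    (m : {measure set S -> \bar R}) (p : R) (rho : (T -> \bar R) -> \bar R)
    (f : T * S -> \bar R) : \bar R :=
  (\int[m]_s (rho (fun x => f (x, s)) `^ p)) `^ p^-1.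

Section Lp_regular.
Context d1 d2 (T : measurableType d1) (S : measurableType d2).
Variables (m : {sigma_finite_measure set S -> \bar R}) (p : R) (rho : (T -> \bar R) -> \bar R).
Hypotheses (p1 : (1 < p)%R) (rho_reg : maximal_regular rho).

Let p0 : (0 < p)%R. Proof. exact: lt_trans ltr01 p1. Qed.
Let rho' := Lp_norm m p rho.

Let rho_measurable d' (T' : measurableType d') (f : T' * (T * S) -> \bar R) :
  (forall z, 0 <= f z) -> measurable_fun setT f ->
  measurable_fun setT (fun z : T' * S => rho (fun x => f (z.1, (x, z.2)))).
Proof.
move=> f0 mf.
apply: (mr_measurable rho_reg (f := fun z : (T' * S) * T => f (z.1.1, (z.2, z.1.2)))) => //.
apply: (measurableT_comp mf); apply: measurable_fun_pair; first exact: measurableT_comp.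
by apply: measurable_fun_pair => //; exact: measurableT_comp.
Qed.

Let Lp_norm_measurable d' (T' : measurableType d') (f : T' * (T * S) -> \bar R) :
  (forall z, 0 <= f z) -> measurable_fun setT f ->
  measurable_fun setT (fun x => rho' (fun y => f (x, y))).
Proof.
move=> f0 mf; apply: measurableT_comp_poweR.
apply: (measurable_fun_fubini_tonelli_F (fun z : T' * S => rho (fun x => f (z.1, (x, z.2))) `^ p)).
  by apply: measurableT_comp_poweR; exact: rho_measurable.
by move=> z; exact: poweR_ge0.
Qed.

Let Lp_norm_pow (f : T * S -> \bar R) : (forall z, 0 <= f z) ->
  rho' f `^ p = \int[m]_s (rho (fun x => f (x, s)) `^ p).
Proof.
move=> f0; rewrite /rho' /Lp_norm poweRKV ?gt_eqF//.
by apply: integral_ge0 => s _; exact: poweR_ge0.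
Qed.

Let fubini_weight (w : RR -> R) (h : RR * (T * S) -> \bar R) :
  (forall t, 0 < w t)%R -> measurable_fun setT w ->
  (forall z, 0 <= h z) -> measurable_fun setT h ->
  \int[mu]_t (rho' (fun y => h (t, y)) `^ p * (w t)%:E) =
  \int[m]_s \int[mu]_t (rho (fun x => h (t, (x, s))) `^ p * (w t)%:E).
Proof.
move=> w0 mw h0 mh.
have mrho : measurable_fun setT (fun z : RR * S => rho (fun x => h (z.1, (x, z.2))) `^ p).
  by apply: measurableT_comp_poweR; exact: rho_measurable.
rewrite -(fubini_tonelli (fun z : RR * S => rho (fun x => h (z.1, (x, z.2))) `^ p * (w z.1)%:E)).
- apply: eq_integral => t _; rewrite Lp_norm_pow//= ge0_integralZr//.
  + exact: (measurableT_comp mrho (pair1_measurable t)).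
  + by move=> s _; exact: poweR_ge0.
  + by rewrite lee_fin ltW.
- apply: emeasurable_funM => //.
  by apply/measurable_EFinP; exact: measurableT_comp.
- by move=> z; rewrite mule_ge0 ?poweR_ge0// lee_fin ltW.
Qed.

(** Fubini's theorem gives the maximal inequality on L^p(w; L^p(rho));
    extrapolation then moves the outer exponent away from p. *)
Lemma maximal_regular_Lp : maximal_regular rho'.
Proof.
split.
- by move=> f f0; exact: poweR_ge0.
- move=> f g f0 fg; apply: lee_poweR; first by rewrite invr_ge0 ltW.
    by apply: integral_ge0 => s _; exact: poweR_ge0.
  apply: ge0_le_integralW => s _; first exact: poweR_ge0.
  apply: lee_poweR; first exact: ltW.
    exact: (mr_ge0 rho_reg).
  exact: (mr_mono rho_reg).
- by move=> d' T' f f0 mf; exact: Lp_norm_measurable.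
move=> s K s1 K0.
have K1 : (0 < extrapolated_Ap_cst p s K)%R.
  rewrite /extrapolated_Ap_cst mulr_gt0 ?powR_gt0 ?A1_cst_gt0 ?powR_gt0//.
  by rewrite ltr_pdivlMr ?subr_gt0// mul1r ltrBlDr ltrDl.
have [phi phi0 rho_phi] := mr_maximal rho_reg p1 K1.
exists (extrapolation_cst s phi); first exact/extrapolation_cst_gt0/ltW.
move=> w wAp f f0 mf.
pose Mf (z : RR * (T * S)) := maxfun mu (fun u => f (u, z.2)) z.1.
have Mf0 z : 0 <= Mf z by exact: maxfun_ge0.
have mMf : measurable_fun setT Mf by exact: measurable_maxfun_param.
apply: (@extrapolation_pair R p s K phi p1 s1 K0 (ltW phi0) w
  (fun t => rho' (fun y => Mf (t, y))) (fun t => rho' (fun y => f (t, y))) wAp) => //.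
- by move=> t; exact: poweR_ge0.
- exact: Lp_norm_measurable.
- by move=> t; exact: poweR_ge0.
- exact: Lp_norm_measurable.
move=> W WAp; have [mW W0 _] := WAp.
rewrite !fubini_weight//.
have mG (h : RR * (T * S) -> \bar R) : (forall z, 0 <= h z) -> measurable_fun setT h ->
    measurable_fun setT (fun s => \int[mu]_t (rho (fun x => h (t, (x, s))) `^ p * (W t)%:E)).
  move=> h0 mh.
  apply: (measurable_fun_fubini_tonelli_G (fun z : RR * S => rho (fun x => h (z.1, (x, z.2))) `^ p * (W z.1)%:E)).
    apply: emeasurable_funM; first by apply: measurableT_comp_poweR; exact: rho_measurable.
    by apply/measurable_EFinP; exact: measurableT_comp.
  by move=> z; rewrite mule_ge0 ?poweR_ge0// lee_fin ltW.
have I0 (h : RR * (T * S) -> \bar R) y :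
    0 <= \int[mu]_t (rho (fun x => h (t, (x, y))) `^ p * (W t)%:E).
  by apply: integral_ge0 => t _; rewrite mule_ge0 ?poweR_ge0// lee_fin ltW.
rewrite -ge0_integralZl_EFin ?(ltW phi0)//; last exact: mG.
apply: ge0_le_integralW => y _; first exact: I0.
apply: (rho_phi W WAp (fun z : RR * T => f (z.1, (z.2, y)))) => //.
apply: (measurableT_comp mf); apply: measurable_fun_pair => //.
by apply: measurable_fun_pair => //; exact: measurable_cst.
Qed.

End Lp_regular.

Lemma Ap_cst1 (p : R) : (1 < p)%R -> Ap p 1 (fun _ : RR => 1%R).
Proof.
move=> p1; split => // k; rewrite powR1 mul1e.
have I1 : \int[mu]_(t in oitv (rat_itv k)) 1%:E = mu (oitv (rat_itv k)).
  by rewrite integral_cst ?mul1e//; exact: measurable_oitv.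
rewrite [X in X * _]I1 [X in _ * X `^ _]I1.
have mfin : mu (oitv (rat_itv k)) \is a fin_num.
  by rewrite ge0_fin_numE//; exact: lebesgue_oitv_fin.
have m0 : (0 <= fine (mu (oitv (rat_itv k))))%R by exact: fine_ge0.
rewrite -(fineK mfin).
by rewrite !poweR_EFin -EFinM lee_fin mulr_powRB1// (lt_trans ltr01).
Qed.

End maximal_regular_norms.

(** * Mixed norms *)

Section tuple_cons.
Context {R : realType}.
Local Notation RR := (measurableTypeR R).

Lemma cons_thead_behead n (x : Rn R n.+1) : [tuple of thead x :: [tuple of behead x]] = x.
Proof. by case/tupleP: x => a s; apply/val_inj. Qed.

Lemma behead_cons (T : Type) n (t : T) (x : n.-tuple T) : [tuple of behead [tuple of t :: x]] = x.
Proof. exact: val_inj. Qed.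

Lemma measurable_thead n : measurable_fun setT (fun x : Rn R n.+1 => thead x : RR).
Proof. exact: measurable_tnth. Qed.

Lemma measurable_cons_tuple d (T : measurableType d) n (f : T -> RR) (g : T -> Rn R n) :
  measurable_fun setT f -> measurable_fun setT g ->
  measurable_fun setT (fun x => [tuple of f x :: g x] : Rn R n.+1).
Proof. exact: measurable_cons. Qed.

End tuple_cons.

Section mixed_norm_theory.
Context {R : realType}.
Local Notation RR := (measurableTypeR R).
Local Notation mu := (@lebesgue_measure R).

Definition exponents_gt1 n (p : n.-tuple R) := forall i, (1 < tnth p i)%R.

Lemma exponents_thead n (p : n.+1.-tuple R) : exponents_gt1 p -> (1 < thead p)%R.
Proof. exact. Qed.

Lemma exponents_behead n (p : n.+1.-tuple R) : exponents_gt1 p ->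
  exponents_gt1 [tuple of behead p].
Proof. by move=> p1 i; rewrite tnth_behead. Qed.

Lemma LnormE d (T : measurableType d) (m : {measure set T -> \bar R}) (r : R) (f : T -> \bar R) :
  (forall x, 0 <= f x) -> Lnorm m r%:E f = (\int[m]_x (f x `^ r)) `^ r^-1.
Proof.
move=> f0; rewrite unlock; congr (_ `^ _); apply: eq_integral => x _.
by rewrite gee0_abs.
Qed.

Lemma mixed_norm_ge0 n (p : n.-tuple R) f : 0 <= mixed_norm p f.
Proof. by elim: n p f => [|n IH] p f /=. Qed.

Lemma mixed_norm_mono n (p : n.-tuple R) (f g : Rn R n -> \bar R) : exponents_gt1 p ->
  (forall x, 0 <= f x) -> (forall x, f x <= g x) -> mixed_norm p f <= mixed_norm p g.
Proof.
elim: n p f g => [|n IH] p f g p1 f0 fg /=.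
  by rewrite !gee0_abs//; exact: le_trans (f0 _) (fg _).
have g0 x : 0 <= g x by rewrite (le_trans (f0 x)).
have q1 := exponents_thead p1; have q0 := lt_trans ltr01 q1.
apply: IH => [|x|x]; [exact: exponents_behead|exact: Lnorm_ge0|].
rewrite !LnormE//; apply: lee_poweR; first by rewrite invr_ge0 ltW.
  by apply: integral_ge0 => t _; exact: poweR_ge0.
apply: ge0_le_integralW => t _; first exact: poweR_ge0.
by apply: lee_poweR => //; exact: ltW.
Qed.

Lemma eq_mixed_norm n (p : n.-tuple R) (f g : Rn R n -> \bar R) :
  f =1 g -> mixed_norm p f = mixed_norm p g.
Proof. by move=> /funext ->. Qed.

Lemma measurable_Lnorm_param d (T : measurableType d) n (r : R) (f : T * Rn R n.+1 -> \bar R) :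
  (forall z, 0 <= f z) -> measurable_fun setT f ->
  measurable_fun setT (fun z : T * Rn R n =>
    Lnorm mu r%:E (fun t : RR => f (z.1, [tuple of t :: z.2]))).
Proof.
move=> f0 mf; under eq_fun do rewrite LnormE//.
apply: measurableT_comp_poweR.
apply: (measurable_fun_fubini_tonelli_F
  (fun w : (T * Rn R n) * RR => f (w.1.1, [tuple of w.2 :: w.1.2]) `^ r)).
  apply: measurableT_comp_poweR; apply: (measurableT_comp mf).
  apply: measurable_fun_pair; first exact: measurableT_comp.
  by apply: measurable_cons_tuple => //; exact: measurableT_comp.
by move=> z; exact: poweR_ge0.
Qed.

Lemma measurable_Lnorm_cons n (r : R) (f : Rn R n.+1 -> \bar R) :
  (forall z, 0 <= f z) -> measurable_fun setT f ->
  measurable_fun setT (fun x : Rn R n => Lnorm mu r%:E (fun t : RR => f [tuple of t :: x])).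
Proof.
move=> f0 mf.
have := @measurable_Lnorm_param _ unit n r (fun z => f z.2) (fun z => f0 z.2)
  (measurableT_comp mf measurable_snd).
by move=> /measurableT_comp /(_ (pair1_measurable tt)).
Qed.

Lemma mixed_normZ_le n (p : n.-tuple R) (c : R) (f : Rn R n -> \bar R) : exponents_gt1 p ->
  (0 <= c)%R -> (forall x, 0 <= f x) -> measurable_fun setT f ->
  mixed_norm p (fun x => c%:E * f x) <= c%:E * mixed_norm p f.
Proof.
elim: n p f => [|n IH] p f p1 c0 f0 mf /=.
  by rewrite abseM gee0_abs.
have q1 := exponents_thead p1; have q0 := lt_trans ltr01 q1.
rewrite (@eq_mixed_norm _ _ _ (fun x => c%:E * Lnorm mu (thead p)%:E (fun t => f [tuple of t :: x]))).
  apply: IH; [exact: exponents_behead|by []|by move=> x; exact: Lnorm_ge0|].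
  exact: measurable_Lnorm_cons.
move=> x; rewrite !LnormE//; last by move=> t; rewrite mule_ge0.
have -> : \int[mu]_t ((c%:E * f [tuple of t :: x]) `^ thead p) =
    (c%:E `^ thead p) * \int[mu]_t (f [tuple of t :: x] `^ thead p).
  rewrite poweR_EFin -ge0_integralZl_EFin ?powR_ge0//.
  - by apply: eq_integral => t _; rewrite poweRM.
  - by move=> t _; exact: poweR_ge0.
  - apply: measurableT_comp_poweR; apply: (measurableT_comp mf).
    by apply: measurable_cons_tuple => //; exact: measurable_cst.
rewrite poweRM ?poweR_ge0//; last by apply: integral_ge0 => t _; exact: poweR_ge0.
by rewrite poweRVK// gt_eqF.
Qed.

(** The elementary bound (a + b)^r <= 2^r (a^r + b^r) is applied to the integrands
    with the exponent r, and to the integrals with the exponent 1/r. *)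
Lemma Lnorm_quasi_triangle d (T : measurableType d) (m : {measure set T -> \bar R}) (r : R)
    (f g : T -> \bar R) : (1 < r)%R ->
  (forall x, 0 <= f x) -> (forall x, 0 <= g x) ->
  measurable_fun setT f -> measurable_fun setT g ->
  Lnorm m r%:E (fun x => f x + g x) <= 4%:E * (Lnorm m r%:E f + Lnorm m r%:E g).
Proof.
move=> r1 f0 g0 mf mg; have r0 := lt_trans ltr01 r1.
have ri0 : (0 < r^-1)%R by rewrite invr_gt0.
rewrite !LnormE//; last by move=> x; rewrite adde_ge0.
set A := \int[m]_x (f x `^ r); set B := \int[m]_x (g x `^ r).
have A0 : 0 <= A by apply: integral_ge0 => x _; exact: poweR_ge0.
have B0 : 0 <= B by apply: integral_ge0 => x _; exact: poweR_ge0.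
apply: (@le_trans _ _ (((2 `^ r)%:E * (A + B)) `^ r^-1)).
  apply: lee_poweR; [exact: ltW|by apply: integral_ge0 => x _; exact: poweR_ge0|].
  rewrite /A /B -ge0_integralD//; last 4 first.
  - by move=> x _; exact: poweR_ge0.
  - exact: measurableT_comp_poweR.
  - by move=> x _; exact: poweR_ge0.
  - exact: measurableT_comp_poweR.
  rewrite -ge0_integralZl_EFin ?powR_ge0//; last 2 first.
  - by move=> x _; rewrite adde_ge0 ?poweR_ge0.
  - by apply: emeasurable_funD; exact: measurableT_comp_poweR.
  by apply: ge0_le_integralW => x _; [exact: poweR_ge0|exact: poweRD_le].
have -> : ((2 `^ r)%:E * (A + B)) `^ r^-1 = 2%:E * (A + B) `^ r^-1.
  rewrite poweRM; [|by rewrite lee_fin powR_ge0|by rewrite adde_ge0].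
  by rewrite poweR_EFin -powRrM divff ?gt_eqF// powRr1.
apply: (@le_trans _ _ (2%:E * ((2 `^ r^-1)%:E * (A `^ r^-1 + B `^ r^-1)))).
  by apply: lee_wpmul2l; [rewrite lee_fin|exact: poweRD_le].
rewrite muleA -EFinM lee_wpmul2r ?adde_ge0 ?poweR_ge0// lee_fin.
have -> : (4 = 2 * 2 :> R)%R by rewrite -natrM.
rewrite ler_wpM2l// -[leRHS]powRr1//.
by apply: ler_powR; rewrite ?ler1n// invf_le1 ?ltW.
Qed.

Lemma mixed_norm_quasi_triangle n (p : n.-tuple R) (f g : Rn R n -> \bar R) :
  exponents_gt1 p -> (forall x, 0 <= f x) -> (forall x, 0 <= g x) ->
  measurable_fun setT f -> measurable_fun setT g ->
  mixed_norm p (fun x => f x + g x) <= (4 ^+ n)%:E * (mixed_norm p f + mixed_norm p g).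
Proof.
elim: n p f g => [|n IH] p f g p1 f0 g0 mf mg /=.
  by rewrite expr0 mul1e !gee0_abs// adde_ge0.
have q1 := exponents_thead p1; have p1' := exponents_behead p1.
pose F (h : Rn R n.+1 -> \bar R) (x : Rn R n) :=
  Lnorm mu (thead p)%:E (fun t : RR => h [tuple of t :: x]).
have mF (h : Rn R n.+1 -> \bar R) : (forall x, 0 <= h x) -> measurable_fun setT h -> measurable_fun setT (F h).
  exact: measurable_Lnorm_cons.
have mcons (h : Rn R n.+1 -> \bar R) (x : Rn R n) : measurable_fun setT h ->
    measurable_fun setT (fun t : RR => h [tuple of t :: x] : \bar R).
  move=> mh; apply: (measurableT_comp mh).
  by apply: measurable_cons_tuple => //; exact: measurable_cst.
apply: (@le_trans _ _ (mixed_norm [tuple of behead p] (fun x => 4%:E * (F f x + F g x)))).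
  apply: mixed_norm_mono => // [x|x]; first exact: Lnorm_ge0.
  by apply: Lnorm_quasi_triangle => //; exact: mcons.
apply: (le_trans (mixed_normZ_le _ _ _ _)) => //.
- by move=> x; rewrite adde_ge0 ?Lnorm_ge0.
- by apply: emeasurable_funD; exact: mF.
rewrite exprS EFinM -muleA; apply: lee_wpmul2l; first by rewrite lee_fin.
by apply: IH => //; try (by move=> x; exact: Lnorm_ge0); exact: mF.
Qed.

End mixed_norm_theory.

(** * The iterated maximal operator *)

HB.instance Definition _ (R : realType) :=
  Measure_isSigmaFinite.Build _ _ _ (@counting nat R) (sigma_finite_counting R).

Section strong_maximal.
Context {R : realType}.
Local Notation RR := (measurableTypeR R).
Local Notation mu := (@lebesgue_measure R).

(** One-dimensional maximal functions in the first coordinate, then in the second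
    one, and so on. *)
Fixpoint strong_max (n : nat) : (Rn R n -> \bar R) -> Rn R n -> \bar R :=
  match n with
  | 0 => fun f => f
  | m.+1 => fun f x => strong_max
      (fun y => maxfun mu (fun t => f [tuple of t :: y]) (thead x : RR)) [tuple of behead x]
  end.

Lemma strong_max_ge0 n (f : Rn R n -> \bar R) x : (forall y, 0 <= f y) -> 0 <= strong_max f x.
Proof.
elim: n f x => [|n IH] f x f0 //=; apply: IH => y.
by apply: maxfun_ge0.
Qed.

Lemma measurable_strong_max_param d (T : measurableType d) n (f : T * Rn R n -> \bar R) :
  (forall z, 0 <= f z) -> measurable_fun setT f ->
  measurable_fun setT (fun z : T * Rn R n => strong_max (fun y => f (z.1, y)) z.2).
Proof.
elim: n d T f => [|n IH] d T f f0 mf /=.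
  by rewrite (_ : (fun z => _) = f)//; apply/funext => -[].
pose g (z : (T * RR) * Rn R n) := maxfun mu (fun t => f (z.1.1, [tuple of t :: z.2])) z.1.2.
have mg : measurable_fun setT g.
  pose h (z : RR * (T * Rn R n)) := f (z.2.1, [tuple of z.1 :: z.2.2]).
  have mh : measurable_fun setT h.
    apply: (measurableT_comp mf); apply: measurable_fun_pair; first exact: measurableT_comp.
    by apply: measurable_cons_tuple => //; exact: measurableT_comp.
  have h0 z : 0 <= h z by exact: f0.
  have mp : measurable_fun setT (fun z : (T * RR) * Rn R n => (z.1.2, (z.1.1, z.2))).
    apply: measurable_fun_pair; first exact: measurableT_comp.
    by apply: measurable_fun_pair => //; exact: measurableT_comp.
  exact: (measurableT_comp (measurable_maxfun_param h0 mh) mp).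
have g0 z : 0 <= g z by exact: maxfun_ge0.
have mp : measurable_fun setT
    (fun z : T * Rn R n.+1 => ((z.1, thead z.2 : RR), [tuple of behead z.2] : Rn R n)).
  apply: measurable_fun_pair.
    by apply: measurable_fun_pair => //; apply: (measurableT_comp (@measurable_thead R n)).
  by apply: (measurableT_comp (@measurable_behead _ RR n)).
exact: (measurableT_comp (IH _ _ g g0 mg) mp).
Qed.

Lemma measurable_strong_max n (f : Rn R n -> \bar R) :
  (forall x, 0 <= f x) -> measurable_fun setT f -> measurable_fun setT (strong_max f).
Proof.
move=> f0 mf.
have := @measurable_strong_max_param _ unit n (fun z => f z.2) (fun z => f0 z.2)
  (measurableT_comp mf measurable_snd).
by move=> /measurableT_comp /(_ (pair1_measurable tt)).
Qed.

(** The operators in the last coordinates are handled by the induction hypothesis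
    for the norm L^p1(rho), the one in the first coordinate by the maximal
    inequality of rho for the exponent p1 and the weight 1. *)
Theorem strong_max_mixed_norm n (p : n.-tuple R) d (T : measurableType d)
    (rho : (T -> \bar R) -> \bar R) : exponents_gt1 p -> maximal_regular rho ->
  exists2 C : R, (0 < C)%R & forall f : Rn R n * T -> \bar R,
    (forall z, 0 <= f z) -> measurable_fun setT f ->
    mixed_norm p (fun x => rho (fun w => strong_max (fun y => f (y, w)) x)) <=
    C%:E * mixed_norm p (fun x => rho (fun w => f (x, w))).
Proof.
elim: n p d T rho => [|n IH] p d T rho p1 rho_reg.
  by exists 1%R => // f f0 mf; rewrite mul1e.
have q1 := exponents_thead p1; have q0 := lt_trans ltr01 q1; set q := thead p in q1 q0.
have p1' := exponents_behead p1.
have [C1 C10 HC1] := IH _ _ _ _ p1' (maximal_regular_Lp (@lebesgue_measure R) q1 rho_reg).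
have [C2 C20 HC2] := mr_maximal rho_reg q1 ltr01.
exists (C1 * C2 `^ q^-1)%R; first by rewrite mulr_gt0// powR_gt0.
move=> f f0 mf.
pose g (z : Rn R n * (T * RR)) := maxfun mu (fun u => f ([tuple of u :: z.1], z.2.1)) z.2.2.
have g0 z : 0 <= g z by exact: maxfun_ge0.
have mg : measurable_fun setT g.
  pose h (z : RR * (Rn R n * T)) := f ([tuple of z.1 :: z.2.1], z.2.2).
  have mh : measurable_fun setT h.
    apply: (measurableT_comp mf); apply: measurable_fun_pair; last exact: measurableT_comp.
    by apply: measurable_cons_tuple => //; exact: measurableT_comp.
  have h0 z : 0 <= h z by exact: f0.
  have mp : measurable_fun setT (fun z : Rn R n * (T * RR) => (z.2.2, (z.1, z.2.1))).
    apply: measurable_fun_pair; first exact: measurableT_comp.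
    by apply: measurable_fun_pair => //; exact: measurableT_comp.
  exact: (measurableT_comp (measurable_maxfun_param h0 mh) mp).
have rho0 := mr_ge0 rho_reg.
have -> : mixed_norm p (fun x => rho (fun w => strong_max (fun y => f (y, w)) x)) =
    mixed_norm [tuple of behead p]
      (fun x => Lp_norm mu q rho (fun w => strong_max (fun y => g (y, w)) x)).
  rewrite /=; apply: eq_mixed_norm => x; rewrite LnormE; last first.
    by move=> t; apply: rho0 => w; apply: strong_max_ge0 => y; exact: maxfun_ge0.
  by rewrite /Lp_norm -/q; congr (_ `^ _); apply: eq_integral => t _; rewrite behead_cons.
apply: (le_trans (HC1 g g0 mg)); rewrite EFinM -muleA; apply: lee_wpmul2l.
  by rewrite lee_fin ltW.
pose F (x : Rn R n) := Lnorm mu q%:E (fun t : RR => rho (fun w => f ([tuple of t :: x], w))).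
have mrf : measurable_fun setT (fun x => rho (fun w => f (x, w))).
  exact: (mr_measurable rho_reg).
apply: (@le_trans _ _ (mixed_norm [tuple of behead p] (fun x => (C2 `^ q^-1)%:E * F x))).
  apply: mixed_norm_mono => // x; first exact: poweR_ge0.
  rewrite /F LnormE; last by move=> t; exact: rho0.
  rewrite -(poweR_EFin C2) -poweRM ?lee_fin ?(ltW C20)//; last first.
    by apply: integral_ge0 => t _; exact: poweR_ge0.
  apply: lee_poweR; first by rewrite invr_ge0 ltW.
    by apply: integral_ge0 => t _; exact: poweR_ge0.
  have := HC2 _ (Ap_cst1 q1) (fun z : RR * T => f ([tuple of z.1 :: x], z.2)) (fun z => f0 _).
  have mul1 (h : RR -> \bar R) : \int[mu]_t (h t * 1%:E) = \int[mu]_t h t.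
    by apply: eq_integral => t _; rewrite mule1.
  rewrite (mul1 (fun t => _ `^ q)) (mul1 (fun t => rho (fun w => f ([tuple of t :: x], w)) `^ q)).
  apply; apply: (measurableT_comp mf); apply: measurable_fun_pair => //.
  by apply: measurable_cons_tuple => //; exact: measurable_cst.
apply: mixed_normZ_le => //; [exact: powR_ge0|move=> x; exact: Lnorm_ge0|].
by apply: (measurable_Lnorm_cons q (f := fun x => rho (fun w => f (x, w)))) => // x; exact: rho0.
Qed.

Lemma measurable_uncurry_nat d (T : measurableType d) (f : nat -> T -> \bar R) :
  (forall j, measurable_fun setT (f j)) ->
  measurable_fun setT (fun z : T * (unit * nat) => f z.2.2 z.1).
Proof.
move=> mf _ B mB; rewrite setTI.
have -> : (fun z : T * (unit * nat) => f z.2.2 z.1) @^-1` B =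
    \bigcup_j ((f j @^-1` B) `*` (setT `*` [set j])).
  apply/seteqP; split => [[x [u j]] /= fB|[x [u j]] [k _ [/= fB [_ /= ->]]]]//.
  by exists j.
apply: bigcupT_measurable => j; apply: measurableX; last exact: measurableX.
by rewrite -[X in measurable X]setTI; exact: mf.
Qed.

Lemma lv_normE (T : Type) (v : R) (g : nat -> T -> \bar R) (x : T) :
  (forall j, 0 <= g j x) ->
  lv_norm v g x = Lp_norm (@counting nat R) v (fun h : unit -> \bar R => h tt)
    (fun w => g w.2 x).
Proof.
move=> g0; rewrite /lv_norm /Lp_norm; congr (_ `^ _).
rewrite ge0_integral_count; last by move=> j; exact: poweR_ge0.
by apply: eq_eseriesr => j _; rewrite gee0_abs.
Qed.

Lemma lv_norm_ge0 (T : Type) (v : R) (g : nat -> T -> \bar R) (x : T) : 0 <= lv_norm v g x.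
Proof. exact: poweR_ge0. Qed.

(** The l^v norm is the L^v norm for the counting measure, so it is maximal-regular
    by maximal_regular_Lp. *)
Theorem strong_max_vector_valued n (p : n.-tuple R) (v : R) : exponents_gt1 p -> (1 < v)%R ->
  exists2 C : R, (0 < C)%R & forall f : nat -> Rn R n -> \bar R,
    (forall j x, 0 <= f j x) -> (forall j, measurable_fun setT (f j)) ->
    mixed_norm p (lv_norm v (fun j => strong_max (f j))) <= C%:E * mixed_norm p (lv_norm v f).
Proof.
move=> p1 v1.
have reg := @maximal_regular_Lp R _ _ unit nat (@counting nat R) v _ v1 (@maximal_regular_unit R).
have [C C0 HC] := strong_max_mixed_norm p1 reg; exists C => // f f0 mf.
have := HC (fun z => f z.2.2 z.1) (fun z => f0 _ _) (measurable_uncurry_nat mf).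
congr (_ <= _ * _); apply: eq_mixed_norm => x; rewrite lv_normE// => j.
exact: strong_max_ge0.
Qed.

End strong_maximal.

(** * Cubes, balls and boxes *)

Section lebesgueRn_cubes.
Context {R : realType}.
Local Notation RR := (measurableTypeR R).
Local Notation mu := (@lebesgue_measure R).

Lemma integral_lebesgueRn_cons n (F : Rn R n.+1 -> \bar R) :
  (forall x, 0 <= F x) -> measurable_fun setT F ->
  \int[lebesgueRn n.+1]_x F x = \int[lebesgueRn n]_y \int[mu]_t F [tuple of t :: y].
Proof.
move=> F0 mF.
have mFc : measurable_fun setT (fun z : RR * Rn R n => F (consRn z)).
  exact: (measurableT_comp mF (@measurable_consRn R n)).
transitivity (\int[mu \x lebesgueRn n]_z F (consRn z)).
  have E := @ge0_integral_pushforward _ _ _ _ R _ (@measurable_consRn R n)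
    (mu \x lebesgueRn n) setT F measurableT mF (fun y _ => F0 y).
  rewrite preimage_setT in E; rewrite -[RHS]E.
  by apply: eq_measure_integral => A mA _.
by rewrite (fubini_tonelli2 (fun z : RR * Rn R n => F (consRn z))).
Qed.

Definition cube n (y : Rn R n) (h : R) : set (Rn R n) :=
  [set x | forall i, `|tnth x i - tnth y i| < h]%R.

Lemma cube_cons n (s : RR) (y : Rn R n) h (t : RR) (x : Rn R n) :
  cube [tuple of s :: y] h [tuple of t :: x] <-> (`|t - s| < h)%R /\ cube y h x.
Proof.
split=> [yx|[t0 yx] i].
  split; first by have := yx ord0; rewrite !tnth0.
  by move=> i; have := yx (lift ord0 i); rewrite !tnthS.
by case: (unliftP ord0 i) => [j ->|->]; [rewrite !tnthS|rewrite !tnth0].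
Qed.

Lemma cubeS n (y : Rn R n.+1) h (x : Rn R n.+1) : cube y h x <->
  (`|thead x - thead y| < h)%R /\ cube [tuple of behead y] h [tuple of behead x].
Proof.
by have := @cube_cons _ (thead y) [tuple of behead y] h (thead x) [tuple of behead x];
  rewrite !cons_thead_behead.
Qed.

Lemma measurable_tnthR n (i : 'I_n) : measurable_fun setT (fun x : Rn R n => tnth x i : RR).
Proof. exact: measurable_tnth. Qed.

Lemma measurable_cube n (y : Rn R n) h : measurable (cube y h).
Proof.
elim: n y => [|n IH] y.
  by rewrite (_ : cube y h = setT)//; apply/seteqP; split => // x _ [].
have -> : cube y h = ((fun x : Rn R n.+1 => thead x : RR) @^-1` ball (thead y : R) h) `&`
    ((fun x : Rn R n.+1 => [tuple of behead x] : Rn R n) @^-1` cube [tuple of behead y] h).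
  apply/seteqP; split => x.
    by move=> /cubeS[xy byx]; split => //=; rewrite /ball/= distrC.
  by move=> [xy byx]; apply/cubeS; split => //; move: xy; rewrite /ball/= distrC.
apply: measurableI; rewrite -[X in measurable X]setTI.
  by apply: (@measurable_thead R n) => //; exact: measurable_ball.
by apply: (@measurable_behead _ RR n).
Qed.

Lemma lebesgueRn_cube n (y : Rn R n) h : (0 < h)%R ->
  lebesgueRn n (cube y h) = ((2 * h) ^+ n)%:E.
Proof.
move=> h0; elim: n y => [|n IH] y.
  rewrite expr0 /= (_ : cube y h = setT); first by rewrite diracT.
  by apply/seteqP; split => // x _ [].
rewrite -(cons_thead_behead y) /=.
rewrite /pushforward [X in (_ \x _) X](_ : _ =
    ball (thead y : R) h `*` cube [tuple of behead y] h); last first.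
  apply/seteqP; split => -[t x] /=.
    by move=> /cube_cons[t0 yx]; split => //; rewrite /ball/= distrC.
  by move=> [t0 yx]; apply/cube_cons; split => //; move: t0; rewrite /ball/= distrC.
rewrite product_measure1E; [|exact: measurable_ball|exact: measurable_cube].
have B : mu (ball (thead y : R) h) = (h *+ 2)%:E by exact: (lebesgue_measure_ball _ (ltW h0)).
by rewrite [X in X * _]B [X in _ * X]IH -EFinM exprS !mulr_natl.
Qed.

Lemma coord_le_eucl_dist n (x y : Rn R n) i :
  (`|tnth x i - tnth y i| <= eucl_dist x y)%R.
Proof.
rewrite /eucl_dist -sqrtr_sqr; apply: ler_wsqrtr.
by rewrite (bigD1 i)//= lerDl sumr_ge0// => j _; rewrite sqr_ge0.
Qed.

Lemma eball_sub_cube n (y : Rn R n) r : eball y r `<=` cube y r.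
Proof. by move=> x yx i; exact: le_lt_trans (coord_le_eucl_dist x y i) yx. Qed.

Lemma cube_sub_eball n (y : Rn R n) h : (0 < n)%N -> (0 < h)%R ->
  cube y h `<=` eball y (n%:R * h).
Proof.
move=> n0 h0 x yx; rewrite /eball/= /eucl_dist.
have nh0 : (0 <= n%:R * h)%R by rewrite mulr_ge0// ltW.
rewrite -(ger0_norm nh0) -sqrtr_sqr ltr_sqrt; last first.
  by rewrite exprn_gt0// mulr_gt0// ltr0n.
apply: (@lt_le_trans _ _ (\sum_(i < n) h ^+ 2)%R).
  apply: ltr_sum => [|i _].
    by apply/hasP; exists (Ordinal n0) => //; rewrite mem_index_enum.
  by rewrite -[ltLHS]real_normK ?num_real// ltr_pXn2r// ?nnegrE ?(ltW h0)//; exact: yx.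
rewrite sumr_const card_ord -[leLHS]mulr_natl exprMn.
apply: ler_wpM2r; first exact: sqr_ge0.
by rewrite -natrX ler_nat -{1}(expn1 n) leq_pexp2l.
Qed.

Lemma measurable_eucl_dist n (y : Rn R n) : measurable_fun setT (fun x : Rn R n => eucl_dist x y).
Proof.
apply: (measurableT_comp (f := @Num.sqrt R)).
  by apply: continuous_measurable_fun; exact: sqrt_continuous.
apply: (@measurable_sum _ _ _ setT _ (index_enum 'I_n)
  (fun (i : 'I_n) (x : Rn R n) => ((tnth x i - tnth y i) ^+ 2 : R)%R)) => i; apply: measurable_funX.
by apply: measurable_funB => //; exact: measurable_tnthR.
Qed.

Lemma measurable_eball n (y : Rn R n) r : measurable (eball y r).
Proof.
rewrite (_ : eball y r = setT `&` (fun x => eucl_dist x y) @^-1` `]-oo, r[%classic).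
  by apply: (measurable_eucl_dist y) => //; exact: measurable_itv.
by rewrite setTI; apply/seteqP; split => x; rewrite /= in_itv.
Qed.

Lemma lebesgueRn_eball_ge n (y : Rn R n) r : (0 < n)%N -> (0 < r)%R ->
  ((2 * (r / n%:R)) ^+ n)%:E <= lebesgueRn n (eball y r).
Proof.
move=> n0 r0; have nR : (0 < n%:R :> R)%R by rewrite ltr0n.
rewrite -(lebesgueRn_cube y (divr_gt0 r0 nR)); apply: le_measure; rewrite ?inE.
- exact: measurable_cube.
- exact: measurable_eball.
- have nR0 : n%:R != 0%R :> R by rewrite gt_eqF.
  have := @cube_sub_eball n y _ n0 (divr_gt0 r0 nR).
  by rewrite (_ : n%:R * (r / n%:R) = r)%R// mulrC divfK.
Qed.

(** For boxes with rational sides the iterated maximal operator, whose suprema run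
    over rational intervals, controls the averages directly. *)
Fixpoint rat_box n : n.-tuple nat -> set (Rn R n) :=
  match n with
  | 0 => fun _ => setT
  | m.+1 => fun ks => [set x | oitv (rat_itv (thead ks)) (thead x) /\
                               rat_box [tuple of behead ks] [tuple of behead x]]
  end.

Fixpoint rat_box_vol n : n.-tuple nat -> R :=
  match n with
  | 0 => fun _ => 1%R
  | m.+1 => fun ks => (fine (mu (oitv (rat_itv (thead ks)))) * rat_box_vol [tuple of behead ks])%R
  end.

Lemma rat_box_vol_ge0 n (ks : n.-tuple nat) : (0 <= rat_box_vol ks)%R.
Proof. by elim: n ks => //= n IH ks; rewrite mulr_ge0// fine_ge0. Qed.

Lemma measurable_rat_box n (ks : n.-tuple nat) : measurable (rat_box ks).
Proof.
elim: n ks => [|n IH] ks; first exact: measurableT.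
apply: measurableI.
  rewrite -[X in measurable X]setTI; apply: (@measurable_thead R n) => //.
  exact: measurable_oitv.
rewrite -[X in measurable X]setTI; by apply: (@measurable_behead _ RR n).
Qed.

(** By Tonelli's theorem the average in the first coordinate can be taken first; it
    is at most the maximal function in that coordinate. *)
Lemma rat_box_average n (ks : n.-tuple nat) (f : Rn R n -> \bar R) x :
  (forall y, 0 <= f y) -> measurable_fun setT f -> rat_box ks x ->
  \int[lebesgueRn n]_y ((\1_(rat_box ks) y)%:E * f y) <= (rat_box_vol ks)%:E * strong_max f x.
Proof.
elim: n ks f x => [|n IH] ks f x f0 mf ksx.
  rewrite integral_dirac//; last first.
    apply: emeasurable_funM => //; apply/measurable_EFinP.
    by apply: measurable_indic; exact: measurable_rat_box.
  by rewrite diracT mul1e indicE mem_set//= !mul1e (tuple0 x).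
case: ksx => Jx bx; set J := oitv _ in Jx; set b := rat_box [tuple of behead ks] in bx.
rewrite integral_lebesgueRn_cons; last 2 first.
- by move=> y; rewrite mule_ge0// lee_fin.
- apply: emeasurable_funM => //; apply/measurable_EFinP.
  by apply: measurable_indic; exact: measurable_rat_box.
have mfc : measurable_fun setT (fun z : RR * Rn R n => f [tuple of z.1 :: z.2]).
  by apply: (measurableT_comp mf); exact: measurable_cons_tuple.
pose g (y : Rn R n) := maxfun mu (fun t => f [tuple of t :: y]) (thead x : RR).
have g0 y : 0 <= g y by exact: maxfun_ge0.
have mg : measurable_fun setT g.
  have := measurable_maxfun_param (fun z : RR * Rn R n => f0 [tuple of z.1 :: z.2]) mfc.
  by move=> /measurableT_comp /(_ (pair1_measurable (thead x : RR))).
have mJ : measurable J by exact: measurable_oitv.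
have Jfin : mu J \is a fin_num by rewrite ge0_fin_numE//; exact: lebesgue_oitv_fin.
rewrite /= EFinM -muleA.
apply: (@le_trans _ _ (\int[lebesgueRn n]_y ((fine (mu J))%:E * ((\1_b y)%:E * g y)))).
  apply: ge0_le_integralW => y _.
    by apply: integral_ge0 => t _; rewrite mule_ge0// lee_fin.
  have -> : \int[mu]_t ((\1_(rat_box ks) [tuple of t :: y])%:E * f [tuple of t :: y]) =
      (\1_b y)%:E * \int[mu]_(t in J) f [tuple of t :: y].
    rewrite [in RHS]integral_mkcond -ge0_integralZl_EFin//; last 2 first.
    - by move=> t _; rewrite patchE; case: ifPn.
    - apply/(measurable_restrictT _ _).1 => //; apply: measurable_funTS.
      exact: (measurableT_comp mfc (pair2_measurable y)).
    apply: eq_integral => t _; rewrite patchE !indicE.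
    have -> : ([tuple of t :: y] \in rat_box ks) = (t \in J) && (y \in b).
      apply/idP/andP => [/set_mem[/= Jt byy]|[/set_mem Jt /set_mem byy]].
        by rewrite theadE behead_cons in Jt byy; split; exact: mem_set.
      by apply: mem_set => /=; rewrite theadE behead_cons.
    by case: (t \in J); case: (y \in b); rewrite /= ?mul1e ?mul0e ?mule0.
  rewrite muleCA lee_wpmul2l ?lee_fin// fineK//.
  have [J0|J0] := eqVneq (mu J) 0.
    rewrite null_set_integral// ?J0 ?mul0e//; apply: measurable_funTS.
    exact: (measurableT_comp mfc (pair2_measurable y)).
  apply: (@le_trans _ _ (mu J * avg mu (fun t => f [tuple of t :: y]) (rat_itv (thead ks)))).
    by rewrite /avg -/J muleC -muleA [_^-1 * _]muleC divee ?mule1.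
  by apply: lee_wpmul2l => //; apply: avg_le_maxfun; rewrite -oitvE.
rewrite ge0_integralZl_EFin ?fine_ge0//; last 2 first.
- by move=> y _; rewrite mule_ge0// lee_fin.
- apply: emeasurable_funM => //; apply/measurable_EFinP.
  by apply: measurable_indic; exact: measurable_rat_box.
by rewrite lee_wpmul2l ?lee_fin ?fine_ge0//; exact: IH.
Qed.

Lemma rat_itv_between (a b : R) (e : R) : (a < b)%R -> (0 < e)%R -> exists k,
  [/\ (forall t, (a < t < b)%R -> oitv (rat_itv k) t) &
   (fine (mu (oitv (rat_itv k))) <= b - a + 2 * e)%R].
Proof.
move=> ab e0.
have [u /= ] := @rat_in_itvoo R (a - e) a (ltac:(by rewrite ltrBlDr ltrDl)).
rewrite in_itv/= => /andP[u1 u2].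
have [v /=] := @rat_in_itvoo R b (b + e) (ltac:(by rewrite ltrDl)).
rewrite in_itv/= => /andP[v1 v2].
exists (pickle (u, v)); have E : rat_itv (pickle (u, v)) = (ratr u, ratr v) :> R * R.
  by rewrite /rat_itv pickleK.
rewrite E; split => [t /andP[at_ tb]|].
  by rewrite oitvE /inoitv/= (lt_trans u2 at_) (lt_trans tb v1).
by rewrite lebesgue_oitv/=; case: ifPn => _ /=; lra.
Qed.

Lemma cube_sub_rat_box n (y : Rn R n) h : (0 < h)%R -> exists ks : n.-tuple nat,
  cube y h `<=` rat_box ks /\ (rat_box_vol ks <= (4 * h) ^+ n)%R.
Proof.
move=> h0; elim: n y => [|n IH] y; first by exists [tuple]; split => //=; rewrite expr0.
have [ks [ysub yvol]] := IH [tuple of behead y].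
have [k [kin kvol]] := @rat_itv_between (thead y - h) (thead y + h) h (ltac:(lra)) h0.
exists [tuple of k :: ks]; split.
  move=> x /cubeS[xy byx].
  rewrite /=; rewrite theadE behead_cons; split; last exact: ysub.
  by apply: kin; rewrite -ltr_distlC distrC.
rewrite /= theadE behead_cons exprS ler_pM ?fine_ge0 ?rat_box_vol_ge0//.
by rewrite (le_trans kvol)//; lra.
Qed.

(** A ball is contained in a rational box of comparable volume. *)
Lemma integral_eball_le_strong_max n (y x : Rn R n) r (f : Rn R n -> \bar R) :
  (0 < r)%R -> (forall z, 0 <= f z) -> measurable_fun setT f -> eball y r x ->
  \int[lebesgueRn n]_(z in eball y r) f z <= ((4 * r) ^+ n)%:E * strong_max f x.
Proof.
move=> r0 f0 mf yx; have [ks [ysub yvol]] := cube_sub_rat_box y r0.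
have ksx : rat_box ks x by apply: ysub; exact: eball_sub_cube.
apply: (le_trans _ (lee_wpmul2r (strong_max_ge0 x f0) (_ : (rat_box_vol ks)%:E <= _))); last first.
  by rewrite lee_fin.
apply: (le_trans _ (rat_box_average f0 mf ksx)).
rewrite integral_mkcond; apply: ge0_le_integralW => z _.
  by rewrite patchE; case: ifPn.
rewrite patchE; case: ifPn => [/set_mem yz|_]; last by rewrite mule_ge0// lee_fin.
by rewrite indicE mem_set ?mul1e//; apply: ysub; exact: eball_sub_cube.
Qed.

End lebesgueRn_cubes.

(** * Local and far parts of the maximal operator *)

Section maximal_local_far.
Context {R : realType}.
Local Notation RR := (measurableTypeR R).
Local Notation mu := (@lebesgue_measure R).

(** The volume of the ball is replaced by the comparable quantity rho^n. *)
Definition ball_avg n (h : Rn R n -> \bar R) (rho : R) : \bar R :=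
  ((rho ^+ n)^-1)%:E * \int[lebesgueRn n]_(y in @Q0 R n rho) h y.

Lemma ball_avg_ge0 n (h : Rn R n -> \bar R) rho : (0 < rho)%R -> (forall x, 0 <= h x) ->
  0 <= ball_avg h rho.
Proof.
move=> r0 h0; rewrite mule_ge0 ?integral_ge0//.
by rewrite lee_fin invr_ge0 exprn_ge0// ltW.
Qed.

Lemma measurable_patch_eball n (h : Rn R n -> \bar R) y rho : measurable_fun setT h ->
  measurable_fun setT (h \_ (eball y rho)).
Proof.
move=> mh; apply/(measurable_restrictT _ _).1; first exact: measurable_eball.
exact: measurable_funTS.
Qed.

Lemma patch_ge0 (T : Type) (h : T -> \bar R) (A : set T) : (forall x, 0 <= h x) ->
  forall x, 0 <= (h \_ A) x.
Proof. by move=> h0 x; rewrite patchE; case: ifPn. Qed.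

Lemma ball_avg_le_strong_max n (h : Rn R n -> \bar R) rho x : (0 < rho)%R ->
  (forall x, 0 <= h x) -> measurable_fun setT h -> Q0 rho x ->
  ball_avg h rho <= (4 ^+ n)%:E * strong_max (h \_ (@Q0 R n rho)) x.
Proof.
move=> r0 h0 mh Qx; rewrite /ball_avg lee_pdivrMl ?exprn_gt0// muleA -EFinM -exprMn mulrC.
have := integral_eball_le_strong_max r0 (patch_ge0 _ h0) (measurable_patch_eball [tuple of nseq n 0%R] rho mh) Qx.
by rewrite -integral_mkcondr setIid.
Qed.

Lemma eball_sub_Q0 n (c x : Rn R n) (rho r s : R) : (0 < n)%N -> (0 < rho)%R -> (0 < r)%R ->
  eball c rho x -> Q0 r x -> (n%:R * (2 * rho + r) <= s)%R -> eball c rho `<=` Q0 s.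
Proof.
move=> n0 rho0 r0 cx Qx le_s y cy.
have h0 : (0 < 2 * rho + r)%R by rewrite addr_gt0// mulr_gt0.
suff /(cube_sub_eball n0 h0) : cube ([tuple of nseq n 0%R] : Rn R n) (2 * rho + r) y.
  by move=> Qy; exact: (lt_le_trans Qy).
move=> i; have := eball_sub_cube Qx i; have := eball_sub_cube cx i.
have := eball_sub_cube cy i; rewrite !(tnth_nth 0%R) /= nth_nseq ltn_ord !subr0.
move: (_`_i)%R (_`_i)%R (_`_i)%R => a b d; rewrite !ltr_norml; lra.
Qed.

(** For a ball of radius rho through x, take the least k such that the inclusion
    criterion of eball_sub_Q0 places it in Q0 (2^k s). If k = 0, then h may be
    restricted to Q0 s. If k > 0, minimality forces 2^k s to be at most a multiple
    of rho, and the average over the ball is at most a multiple of that over Q0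
    (2^k s). *)
Lemma maximal_op_le_local_far n (h : Rn R n -> \bar R) (s v : R) x : (0 < n)%N ->
  (0 < s)%R -> (0 < v)%R -> (forall x, 0 <= h x) -> measurable_fun setT h ->
  Q0 (s / (2 * n%:R)) x ->
  maximal_op h x <= ((4 * n%:R ^+ 2) ^+ n)%:E *
    (strong_max (h \_ (@Q0 R n s)) x +
     (\sum_(0 <= k <oo) ball_avg h (2 ^+ k * s) `^ v) `^ v^-1).
Proof.
move=> n0 s0 v0 h0 mh Qx; set r := (s / (2 * n%:R))%R in Qx.
have nR : (0 < n%:R :> R)%R by rewrite ltr0n.
have n1 : (1 <= n%:R :> R)%R by rewrite ler1n.
have r0 : (0 < r)%R by rewrite divr_gt0// mulr_gt0.
have sE : (s = 2 * n%:R * r)%R by rewrite /r mulrC divfK// mulf_neq0// gt_eqF.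
set F := (X in _ + X); set S := strong_max _ x.
have S0 : 0 <= S by apply: strong_max_ge0; exact: patch_ge0.
have F0 : 0 <= F by exact: poweR_ge0.
have sk0 k : (0 < 2 ^+ k * s)%R by rewrite mulr_gt0// exprn_gt0.
have avgF k : ball_avg h (2 ^+ k * s) <= F.
  rewrite -[leLHS](@poweRVK _ _ v) ?gt_eqF ?ball_avg_ge0//.
  apply: lee_poweR; rewrite ?invr_ge0 ?(ltW v0) ?poweR_ge0//.
  by apply: (@nneseries_ge_term _ (fun k => ball_avg h (2 ^+ k * s) `^ v)) => j; exact: poweR_ge0.
apply: ub_ereal_sup => _ [[c rho] /= [rho0 cx] <-].
rewrite (eq_integral h); last by move=> y _; rewrite gee0_abs.
have m_ge := lebesgueRn_eball_ge c n0 rho0; set m := lebesgueRn n (eball c rho) in m_ge *.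
have m0 : (0 < (2 * (rho / n%:R)) ^+ n)%R by rewrite exprn_gt0// mulr_gt0// divr_gt0.
have m_ge0 : 0 <= m by exact: measure_ge0.
have minv : m^-1 <= ((2 * (rho / n%:R)) ^+ n)^-1%:E.
  have -> : ((2 * (rho / n%:R)) ^+ n)^-1%:E = ((2 * (rho / n%:R)) ^+ n)%:E^-1.
    by rewrite inver gt_eqF.
  have a_ge0 : (0 <= (2 * (rho / n%:R)) ^+ n)%R by exact: ltW.
  by rewrite (@lee_pV2 R m _%:E) ?inE ?lee_fin.
have int0 A : 0 <= \int[lebesgueRn n]_(y in A) h y by exact: integral_ge0.
have m1 : (((2 * (rho / n%:R)) ^+ n)^-1 = (n%:R / (2 * rho)) ^+ n)%R.
  by rewrite -exprVn; congr (_ ^+ _)%R; field; rewrite !gt_eqF.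
(* After division by the volume of the ball, which is at least (2 rho / n)^n, a
    bound of the integral by a^n X with a <= 8 n rho suffices. *)
have reduce (a : R) (X : \bar R) : (0 <= a)%R -> (a * n%:R <= 4 * n%:R ^+ 2 * (2 * rho))%R -> 0 <= X ->
    X <= S + F -> \int[lebesgueRn n]_(y in eball c rho) h y <= (a ^+ n)%:E * X ->
    (\int[lebesgueRn n]_(y in eball c rho) h y) / m <= ((4 * n%:R ^+ 2) ^+ n)%:E * (S + F).
  move=> a0 a_le X0 XSF le_int.
  apply: (@le_trans _ _ ((a ^+ n)%:E * X * ((n%:R / (2 * rho)) ^+ n)%:E)).
    by apply: lee_pmul; rewrite ?inve_ge0// -m1.
  rewrite muleAC -EFinM -exprMn; apply: lee_pmul => //.
    by rewrite lee_fin exprn_ge0// mulr_ge0// divr_ge0// mulr_ge0// ltW.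
  rewrite lee_fin lerXn2r ?nnegrE//.
  - by rewrite mulr_ge0// divr_ge0// mulr_ge0// ltW.
  - by rewrite mulrA ler_pdivrMr// mulr_gt0.
have k_ex : exists k, (n%:R * (2 * rho + r) <= 2 ^+ k * s)%R.
  exists (Num.bound (n%:R * (2 * rho + r) / s)).
  rewrite -ler_pdivrMr//; apply: ltW.
  apply: (lt_trans (archi_boundP _)).
    by rewrite divr_ge0 ?(ltW s0)// mulr_ge0// addr_ge0 ?(ltW r0)// mulr_ge0// ltW.
  by rewrite -natrX ltr_nat ltn_expl.
case: (ex_minnP k_ex) => -[|k] hk kmin.
  rewrite expr0 mul1r in hk.
  apply: (reduce (4 * rho)%R S) => //.
  - by rewrite mulr_ge0// ltW.
  - have : (0 <= (rho * n%:R) * (n%:R - 1))%R by rewrite mulr_ge0 ?subr_ge0// mulr_ge0// ltW.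
    have : (0 <= rho * n%:R)%R by rewrite mulr_ge0// ltW.
    lra.
  - by rewrite leeDl.
  - rewrite (eq_integral (h \_ (@Q0 R n s))); last first.
      by move=> y /set_mem cy; rewrite patchE mem_set//; exact: (eball_sub_Q0 n0 rho0 r0 cx Qx hk).
    by apply: integral_eball_le_strong_max => //; [exact: patch_ge0|exact: measurable_patch_eball].
have k_lt : (2 ^+ k * s < n%:R * (2 * rho + r))%R.
  by rewrite ltNge; apply/negP => /kmin; rewrite ltnn.
have k1 : (s <= 2 ^+ k * s)%R by rewrite ler_peMl ?(ltW s0)// exprn_ege1// ler1n.
apply: (reduce (2 ^+ k.+1 * s)%R (ball_avg h (2 ^+ k.+1 * s))) => //.
- exact: ltW.
- have A_lt : (2 ^+ k * s <= 4 * n%:R * rho)%R by lra.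
  rewrite exprS -(mulrA 2%R); have := ler_wpM2r (ltW nR) A_lt; lra.
- by rewrite ball_avg_ge0.
- by rewrite (le_trans (avgF k.+1))// leeDr.
- rewrite /ball_avg muleA -EFinM divff ?mul1e ?gt_eqF ?exprn_gt0//.
  apply: ge0_subset_integral => //; [exact: measurable_eball|exact: measurable_eball| | ].
    exact: measurable_funTS.
  exact: (eball_sub_Q0 n0 rho0 r0 cx Qx hk).
Qed.

End maximal_local_far.

(** * Norms of indicators and of sequences *)

Section norm_of_balls.
Context {R : realType}.
Local Notation RR := (measurableTypeR R).
Local Notation mu := (@lebesgue_measure R).

Lemma mixed_normZ n (p : n.-tuple R) (c : R) (f : Rn R n -> \bar R) : exponents_gt1 p ->
  (0 < c)%R -> (forall x, 0 <= f x) -> measurable_fun setT f ->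
  mixed_norm p (fun x => c%:E * f x) = c%:E * mixed_norm p f.
Proof.
move=> p1 c0 f0 mf; apply/eqP; rewrite eq_le mixed_normZ_le//=; last exact: ltW.
rewrite -lee_pdivlMl//; apply: le_trans (mixed_normZ_le p1 (c := c^-1%R) _ _ _).
- rewrite (@eq_mixed_norm _ _ _ f (fun x => c^-1%:E * (c%:E * f x)))// => x.
  by rewrite muleA -EFinM mulVf ?gt_eqF// mul1e.
- by rewrite invr_ge0 ltW.
- by move=> x; rewrite mule_ge0// lee_fin ltW.
- by apply: emeasurable_funM.
Qed.

(** This is where the exponent sum 1/p_i comes from. *)
Lemma mixed_norm_cube n (p : n.-tuple R) (y : Rn R n) (h : R) : exponents_gt1 p -> (0 < h)%R ->
  mixed_norm p (fun x => (\1_(cube y h) x)%:E) =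
  ((2 * h) `^ (\sum_(i < n) (tnth p i)^-1))%:E.
Proof.
move=> p1 h0; elim: n p y p1 => [|n IH] p y p1 /=.
  by rewrite big_ord0 powRr0 indicE mem_set ?normr1// => -[].
have q1 := exponents_thead p1; have q0 := lt_trans ltr01 q1.
have h2 : (0 < (2 * h) `^ (thead p)^-1)%R by rewrite powR_gt0// mulr_gt0.
rewrite -(cons_thead_behead y); set b := [tuple of behead y]; set s := thead y.
rewrite (@eq_mixed_norm _ _ _ _
    (fun x => ((2 * h) `^ (thead p)^-1)%:E * (\1_(cube b h) x)%:E)); last first.
  move=> x; rewrite LnormE; last by move=> t; rewrite lee_fin.
  rewrite (eq_integral (fun t : RR => (\1_(ball (s : R) h) t)%:E * (\1_(cube b h) x)%:E)).
    rewrite ge0_integralZr//; last first.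
      by apply/measurable_EFinP; apply: measurable_indic; exact: measurable_ball.
    rewrite integral_indic ?setIT//; last exact: measurable_ball.
    rewrite poweRM//.
    have B : mu (ball (s : R) h) = (h *+ 2)%:E by exact: (lebesgue_measure_ball _ (ltW h0)).
    rewrite [X in X `^ _ * _]B poweR_EFin -(mulr_natl h 2); congr (_ * _).
    rewrite indicE; case: (x \in _); first by rewrite poweR_EFin powR1.
    by rewrite poweR0r// invr_eq0 gt_eqF.
  move=> t _; rewrite -EFinM !indicE.
  have -> : ([tuple of t :: x] \in cube [tuple of s :: b] h) =
      (t \in (ball (s : R) h : set RR)) && (x \in cube b h).
    apply/idP/andP => [/set_mem /cube_cons[st bx]|[/set_mem st /set_mem bx]].
      by split; apply: mem_set => //; rewrite /ball/= distrC.
    by apply: mem_set; apply/cube_cons; split => //; move: st; rewrite /ball/= distrC.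
  rewrite poweR_EFin.
  by case: (t \in _); case: (x \in _); rewrite /= ?mulr1 ?mulr0 ?powR1 ?powR0 ?(gt_eqF q0).
rewrite mixed_normZ//; last 2 first.
- exact: exponents_behead.
- by apply/measurable_EFinP; apply: measurable_indic; exact: measurable_cube.
rewrite IH; last exact: exponents_behead.
rewrite -EFinM big_ord_recl -powRD; last first.
  by rewrite (gt_eqF (mulr_gt0 _ h0))// implybT.
congr (_ `^ (_ + _))%:E; apply: eq_bigr => i _; congr (_^-1)%R.
rewrite tnth_behead; congr (tnth _ _); apply/val_inj.
by rewrite /= inordK// ltnS.
Qed.

Lemma measurable_indic_Q0 n (rho : R) : measurable_fun setT (fun x : Rn R n => (\1_(Q0 rho) x)%:E : \bar R).
Proof. by apply/measurable_EFinP; apply: measurable_indic; exact: measurable_eball. Qed.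

Lemma lee_indic (T : Type) (A B : set T) x : A `<=` B -> (\1_A x)%:E <= (\1_B x)%:E :> \bar R.
Proof.
move=> AB; rewrite lee_fin !indicE; case: (boolP (x \in A)) => [/set_mem Ax|_]; last exact: ler0n.
by rewrite mem_set//; exact: AB.
Qed.

Lemma mixed_norm_Q0_le n (p : n.-tuple R) (rho : R) : exponents_gt1 p -> (0 < rho)%R ->
  mixed_norm p (fun x => (\1_(Q0 rho) x)%:E) <= ((2 * rho) `^ (\sum_(i < n) (tnth p i)^-1))%:E.
Proof.
move=> p1 r0; rewrite -(mixed_norm_cube [tuple of nseq n 0%R])//; apply: mixed_norm_mono => // x.
by apply: lee_indic; exact: eball_sub_cube.
Qed.

Lemma mixed_norm_Q0_ge n (p : n.-tuple R) (rho : R) : (0 < n)%N -> exponents_gt1 p -> (0 < rho)%R ->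
  ((2 * (rho / n%:R)) `^ (\sum_(i < n) (tnth p i)^-1))%:E <= mixed_norm p (fun x => (\1_(Q0 rho) x)%:E).
Proof.
move=> n0 p1 r0; have nR : (0 < n%:R :> R)%R by rewrite ltr0n.
have h0 := divr_gt0 r0 nR.
rewrite -(mixed_norm_cube [tuple of nseq n 0%R])//; apply: mixed_norm_mono => // x.
apply: lee_indic; have := @cube_sub_eball _ n [tuple of nseq n 0%R] _ n0 h0.
by rewrite (_ : n%:R * (rho / n%:R) = rho)%R// mulrC divfK// gt_eqF.
Qed.

Lemma lv_norm_mono (T : Type) (v : R) (f g : nat -> T -> \bar R) x : (0 < v)%R ->
  (forall j, 0 <= f j x) -> (forall j, f j x <= g j x) -> lv_norm v f x <= lv_norm v g x.
Proof.
move=> v0 f0 fg; rewrite /lv_norm; apply: lee_poweR; first by rewrite invr_ge0 ltW.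
  by apply: nneseries_ge0 => j _ _; exact: poweR_ge0.
apply: lee_nneseries => [j _ _|j _]; first exact: poweR_ge0.
have g0 := le_trans (f0 j) (fg j).
by rewrite !gee0_abs//; apply: lee_poweR => //; exact: ltW.
Qed.

Lemma lv_normZ (T : Type) (v c : R) (f : nat -> T -> \bar R) x : (0 < v)%R ->
  (0 <= c)%R -> (forall j, 0 <= f j x) ->
  lv_norm v (fun j x => c%:E * f j x) x = c%:E * lv_norm v f x.
Proof.
move=> v0 c0 f0; rewrite /lv_norm.
rewrite (eq_eseriesr (g := fun j => (c `^ v)%:E * `|f j x| `^ v)); last first.
  by move=> j _; rewrite abseM poweRM// gee0_abs// poweR_EFin.
rewrite nneseriesZl; last by move=> j _; exact: poweR_ge0.
rewrite poweRM ?lee_fin ?powR_ge0//; last by apply: nneseries_ge0 => j _ _; exact: poweR_ge0.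
by rewrite -poweR_EFin poweRVK ?gt_eqF.
Qed.

Lemma lv_norm_patch n (v : R) (A : set (Rn R n)) (f : nat -> Rn R n -> \bar R) : (0 < v)%R ->
  lv_norm v (fun j => f j \_ A) = (lv_norm v f) \_ A.
Proof.
move=> v0; apply/funext => x; rewrite /lv_norm patchE; case: ifPn => xA.
  by congr (_ `^ _); apply: eq_eseriesr => j _; rewrite patchE xA.
rewrite eseries0 => [|j _ _]; first by rewrite poweR0r// invr_eq0 gt_eqF.
by rewrite patchE (negbTE xA) abse0 poweR0r// gt_eqF.
Qed.

Lemma measurable_lv_norm d (T : measurableType d) (v : R) (f : nat -> T -> \bar R) :
  (forall j x, 0 <= f j x) -> (forall j, measurable_fun setT (f j)) ->
  measurable_fun setT (lv_norm v f).
Proof.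
move=> f0 mf; apply: measurableT_comp_poweR.
apply: ge0_emeasurable_sum => [j x _ _|j _]; first exact: poweR_ge0.
by apply: measurableT_comp_poweR; exact: measurableT_comp.
Qed.

End norm_of_balls.

(** * The estimate at a fixed radius *)

Section local_estimate.
Context {R : realType}.
Local Notation RR := (measurableTypeR R).
Local Notation mu := (@lebesgue_measure R).

Lemma maximal_op_ge0 n (f : Rn R n -> \bar R) x : 0 <= maximal_op f x.
Proof.
apply: (@le_trans _ _ ((\int[lebesgueRn n]_(y in eball x 1%R) `|f y|) / lebesgueRn n (eball x 1%R))).
  by rewrite mule_ge0 ?inve_ge0// integral_ge0.
apply: ereal_sup_ubound; exists (x, 1%R) => //=; split => //.
rewrite /eball/= /eucl_dist big1 ?sqrtr0// => i _.
by rewrite subrr expr0n.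
Qed.

Lemma lv_norm_LnormE (T : Type) (v : R) (f : nat -> T -> \bar R) x : (forall j, 0 <= f j x) ->
  lv_norm v f x = Lnorm (@counting nat R) v%:E (fun j => f j x).
Proof.
move=> f0; rewrite LnormE// ge0_integral_count; last by move=> j; exact: poweR_ge0.
by rewrite /lv_norm; congr (_ `^ _); apply: eq_eseriesr => j _; rewrite gee0_abs.
Qed.

Lemma lv_norm_quasi_triangle (T : Type) (v : R) (f g : nat -> T -> \bar R) x : (1 < v)%R ->
  (forall j, 0 <= f j x) -> (forall j, 0 <= g j x) ->
  lv_norm v (fun j x => f j x + g j x) x <= 4%:E * (lv_norm v f x + lv_norm v g x).
Proof.
move=> v1 f0 g0; rewrite !lv_norm_LnormE//; last by move=> j; rewrite adde_ge0.
exact: Lnorm_quasi_triangle.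
Qed.

(** Lets a possibly infinite quantity be treated as a scalar factor of a norm. *)
Lemma lee_approx_fin (x y : \bar R) : 0 <= y ->
  (forall c : R, (0 < c)%R -> c%:E <= x -> c%:E <= y) -> x <= y.
Proof.
move=> y0 xy; case: x xy => [r||] xy; last exact: leNye.
  by have [r0|r0] := ltP 0%R r; [exact: xy|rewrite (le_trans _ y0)// lee_fin].
case: y y0 xy => // [r r0 xy]; have := xy (r + 1)%R.
have r1 : (0 < r + 1)%R by rewrite ltr_wpDl.
by move=> /(_ r1 (leey _)); rewrite lee_fin gerDl ler10.
Qed.

(** By ball_avg_le_strong_max, the averages over Q = Q0 rho are at most a multiple
    of the iterated maximal functions of the restrictions to Q, at every point of
    Q. Hence so is the multiple of the indicator of Q by the l^v norm of the
    averages, and the norm of that indicator is known. *)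
Lemma lv_ball_avg_le n (p : n.-tuple R) (v C : R) (f : nat -> Rn R n -> \bar R) (rho : R) :
  (0 < n)%N -> exponents_gt1 p -> (1 < v)%R -> (0 < C)%R -> (0 < rho)%R ->
  (forall j x, 0 <= f j x) -> (forall j, measurable_fun setT (f j)) ->
  (forall g : nat -> Rn R n -> \bar R,
    (forall j x, 0 <= g j x) -> (forall j, measurable_fun setT (g j)) ->
    mixed_norm p (lv_norm v (fun j => strong_max (g j))) <= C%:E * mixed_norm p (lv_norm v g)) ->
  lv_norm v (fun j (_ : unit) => ball_avg (f j) rho) tt <=
  (((2 * (rho / n%:R)) `^ (\sum_(i < n) (tnth p i)^-1))^-1 * (4 ^+ n * C))%:E *
    mixed_norm p ((lv_norm v f) \_ (@Q0 R n rho)).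
Proof.
move=> n0 p1 v1 C0 r0 f0 mf HC; have v0 := lt_trans ltr01 v1.
have nR : (0 < n%:R :> R)%R by rewrite ltr0n.
set a := ((2 * _) `^ _)%R.
have a0 : (0 < a)%R by rewrite powR_gt0// mulr_gt0// divr_gt0.
apply: lee_approx_fin.
  by rewrite mule_ge0 ?mixed_norm_ge0// lee_fin mulr_ge0// ?invr_ge0 ?mulr_ge0 ?exprn_ge0// ltW.
move=> c c0 cB; rewrite EFinM -muleA lee_pdivlMl// muleC.
pose g j := f j \_ (@Q0 R n rho).
have g0 j x : 0 <= g j x by exact: patch_ge0.
have mg j : measurable_fun setT (g j) by exact: measurable_patch_eball.
apply: (@le_trans _ _ (c%:E * mixed_norm p (fun x => (\1_(Q0 rho) x)%:E))).
  by apply: lee_wpmul2l; [rewrite lee_fin ltW|exact: mixed_norm_Q0_ge].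
rewrite -mixed_normZ//; last exact: measurable_indic_Q0.
apply: (@le_trans _ _ (mixed_norm p (fun x => (4 ^+ n)%:E * lv_norm v (fun j => strong_max (g j)) x))).
  apply: mixed_norm_mono => // [x|x].
    by rewrite mule_ge0// lee_fin// ltW.
  rewrite indicE; case: (boolP (x \in _)) => [/set_mem Qx|_]; last first.
    by rewrite mule0 mule_ge0 ?lv_norm_ge0// lee_fin exprn_ge0.
  rewrite mule1 (le_trans cB)// -lv_normZ//; last by move=> j; exact: strong_max_ge0.
  have := @lv_norm_mono _ unit v (fun j _ => ball_avg (f j) rho)
    (fun j _ => (4 ^+ n)%:E * strong_max (g j) x) tt v0.
  apply => j; first exact: ball_avg_ge0.
  exact: ball_avg_le_strong_max.
rewrite mixed_normZ ?exprn_gt0//; last 2 first.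
- by move=> x; exact: lv_norm_ge0.
- by apply: measurable_lv_norm => j *; [exact: strong_max_ge0|exact: measurable_strong_max].
rewrite EFinM -muleA; apply: lee_wpmul2l; first by rewrite lee_fin exprn_ge0.
by rewrite (le_trans (HC g g0 mg))// lv_norm_patch.
Qed.

(** Let F be the l^v norm of the f_j, N(r) = r^(-lam) ||F||_(Q0 r) and sigma = sum
    1/p_i. The local part is bounded by the norm of F on Q0 s, that is by the term
    k = 0. By lv_ball_avg_le the averages over Q0 (2^k s) have an l^v norm of at
    most a multiple of (2^k s)^(-sigma) ||F||_(Q0 (2^k s)) = (2^k s)^(lam - sigma)
    N(2^k s), and the indicator of the small ball has norm at most s^sigma. With
    theta = 2^(-(sigma - lam) / 2) the factor 2^(-k (sigma - lam)) equals theta^(2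
    k): one theta^k is spent on bounding N(2^k s) by Z, the other one on summing
    over k. *)
Lemma local_estimate n (p : n.-tuple R) (v lam : R) : (0 < n)%N -> exponents_gt1 p ->
  (1 < v)%R -> (0 <= lam)%R -> (lam < \sum_(i < n) (tnth p i)^-1)%R ->
  exists theta C : R, [/\ (0 < theta)%R, (theta < 1)%R, (0 < C)%R &
  forall f : nat -> Rn R n -> \bar R,
    (forall j x, 0 <= f j x) -> (forall j, measurable_fun setT (f j)) ->
    forall (s : R) (Z : \bar R), (0 < s)%R -> 0 <= Z ->
    (forall k, (theta ^+ k)%:E * (((2 ^+ k * s) `^ (- lam))%:E *
       mixed_norm p ((lv_norm v f) \_ (@Q0 R n (2 ^+ k * s)))) <= Z) ->
    ((s / (2 * n%:R)) `^ (- lam))%:E *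
      mixed_norm p ((lv_norm v (fun j => maximal_op (f j))) \_ (@Q0 R n (s / (2 * n%:R)))) <=
    C%:E * Z].
Proof.
move=> n0 p1 v1 lam0 lam_lt; have v0 := lt_trans ltr01 v1.
have nR : (0 < n%:R :> R)%R by rewrite ltr0n.
set sigma := (\sum_(i < n) _)%R in lam_lt *.
have d0 : (0 < sigma - lam)%R by rewrite subr_gt0.
have [C0 C00 HC0] := strong_max_vector_valued p1 v1.
pose theta := (2 `^ (- ((sigma - lam) / 2)) : R)%R.
have th0 : (0 < theta)%R by rewrite powR_gt0.
have th1 : (theta < 1)%R.
  rewrite /theta powRN invf_lt1 ?powR_gt0// [ltLHS](_ : _ = (1 `^ ((sigma - lam) / 2)))%R; last by rewrite powR1.
  by apply: gt0_ltr_powR; rewrite ?nnegrE ?divr_gt0// ltr1n.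
have thv1 : (theta `^ v < 1)%R.
  rewrite [ltRHS](_ : _ = (1 `^ v))%R; last by rewrite powR1.
  by rewrite gt0_ltr_powR ?nnegrE// ltW.
have thE k : ((theta ^+ k)^-1 * (2 ^+ k) `^ (- (sigma - lam)) = theta ^+ k)%R.
  apply: (mulfI (lt0r_neq0 (exprn_gt0 k th0))); rewrite mulrA divff ?mul1r ?gt_eqF ?exprn_gt0//.
  rewrite -exprMn -powRD; last by rewrite pnatr_eq0 implybT.
  rewrite -powR_mulrn// -powRrM mulrC powRrM powR_mulrn ?powR_ge0//.
  by congr ((_ `^ _) ^+ _)%R; field.
pose K := ((4 * n%:R ^+ 2) ^+ n : R)%R.
have K0 : (0 < K)%R by rewrite exprn_gt0// mulr_gt0// exprn_gt0.
pose K1 := (((2 / n%:R) `^ sigma)^-1 * (4 ^+ n * C0))%R.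
have K10 : (0 < K1)%R by rewrite mulr_gt0// ?invr_gt0 ?powR_gt0 ?divr_gt0// mulr_gt0// exprn_gt0.
pose G := (((1 - theta `^ v)^-1) `^ v^-1)%R.
have G0 : (0 < G)%R by rewrite powR_gt0// invr_gt0 subr_gt0.
pose C := (4 * K * 4 ^+ n * (2 * n%:R) `^ lam * (C0 + K1 * G))%R.
have CC0 : (0 < C)%R.
  have n2 : (0 < (2 * n%:R) `^ lam)%R by rewrite powR_gt0// mulr_gt0.
  have CG : (0 < C0 + K1 * G)%R by rewrite addr_gt0// mulr_gt0.
  by rewrite /C mulr_gt0// mulr_gt0// mulr_gt0 ?exprn_gt0// mulr_gt0.
exists theta, C; split => // f f0 mf s Z s0 Z0 hZ.
set r := (s / (2 * n%:R))%R.
have r0 : (0 < r)%R by rewrite divr_gt0// mulr_gt0.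
case: Z Z0 hZ => [z||] Z0 hZ; [|by rewrite gt0_muley ?lte_fin ?leey|by []].
pose F := lv_norm v f.
pose Phi k := mixed_norm p (F \_ (@Q0 R n (2 ^+ k * s))).
have sk0 k : (0 < 2 ^+ k * s)%R by rewrite mulr_gt0// exprn_gt0.
have Phi_le k : Phi k <= (z * (theta ^+ k)^-1 * (2 ^+ k * s) `^ lam)%:E.
  have := hZ k; rewrite muleA -EFinM -/(Phi k) -lee_pdivlMl; last first.
    by rewrite mulr_gt0 ?exprn_gt0 ?powR_gt0.
  move=> /le_trans; apply; rewrite -EFinM lee_fin powRN invfM invrK.
  by rewrite mulrC mulrA.
pose B k := lv_norm v (fun j (_ : unit) => ball_avg (f j) (2 ^+ k * s)) tt.
(* The l^v norm of the k-th averages is at most d theta^k. *)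
pose d := (K1 * z * s `^ (- (sigma - lam)))%R.
have dd0 : (0 <= d)%R by rewrite !mulr_ge0 ?powR_ge0// ltW.
have B_le k : B k <= (d * theta ^+ k)%:E.
  apply: (le_trans (lv_ball_avg_le n0 p1 v1 C00 (sk0 k) f0 mf HC0)); rewrite -/F -/(Phi k) -/sigma.
  apply: (le_trans (lee_wpmul2l _ (Phi_le k))).
    by rewrite lee_fin mulr_ge0 ?invr_ge0 ?powR_ge0// mulr_ge0 ?exprn_ge0// ltW.
  rewrite -EFinM lee_fin le_eqVlt; apply/orP; left; apply/eqP.
  rewrite -[in RHS](thE k) /d /K1.
  rewrite (_ : 2 * (2 ^+ k * s / n%:R) = (2 / n%:R) * (2 ^+ k * s))%R; last by field; rewrite gt_eqF.
  have n2 : (0 <= 2 / n%:R :> R)%R by rewrite divr_ge0// ltW.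
  have k2 : (0 < 2 ^+ k :> R)%R by rewrite exprn_gt0.
  have sne0 : s != 0%R by rewrite gt_eqF.
  have kne0 : (2 ^+ k)%R != 0%R :> R by rewrite gt_eqF.
  rewrite (@powRM _ _ _ sigma n2 (ltW (sk0 k))).
  rewrite !(@powRM _ _ _ _ (ltW k2) (ltW s0)).
  rewrite opprB (powRD (x := s)) ?sne0 ?implybT// (powRD (x := (2 ^+ k)%R)) ?kne0 ?implybT// !powRN.
  by field; rewrite !gt_eqF ?powR_gt0 ?divr_gt0 ?exprn_gt0.
(* Summing the geometric series of ratio theta^v. *)
have D_le : (\sum_(0 <= k <oo) B k `^ v) `^ v^-1 <= (d * G)%:E.
  apply: (@le_trans _ _ (((d * G) `^ v)%:E `^ v^-1)); last first.
    by rewrite -poweR_EFin poweRVK ?gt_eqF// lee_fin mulr_ge0// ltW.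
  apply: lee_poweR; first by rewrite invr_ge0 ltW.
    by apply: nneseries_ge0 => k _ _; exact: poweR_ge0.
  apply: (@le_trans _ _ (\sum_(0 <= k <oo) (((theta `^ v) ^+ k)%:E * (d `^ v)%:E))).
    apply: lee_nneseries => [k _ _|k _]; first exact: poweR_ge0.
    rewrite -EFinM mulrC -powR_mulrn ?powR_ge0// -powRrM (mulrC v) powRrM -powRM ?powR_ge0//.
    rewrite powR_mulrn ?(ltW th0)// -poweR_EFin; apply: lee_poweR => //; first exact: ltW.
    exact: lv_norm_ge0.
  apply: (le_trans (nneseries_geometric_le _ thv1 _)); rewrite ?powR_ge0 ?lee_fin ?powR_ge0//.
  have GE : (G `^ v = (1 - theta `^ v)^-1)%R.
    rewrite /G -powRrM mulVf; last by rewrite gt_eqF.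
    by rewrite powRr1// invr_ge0 subr_ge0 ltW.
  by rewrite (@powRM _ d G v dd0 (ltW G0)) GE mulrC.
pose H := lv_norm v (fun j => strong_max (f j \_ (@Q0 R n s))).
have fQ0 j x : 0 <= (f j \_ (@Q0 R n s)) x by exact: patch_ge0.
have mfQ j : measurable_fun setT (f j \_ (@Q0 R n s)) by exact: measurable_patch_eball.
have H0 x : 0 <= H x by exact: lv_norm_ge0.
have mH : measurable_fun setT H.
  by apply: measurable_lv_norm => j *; [exact: strong_max_ge0|exact: measurable_strong_max].
have H_le : mixed_norm p H <= (C0 * (z * s `^ lam))%:E.
  apply: (le_trans (HC0 _ fQ0 mfQ)); rewrite lv_norm_patch// EFinM lee_wpmul2l ?lee_fin ?(ltW C00)//.
  by have := Phi_le 0%N; rewrite /Phi expr0 mul1r invr1 mulr1.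
(* On Q0 r the local parts contribute H and the far parts the constant d G. *)
have pointwise x : ((lv_norm v (fun j => maximal_op (f j))) \_ (@Q0 R n r)) x <=
    (4 * K)%:E * (H x + (d * G)%:E * (\1_(Q0 r) x)%:E).
  rewrite patchE indicE; case: (boolP (x \in _)) => [/set_mem Qx|_]; last first.
    by rewrite mule0 adde0 mule_ge0 ?lv_norm_ge0// lee_fin mulr_ge0// ltW.
  pose Fj j (_ : Rn R n) := (\sum_(0 <= k <oo) ball_avg (f j) (2 ^+ k * s) `^ v) `^ v^-1.
  pose Sj j := strong_max (f j \_ (@Q0 R n s)).
  have Sj0 j y : 0 <= Sj j y by exact: strong_max_ge0.
  have Fj0 j y : 0 <= Fj j y by exact: poweR_ge0.
  apply: (@le_trans _ _ (lv_norm v (fun j x => K%:E * (Sj j x + Fj j x)) x)).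
    apply: lv_norm_mono => // j; first exact: maximal_op_ge0.
    exact: maximal_op_le_local_far.
  rewrite (@lv_normZ _ _ _ _ (fun j x => Sj j x + Fj j x))//; [|exact: ltW|]; last first.
    by move=> j; rewrite adde_ge0.
  rewrite (mulrC 4%R) EFinM -muleA mule1; apply: lee_wpmul2l; first by rewrite lee_fin ltW.
  apply: (le_trans (lv_norm_quasi_triangle v1 _ _)) => //.
  apply: lee_wpmul2l; rewrite ?lee_fin//; apply: leeD => //.
  apply: le_trans D_le; rewrite /lv_norm; apply: lee_poweR; first by rewrite invr_ge0 ltW.
    by apply: nneseries_ge0 => j _ _; exact: poweR_ge0.
  rewrite (eq_eseriesr (g := fun j => \sum_(0 <= k <oo) ball_avg (f j) (2 ^+ k * s) `^ v)).
    rewrite nneseries_interchange; last by move=> i j; exact: poweR_ge0.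
    apply: lee_nneseries => [k _ _|k _]; first by apply: nneseries_ge0 => j _ _; exact: poweR_ge0.
    rewrite /B /lv_norm poweRKV ?gt_eqF//; last by apply: nneseries_ge0 => j _ _; exact: poweR_ge0.
    rewrite le_eqVlt; apply/orP; left; apply/eqP; apply: eq_eseriesr => j _.
    by rewrite gee0_abs// ball_avg_ge0.
  move=> j _; rewrite gee0_abs// /Fj poweRKV ?gt_eqF//.
  by apply: nneseries_ge0 => k _ _; exact: poweR_ge0.
have mHd : measurable_fun setT (fun x : Rn R n => (d * G)%:E * (\1_(Q0 r) x)%:E : \bar R).
  by apply: emeasurable_funM => //; exact: measurable_indic_Q0.
have dG0 : (0 <= d * G)%R by rewrite mulr_ge0// ltW.
have Hd0 (x : Rn R n) : 0 <= (d * G)%:E * (\1_(Q0 r) x)%:E by rewrite mule_ge0// lee_fin.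
have norm_le : mixed_norm p ((lv_norm v (fun j => maximal_op (f j))) \_ (@Q0 R n r)) <=
    (4 * K * 4 ^+ n * ((C0 + K1 * G) * (z * s `^ lam)))%:E.
  apply: (le_trans (mixed_norm_mono _ _ pointwise)) => //.
    by apply: patch_ge0 => x; exact: lv_norm_ge0.
  rewrite mixed_normZ//; last 3 first.
  - by rewrite mulr_gt0.
  - by move=> x; rewrite adde_ge0 ?lv_norm_ge0.
  - exact: emeasurable_funD.
  rewrite -mulrA (EFinM (4 * K)%R); apply: lee_wpmul2l; first by rewrite lee_fin mulr_ge0// ltW.
  apply: (le_trans (mixed_norm_quasi_triangle _ _ _ _ _)) => //.
  rewrite (EFinM (4 ^+ n)%R); apply: lee_wpmul2l; first by rewrite lee_fin exprn_ge0.
  rewrite mulrDl EFinD; apply: leeD => //.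
  apply: (le_trans (mixed_normZ_le _ _ _ _)) => //; first exact: measurable_indic_Q0.
  apply: (le_trans (lee_wpmul2l _ (mixed_norm_Q0_le p1 r0))); first by rewrite lee_fin.
  rewrite -/sigma -EFinM lee_fin.
  apply: (@le_trans _ _ (d * G * s `^ sigma)%R).
    have sig0 : (0 <= sigma)%R by rewrite (le_trans lam0)// ltW.
    have r20 : (0 <= 2 * r)%R by rewrite mulr_ge0// ltW.
    rewrite ler_wpM2l//; apply: ge0_ler_powR; rewrite ?nnegrE// ?(ltW s0)//.
    rewrite /r (_ : (2 * (s / (2 * n%:R)) = s / n%:R)%R); last by field; rewrite gt_eqF.
    by rewrite ler_pdivrMr// ler_peMr ?(ltW s0)// ler1n.
  rewrite /d (_ : (- (sigma - lam) = lam + (- sigma))%R); last by rewrite opprB.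
  have sne0 : s != 0%R by rewrite gt_eqF.
  rewrite (powRD (x := s)) ?sne0 ?implybT// powRN le_eqVlt; apply/orP; left; apply/eqP.
  by field; rewrite gt_eqF// powR_gt0.
apply: (le_trans (lee_wpmul2l _ norm_le)); first by rewrite lee_fin powR_ge0.
have n2 : (0 < 2 * n%:R :> R)%R by rewrite mulr_gt0.
have sE : (s `^ lam = r `^ lam * (2 * n%:R) `^ lam)%R.
  by rewrite -powRM ?(ltW r0) ?(ltW n2)// /r divfK// gt_eqF.
have rlam : (r `^ lam)%R != 0%R by rewrite gt_eqF// powR_gt0.
rewrite -!EFinM lee_fin /C sE powRN le_eqVlt; apply/orP; left; apply/eqP.
by move: rlam; move: (r `^ lam)%R ((2 * n%:R) `^ lam)%R => a b a0; field.
Qed.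

End local_estimate.

(** * Integration over the radii *)

Section dilation.
Context {R : realType}.
Local Notation RR := (measurableTypeR R).
Local Notation mu := (@lebesgue_measure R).

Lemma lebesgue_measure_dilation (c : R) (A : set RR) : (0 < c)%R -> measurable A ->
  mu A = c%:E * mu ((fun x : RR => (c * x)%R : RR) @^-1` A).
Proof.
move=> c0 mA.
have mphi : measurable_fun setT (fun x : RR => (c * x)%R : RR) by exact: measurable_funM.
pose nu : {measure set RR -> \bar R} := mscale (NngNum (ltW c0))
  (measure_function_pushforward__canonical__measure_function_Measure mu mphi).
(* It suffices to compare the two measures on half-open intervals. *)
apply: (@lebesgue_measure_unique R nu) => // _ [[a b] _ <-] /=.
rewrite /nu /mscale /= /pushforward (_ : _ @^-1` _ = `](a / c)%R, (b / c)%R]%classic); last first.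
  by apply/seteqP; split => x /=; rewrite !in_itv/= ltr_pdivrMr// ler_pdivlMr// mulrC.
rewrite !lebesgue_measure_itv/= !lte_fin ltr_pM2r ?invr_gt0//.
case: ifPn => _; last by rewrite mule0.
by rewrite -!EFinB -EFinM mulrBr !(mulrC c) !divfK// gt_eqF.
Qed.

(** The measure dr / r is invariant under dilations. *)
Lemma integral_dilation (c : R) (g : RR -> \bar R) : (0 < c)%R ->
  (forall x, 0 <= g x) -> measurable_fun setT g ->
  \int[mu]_(r in `]0%R, +oo[) (g (c * r)%R * (r^-1)%:E) =
  \int[mu]_(r in `]0%R, +oo[) (g r * (r^-1)%:E).
Proof.
move=> c0 g0 mg.
have mphi : measurable_fun setT (fun x : RR => (c * x)%R : RR) by exact: measurable_funM.
pose nu : {measure set RR -> \bar R} := mscale (NngNum (ltW c0))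
  (measure_function_pushforward__canonical__measure_function_Measure mu mphi).
pose D := (`]0%R, +oo[%classic : set RR).
have mD : measurable D by exact: measurable_itv.
pose h (r : RR) := g r * (r `^ (-1))%:E.
have mh : measurable_fun setT h.
  apply: emeasurable_funM => //; apply/measurable_EFinP.
  exact: measurableT_comp_powR.
have h0 r : 0 <= h r by rewrite mule_ge0// lee_fin powR_ge0.
have hE u : \int[mu]_(r in D) (u r * (r^-1)%:E) = \int[mu]_(r in D) (u r * (r `^ (-1))%:E).
  apply: eq_integral => r /set_mem; rewrite /D/= in_itv/= andbT => r0.
  by rewrite powR_inv1// ltW.
rewrite (hE g) (hE (fun r => g (c * r)%R)).
have -> : \int[mu]_(r in D) (g r * (r `^ (-1))%:E) = \int[nu]_(r in D) h r.
  apply: eq_measure_integral => A mA _.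
  exact: lebesgue_measure_dilation.
rewrite ge0_integral_mscale//; last exact: measurable_funTS.
rewrite (@ge0_integral_pushforward _ _ _ _ R _ mphi mu D h mD); last 2 first.
- exact: measurable_funTS.
- by move=> r _.
rewrite (_ : _ @^-1` D = D); last first.
  by apply/seteqP; split => x; rewrite /D/= !in_itv/= !andbT pmulr_rgt0.
rewrite -ge0_integralZl_EFin//; last 2 first.
- by move=> r _; exact: h0.
- by apply: measurable_funTS; exact: (measurableT_comp mh mphi).
apply: eq_integral => r /set_mem; rewrite /D/= in_itv/= andbT => r0.
rewrite /h/= powRM ?(ltW c0) ?(ltW r0)// !powR_inv1 ?(ltW c0) ?(ltW r0)// EFinM.
by rewrite muleCA; congr (_ * _); rewrite -!EFinM mulrA divff ?mul1r// gt_eqF.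
Qed.

End dilation.

Section morrey_norm_borel.
Context {R : realType}.
Local Notation RR := (measurableTypeR R).
Local Notation mu := (@lebesgue_measure R).

Lemma measurable_mixed_norm_param d (T : measurableType d) n (p : n.-tuple R)
    (f : T * Rn R n -> \bar R) : (forall z, 0 <= f z) -> measurable_fun setT f ->
  measurable_fun setT (fun w => mixed_norm p (fun x => f (w, x))).
Proof.
elim: n p f => [|n IH] p f f0 mf /=.
  by apply: measurableT_comp => //; exact: (measurableT_comp mf (pair2_measurable _)).
apply: (IH _ (fun z => Lnorm mu (thead p)%:E (fun t : RR => f (z.1, [tuple of t :: z.2])))).
  by move=> z; exact: Lnorm_ge0.
exact: measurable_Lnorm_param.
Qed.

Lemma measurable_mixed_norm_Q0 n (p : n.-tuple R) (F : Rn R n -> \bar R) :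
  (forall x, 0 <= F x) -> measurable_fun setT F ->
  measurable_fun setT (fun r : RR => mixed_norm p (F \_ (@Q0 R n r))).
Proof.
move=> F0 mF; pose D := [set z : RR * Rn R n | Q0 (z.1 : R) z.2].
have mdist : measurable_fun setT (fun z : RR * Rn R n =>
    ((z.1 : R) - eucl_dist z.2 [tuple of nseq n 0%R])%R).
  apply: measurable_funB => //.
  exact: (measurableT_comp (measurable_eucl_dist _) measurable_snd).
have mD : measurable D.
  have -> : D = setT `&` (fun z : RR * Rn R n =>
      ((z.1 : R) - eucl_dist z.2 [tuple of nseq n 0%R])%R) @^-1` `]0%R, +oo[%classic.
    rewrite setTI; by apply/seteqP; split => -[r x]; rewrite /D/= in_itv/= andbT subr_gt0.
  by apply: mdist => //; exact: measurable_itv.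
have mF2 : measurable_fun setT (fun z : RR * Rn R n => F z.2) by exact: (measurableT_comp mF).
have := @measurable_mixed_norm_param _ RR n p ((fun z => F z.2) \_ D).
move=> /(_ (patch_ge0 _ (fun z => F0 z.2))) H; have {}H := H ((measurable_restrictT _ mD).1 _).
rewrite (_ : (fun r => _) = (fun r : RR => mixed_norm p (fun x => ((fun z : RR * Rn R n => F z.2) \_ D) (r, x)))).
  by apply: H; exact: measurable_funTS.
apply/funext => r; apply: eq_mixed_norm => x; rewrite !patchE.
suff -> : (x \in Q0 (r : R)) = ((r, x) \in D) by [].
by apply/idP/idP => /set_mem ?; exact: mem_set.
Qed.

(** In local_estimate take for Z the norm of F itself if q is infinite. For finite
    q take the l^q norm of the sequence theta^k N(2^k s): by integral_dilation each
    term contributes theta^(k q) times the q-th power of the norm of F, and the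
    geometric series converges. Comparing sums of q-th powers covers q < 1 as well. *)
Theorem morrey_maximal_borel n (p : n.-tuple R) (q : \bar R) (v lam : R) : (0 < n)%N ->
  exponents_gt1 p -> 0 < q -> (1 < v)%R -> (0 <= lam)%R ->
  (lam < \sum_(i < n) (tnth p i)^-1)%R ->
  exists2 C : R, (0 < C)%R & forall f : nat -> Rn R n -> \bar R,
    (forall j x, 0 <= f j x) -> (forall j, measurable_fun setT (f j)) ->
    local_morrey_norm p lam q (lv_norm v (fun j => maximal_op (f j))) <=
    C%:E * local_morrey_norm p lam q (lv_norm v f).
Proof.
move=> n0 p1 q0 v1 lam0 lam_lt; have v0 := lt_trans ltr01 v1.
have [theta [C [th0 th1 C0 HC]]] := local_estimate n0 p1 v1 lam0 lam_lt.
have n2 : (0 < 2 * n%:R :> R)%R by rewrite mulr_gt0// ltr0n.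
have rE (r : R) : (2 * n%:R * r / (2 * n%:R) = r)%R by rewrite (mulrC _ r) mulfK// gt_eqF.
case: q q0 => [q|_|//]; last first.
  exists C => // f f0 mf; rewrite /local_morrey_norm.
  set N := fun r => _ * mixed_norm p (lv_norm v f \_ _).
  have N0 r : 0 <= N r by rewrite mule_ge0 ?mixed_norm_ge0// lee_fin powR_ge0.
  have Z0 : 0 <= ereal_sup [set N r | r in `]0%R, +oo[].
    apply: (le_trans (N0 1%R)); apply: ereal_sup_ubound.
    by exists 1%R => //=; rewrite in_itv/= ltr01.
  apply: ub_ereal_sup => _ [r /= r0 <-]; rewrite in_itv/= andbT in r0.
  have s0 := mulr_gt0 n2 r0.
  have := HC f f0 mf (2 * n%:R * r)%R _ s0 Z0; rewrite rE; apply=> k.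
  have sk0 : (0 < 2 ^+ k * (2 * n%:R * r))%R by rewrite mulr_gt0// exprn_gt0.
  apply: (@le_trans _ _ (N (2 ^+ k * (2 * n%:R * r))%R)).
    rewrite -[leRHS]mul1e; apply: lee_wpmul2r; first exact: N0.
    by rewrite lee_fin exprn_ile1// ltW.
  apply: ereal_sup_ubound; exists (2 ^+ k * (2 * n%:R * r))%R => //=.
  by rewrite in_itv/= andbT.
rewrite lte_fin => q0.
have thq0 : (0 <= theta `^ q)%R by exact: powR_ge0.
have thq1 : (theta `^ q < 1)%R.
  rewrite [ltRHS](_ : _ = (1 `^ q))%R; last by rewrite powR1.
  by rewrite gt0_ltr_powR ?nnegrE// ltW.
have G0 : (0 < (1 - theta `^ q)^-1)%R by rewrite invr_gt0 subr_gt0.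
pose G := ((1 - theta `^ q)^-1)%R.
exists ((C `^ q * G) `^ q^-1)%R => [|f f0 mf]; first by rewrite powR_gt0// mulr_gt0// powR_gt0.
pose NF (F : Rn R n -> \bar R) (r : RR) :=
  ((r : R) `^ (- lam))%:E * mixed_norm p (F \_ (@Q0 R n r)).
pose NM := NF (lv_norm v (fun j => maximal_op (f j))); pose N := NF (lv_norm v f).
pose I := \int[mu]_(r in `]0%R, +oo[) (N r `^ q * (r^-1)%:E).
change ((\int[mu]_(r in `]0%R, +oo[) (NM r `^ q * (r^-1)%:E)) `^ q^-1 <=
  ((C `^ q * G) `^ q^-1)%:E * I `^ q^-1).
have N0 r : 0 <= N r by rewrite mule_ge0 ?mixed_norm_ge0// lee_fin powR_ge0.
have NM0 r : 0 <= NM r by rewrite mule_ge0 ?mixed_norm_ge0// lee_fin powR_ge0.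
have Nq0 r : 0 <= N r `^ q by exact: poweR_ge0.
have mNq : measurable_fun setT (fun r : RR => N r `^ q).
  apply: measurableT_comp_poweR; apply: emeasurable_funM.
    by apply/measurable_EFinP; exact: measurableT_comp_powR.
  apply: measurable_mixed_norm_Q0; first by move=> x; exact: lv_norm_ge0.
  exact: measurable_lv_norm.
have I0 : 0 <= I.
  apply: integral_ge0 => r /=; rewrite in_itv/= andbT => r0.
  by rewrite mule_ge0// lee_fin invr_ge0 ltW.
pose c k : R := (2 ^+ k * (2 * n%:R))%R.
have c0 k : (0 < c k)%R by rewrite mulr_gt0// exprn_gt0.
have NM_le r : (0 < r)%R ->
    NM r `^ q <= (C `^ q)%:E * \sum_(0 <= k <oo) (((theta `^ q) ^+ k)%:E * N (c k * r)%R `^ q).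
  move=> r0; set Z := \sum_(0 <= k <oo) _.
  have term0 k : 0 <= ((theta `^ q) ^+ k)%:E * N (c k * r)%R `^ q.
    by rewrite mule_ge0// lee_fin exprn_ge0.
  have Z0 : 0 <= Z by apply: nneseries_ge0 => k _ _.
  have s0 := mulr_gt0 n2 r0.
  have H : NM r <= C%:E * Z `^ q^-1.
    have := HC f f0 mf (2 * n%:R * r)%R (Z `^ q^-1) s0 (poweR_ge0 _ _); rewrite rE; apply=> k.
    rewrite mulrA; change ((theta ^+ k)%:E * N (c k * r)%R <= Z `^ q^-1).
    rewrite -[leLHS](@poweRVK _ _ q) ?gt_eqF//; last by rewrite mule_ge0// lee_fin exprn_ge0// ltW.
    apply: lee_poweR; [by rewrite invr_ge0 ltW|exact: poweR_ge0|].
    rewrite poweRM//; last by rewrite lee_fin exprn_ge0// ltW.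
    rewrite poweR_EFin -powR_mulrn ?(ltW th0)// -powRrM mulrC powRrM powR_mulrn//.
    exact: nneseries_ge_term.
  rewrite -(poweR_EFin C) -[X in _ * X](@poweRKV _ _ q) ?gt_eqF// -poweRM ?poweR_ge0//.
    by apply: lee_poweR => //; exact: ltW.
  by rewrite lee_fin ltW.
have main : \int[mu]_(r in `]0%R, +oo[) (NM r `^ q * (r^-1)%:E) <= (C `^ q * G)%:E * I.
  apply: (@le_trans _ _ (\int[mu]_(r in `]0%R, +oo[) ((C `^ q)%:E *
      \sum_(0 <= k <oo) (((theta `^ q) ^+ k)%:E * (N (c k * r)%R `^ q * (r^-1)%:E))))).
    apply: ge0_le_integralW => r /=; rewrite in_itv/= andbT => r0.
      by rewrite mule_ge0 ?poweR_ge0// lee_fin invr_ge0 ltW.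
    apply: (le_trans (lee_wpmul2r _ (NM_le r r0))).
      by rewrite lee_fin invr_ge0 ltW.
    rewrite -muleA; apply: lee_wpmul2l; first by rewrite lee_fin powR_ge0.
    rewrite muleC -nneseriesZl; last by move=> k _; rewrite mule_ge0// lee_fin exprn_ge0.
    rewrite le_eqVlt; apply/orP; left; apply/eqP; apply: eq_eseriesr => k _.
    by rewrite muleCA [_ * N _ `^ _]muleC.
  have mNr k : measurable_fun (`]0%R, +oo[%classic : set RR) (fun r : RR => N (c k * r)%R `^ q * (r^-1)%:E).
    apply: (eq_measurable_fun (fun r : RR => N (c k * r)%R `^ q * (r `^ (-1))%:E)).
      by move=> r /set_mem; rewrite /= in_itv/= andbT => r0; rewrite powR_inv1// ltW.
    apply: measurable_funTS; apply: emeasurable_funM.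
      apply: (measurableT_comp mNq (_ : measurable_fun setT (fun r : RR => (c k * r)%R : RR))).
      exact: measurable_funM.
    by apply/measurable_EFinP; exact: measurableT_comp_powR.
  have mterm k : measurable_fun (`]0%R, +oo[%classic : set RR)
      (fun r : RR => ((theta `^ q) ^+ k)%:E * (N (c k * r)%R `^ q * (r^-1)%:E)).
    by apply: emeasurable_funM.
  have term0 k (r : RR) : (`]0%R, +oo[%classic : set RR) r ->
      0 <= ((theta `^ q) ^+ k)%:E * (N (c k * r)%R `^ q * (r^-1)%:E).
    rewrite /= in_itv/= andbT => r0.
    by rewrite mule_ge0 ?lee_fin ?exprn_ge0// mule_ge0// lee_fin invr_ge0 ltW.
  rewrite ge0_integralZl_EFin ?powR_ge0//; last 2 first.
  - by move=> r r0; apply: nneseries_ge0 => k _ _; exact: term0.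
  - by apply: ge0_emeasurable_sum => [k r r0 _|k _]; [exact: term0|exact: mterm].
  rewrite EFinM -muleA; apply: lee_wpmul2l; first by rewrite lee_fin powR_ge0.
  rewrite integral_nneseries//.
  apply: le_trans (nneseries_geometric_le thq0 thq1 I0).
  apply: lee_nneseries => [k _ _|k _]; first by apply: integral_ge0 => r r0; exact: term0.
  have <- : \int[mu]_(r in `]0%R, +oo[) (N (c k * r)%R `^ q * (r^-1)%:E) = I.
    exact: (integral_dilation (c0 k) Nq0 mNq).
  have nonneg (r : RR) : (`]0%R, +oo[%classic : set RR) r -> 0 <= N (c k * r)%R `^ q * (r^-1)%:E.
    by rewrite /= in_itv/= andbT => r0; rewrite mule_ge0// lee_fin invr_ge0 ltW.
  have thk : (0 <= (theta `^ q) ^+ k)%R by exact: exprn_ge0.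
  by rewrite (ge0_integralZl_EFin mu (measurable_itv _) nonneg (mNr k) thk).
apply: (@le_trans _ _ (((C `^ q * G)%:E * I) `^ q^-1)).
  apply: lee_poweR => //; first by rewrite invr_ge0 ltW.
  by apply: integral_ge0 => r /=; rewrite in_itv/= andbT => r0;
    rewrite mule_ge0 ?poweR_ge0// lee_fin invr_ge0 ltW.
by rewrite poweRM// lee_fin mulr_ge0 ?powR_ge0// ltW.
Qed.

End morrey_norm_borel.

(** * Lebesgue measurable functions *)

Section borel_minorant.
Import HBNNSimple.
Context d (T : measurableType d) (R : realType).
Variable mu : {measure set T -> \bar R}.

Definition measurable_off_null (A : set T) := exists Z : set T,
  [/\ measurable Z, mu Z = 0 & measurable (A `\` Z)].

(** Being measurable off a null set is stable under the operations of a
    sigma-algebra. *)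
Lemma completed_measurable_off_null (A : set T) :
  @measurable _ (g_sigma_algebraType (completed_algebra_gen mu)) A -> measurable_off_null A.
Proof.
suff : <<s completed_algebra_gen mu >> `<=` measurable_off_null by apply.
apply: smallest_sub.
  split.
  - by exists set0; rewrite measure0 set0D.
  - move=> B [Z [mZ Z0 mBZ]]; exists Z; split => //.
    rewrite (_ : setT `\` B `\` Z = ~` Z `\` (B `\` Z)).
      by apply: measurableD => //; exact: measurableC.
    apply/seteqP; split => x /=.
      by move=> [[_ nB] nZ]; split => // -[].
    by move=> [nZ nBZ]; split => //; split => // Bx; exact: nBZ.
  - move=> F FZ; pose Z k := projT1 (cid (FZ k)).
    have hZ k : [/\ measurable (Z k), mu (Z k) = 0 & measurable (F k `\` Z k)].
      by rewrite /Z; case: cid.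
    have mZ : measurable (\bigcup_k Z k) by apply: bigcupT_measurable => k; have [] := hZ k.
    exists (\bigcup_k Z k); split => //.
      apply/negligibleP => //; apply: negligible_bigcup => k.
      by have [mZk Z0 _] := hZ k; exact/negligibleP.
    rewrite (_ : _ `\` _ = (\bigcup_k (F k `\` Z k)) `\` \bigcup_k Z k).
      by apply: measurableD => //; apply: bigcupT_measurable => k; have [] := hZ k.
    apply/seteqP; split => x /=.
      by move=> [[k _ Fx] nZ]; split => //; exists k => //; split => // Zx; apply: nZ; exists k.
    by move=> [[k _ [Fx _]] nZ]; split => //; exists k.
move=> _ [B mB [N [Z [mZ Z0 NZ]]] <-]; exists Z; split => //.
rewrite (_ : _ `\` Z = B `\` Z); first exact: measurableD.
apply/seteqP; split => x /=; first by move=> [[Bx|/NZ Zx] nZ].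
by move=> [Bx nZ]; split => //; left.
Qed.

(** A simple function below f keeps its integral when it is cut off on Z, and is
    then below g. *)
Lemma ge0_le_integral_off_null (Z : set T) (f g : T -> \bar R) : measurable Z -> mu Z = 0 ->
  (forall x, 0 <= f x) -> (forall x, 0 <= g x) -> (forall x, ~ Z x -> f x <= g x) ->
  \int[mu]_x f x <= \int[mu]_x g x.
Proof.
move=> mZ Z0 f0 g0 fg; rewrite (ge0_integralTE mu f0).
apply: ub_ereal_sup => _ [h hf <-]; rewrite -integralT_nnsfun.
have mh : measurable_fun setT (EFin \o h) by apply/measurable_EFinP.
rewrite (ge0_negligible_integral mZ measurableT mh _ Z0); last first.
  by move=> x _; rewrite lee_fin.
rewrite integral_mkcond; apply: ge0_le_integralW => x _.
  by rewrite patchE; case: ifPn => //; rewrite lee_fin.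
rewrite patchE; case: ifPn => // /set_mem[_ nZ].
exact: le_trans (hf x) (fg x nZ).
Qed.

(** Absolute values of rationals: every level is nonnegative, and every nonnegative
    rational occurs. *)
Definition rat_level (k : nat) : R :=
  `|if (unpickle k : option rat) is Some a then ratr a else 0|%R.

(** The sets on which f > q, for q rational, are measurable once null sets are
    removed from them. The supremum of the functions equal to q on these smaller
    sets and to 0 elsewhere is measurable, is at most f, and equals f off a null
    set. *)
Lemma exists_borel_minorant (f : T -> \bar R) : (forall x, 0 <= f x) ->
  measurable_fun [set: g_sigma_algebraType (completed_algebra_gen mu)] f ->
  exists g : T -> \bar R, [/\ measurable_fun setT g, (forall x, 0 <= g x <= f x) &
    forall A, \int[mu]_(x in A) f x <= \int[mu]_(x in A) g x].
Proof.
move=> f0 mf.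
have level_off_null k : measurable_off_null [set x | (rat_level k)%:E < f x].
  apply: completed_measurable_off_null.
  have -> : [set x | (rat_level k)%:E < f x] = setT `&` f @^-1` `](rat_level k)%:E, +oo[%classic.
    by rewrite setTI; apply/seteqP; split => x /=; rewrite in_itv/= andbT.
  by apply: mf => //; exact: emeasurable_itv.
pose Zk k := projT1 (cid (level_off_null k)).
have hZ k : [/\ measurable (Zk k), mu (Zk k) = 0 &
    measurable ([set x | (rat_level k)%:E < f x] `\` Zk k)].
  by rewrite /Zk; case: cid.
pose Z := \bigcup_k Zk k.
have mZ : measurable Z by apply: bigcupT_measurable => k; have [] := hZ k.
have Z0 : mu Z = 0.
  apply/negligibleP => //; apply: negligible_bigcup => k.
  by have [mZk Z0 _] := hZ k; exact/negligibleP.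
pose B k := [set x | (rat_level k)%:E < f x] `\` Zk k.
pose F k x := (rat_level k)%:E * (\1_(B k) x)%:E.
pose g x := ereal_sup (range (F ^~ x)).
have F0 k x : 0 <= F k x by rewrite mule_ge0// lee_fin normr_ge0.
have g0 x : 0 <= g x.
  by apply: (le_trans (F0 0%N x)); apply: ereal_sup_ubound; exists 0%N.
exists g; split.
- apply: measurable_ereal_supT => k; apply: emeasurable_funM => //.
  by apply/measurable_EFinP; apply: measurable_indic; have [] := hZ k.
- move=> x; rewrite g0/=; apply: ub_ereal_sup => _ [k _ <-].
  rewrite /F indicE; case: (boolP (x \in B k)) => [/set_mem[/= /ltW h _]|_].
    by rewrite mule1.
  by rewrite mule0.
- move=> A; rewrite (integral_mkcond _ f) (integral_mkcond _ g).
  apply: (ge0_le_integral_off_null mZ Z0); [exact: patch_ge0|exact: patch_ge0|].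
  move=> x nZ; rewrite !patchE; case: ifPn => // _.
  rewrite leNgt; apply/negP => gf.
  have gfin : g x \is a fin_num by rewrite ge0_fin_numE// (lt_le_trans gf)// leey.
  have [r rE] : exists r, g x = r%:E by exists (fine (g x)); rewrite fineK.
  have r0 : (0 <= r)%R by have := g0 x; rewrite rE lee_fin.
  have [s rs sf] : exists2 s, (r < s)%R & s%:E <= f x.
    move: gf; rewrite rE; case: (f x) => [t rt|_|]; [exists t => //| |by []].
    by exists (r + 1)%R; rewrite ?ltrDl ?leey.
  have [a /=] := rat_in_itvoo rs; rewrite in_itv/= => /andP[ra as_].
  have aE : rat_level (pickle a) = ratr a.
    by rewrite /rat_level pickleK ger0_norm// (le_trans r0)// ltW.
  have : (ratr a)%:E <= g x.
    rewrite -aE; apply: ereal_sup_ubound; exists (pickle a) => //.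
    rewrite /F indicE mem_set ?mule1//; split.
      by rewrite /= aE (lt_le_trans _ sf).
    by move=> Zx; apply: nZ; exists (pickle a).
  by rewrite rE lee_fin leNgt ra.
Qed.

End borel_minorant.

Section morrey_maximal.
Context {R : realType}.
Local Notation RR := (measurableTypeR R).
Local Notation mu := (@lebesgue_measure R).

Lemma local_morrey_norm_mono n (p : n.-tuple R) (q : \bar R) (lam : R)
    (F G : Rn R n -> \bar R) : exponents_gt1 p -> 0 < q ->
  (forall x, 0 <= F x) -> (forall x, F x <= G x) ->
  local_morrey_norm p lam q F <= local_morrey_norm p lam q G.
Proof.
move=> p1 q0 F0 FG.
have N_le r : (r `^ (- lam))%:E * mixed_norm p (F \_ (@Q0 R n r)) <=
    (r `^ (- lam))%:E * mixed_norm p (G \_ (@Q0 R n r)).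
  apply: lee_wpmul2l; first by rewrite lee_fin powR_ge0.
  apply: mixed_norm_mono => // [x|x]; first exact: patch_ge0.
  by rewrite !patchE; case: ifPn.
have N_ge0 (H : Rn R n -> \bar R) r : 0 <= (r `^ (- lam))%:E * mixed_norm p (H \_ (@Q0 R n r)).
  by rewrite mule_ge0 ?mixed_norm_ge0// lee_fin powR_ge0.
case: q q0 => [q|_|//]; last first.
  apply: ub_ereal_sup => _ [r /= r0 <-]; apply: (le_trans (N_le r)).
  by apply: ereal_sup_ubound; exists r.
rewrite lte_fin => q0 /=; apply: lee_poweR; first by rewrite invr_ge0 ltW.
  apply: integral_ge0 => r /=; rewrite in_itv/= andbT => r0.
  by rewrite mule_ge0 ?poweR_ge0// lee_fin invr_ge0 ltW.
apply: ge0_le_integralW => r /=; rewrite in_itv/= andbT => r0.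
  by rewrite mule_ge0 ?poweR_ge0// lee_fin invr_ge0 ltW.
apply: lee_wpmul2r; first by rewrite lee_fin invr_ge0 ltW.
by apply: lee_poweR => //; exact: ltW.
Qed.

End morrey_maximal.

Theorem theorem3p2 (R : realType) (n : nat) (p : n.-tuple R) (q : \bar R)
    (v lam : R) (hn : (0 < n)%N) (hp : forall i : 'I_n, (1 < tnth p i)%R)
    (hq : 0 < q) (hv : (1 < v)%R) (hlam0 : (0 <= lam)%R)
    (hlam : (lam < \sum_(i < n) (tnth p i)^-1)%R) :
  exists2 C : R, (0 < C)%R &
    forall f : nat -> Rn R n -> \bar R,
      (forall j, lebesgue_measurable_fun (f j)) ->
      local_morrey_norm p lam q (lv_norm v (fun j => maximal_op (f j)))
      <= C%:E * local_morrey_norm p lam q (lv_norm v f).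
Proof.
have [C C0 HC] := morrey_maximal_borel hn hp hq hv hlam0 hlam; exists C => // f mf.
have v0 := lt_trans ltr01 hv.
have /choice[g gP] : forall j, exists g : Rn R n -> \bar R,
    [/\ measurable_fun setT g, (forall x, 0 <= g x <= `|f j x|) &
     forall A, \int[lebesgueRn n]_(x in A) `|f j x| <= \int[lebesgueRn n]_(x in A) g x].
  move=> j; apply: exists_borel_minorant => //.
  by apply: measurableT_comp => //; exact: mf.
have g0 j x : 0 <= g j x by have [_ /(_ x) /andP[]] := gP j.
have mg j : measurable_fun setT (g j) by have [] := gP j.
have maximal_le x : lv_norm v (fun j => maximal_op (f j)) x <= lv_norm v (fun j => maximal_op (g j)) x.
  apply: (lv_norm_mono v0) => j; first exact: maximal_op_ge0.
  apply: ub_ereal_sup => _ [b hb <-].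
  apply: (@le_trans _ _ ((\int[lebesgueRn n]_(y in eball b.1 b.2) `|g j y|)
           / lebesgueRn n (eball b.1 b.2))); last by apply: ereal_sup_ubound; exists b.
  apply: lee_wpmul2r; first by rewrite inve_ge0.
  have [_ _ /(_ (eball b.1 b.2))] := gP j; move=> /le_trans; apply.
  by apply: ge0_le_integralW => y _; [exact: g0|rewrite gee0_abs].
have norm_le x : lv_norm v g x <= lv_norm v f x.
  rewrite /lv_norm; apply: lee_poweR; first by rewrite invr_ge0 ltW.
    by apply: nneseries_ge0 => j _ _; exact: poweR_ge0.
  apply: lee_nneseries => [j _ _|j _]; first exact: poweR_ge0.
  apply: lee_poweR; [exact: ltW|by []|].
  by rewrite gee0_abs//; have [_ /(_ x) /andP[]] := gP j.
apply: (le_trans (local_morrey_norm_mono lam hp hq _ maximal_le)).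
  by move=> x; exact: lv_norm_ge0.
apply: (le_trans (HC g g0 mg)); apply: lee_wpmul2l; first by rewrite lee_fin ltW.
apply: (local_morrey_norm_mono lam hp hq _ norm_le).
by move=> x; exact: lv_norm_ge0.
Qed.
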